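(* Let $1\le p<t<r<\infty$. Let $W\in\mathcal{A}_p$ be a matrix weight with the $\mathcal{A}_p$-dimension $\tilde d\in[0,n)$, and, if $p>1$, let $\widetilde W:=W^{-1/(p-1)}$ (which belongs to $\mathcal{A}_{p'}$) have the $\mathcal{A}_{p'}$-dimension $\tilde{\tilde d}$. Let $$\tilde\beta:=\begin{cases} n, & p=1,\\ n+\tilde{\tilde d}\,p/p', & 1<p<\infty,\end{cases}$$ and suppose $-nr/p+\tilde d r/p+n-\tilde\beta r(1/t-1/p)<0$. A subset $\mathcal{F}$ of $M_p^{t,r}(W)$ is totally bounded if and only if the following conditions hold: (i) $\mathcal{F}$ is bounded, that is, $\sup_{\vec f\in\mathcal{F}}\|\vec f\|_{M_p^{t,r}(W)}<\infty$; (ii) $\mathcal{F}$ uniformly vanishes at infinity, that is, $$\lim_{R\to\infty}\ \sup_{\vec f\in\mathcal{F}}\|\vec f\chi_{B^c(0,R)}\|_{M_p^{t,r}(W)}=0;$$ (iii) $\mathcal{F}$ is equicontinuous by means of the dyadic average operator, that is, $$\lim_{a\to-\infty,\ a\in\mathbb{Z}}\ \sup_{\vec f\in\mathcal{F}}\|\vec f-E_{d,a}\vec f\|_{M_p^{t,r}(W)}=0.$$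
   Context: $n,d\in\mathbb{N}$; $M_d(\mathbb{C})$ is the set of $d\times d$ complex matrices, $\|A\|=\sup_{|\vec z|=1}|A\vec z|$ is the operator norm with respect to the Euclidean norm $|\cdot|$ on $\mathbb{C}^d$. A matrix weight is a function $W:\mathbb{R}^n\to M_d(\mathbb{C})$ such that $W(x)$ is nonnegative definite for every $x$, $W(x)$ is invertible for almost every $x$, and the entries of $W$ are locally integrable. Powers $W^\alpha(x)$ are defined (for a.e. $x$) by diagonalization: if $W(x)=U\,\mathrm{diag}(\lambda_i)U^*$ with $U$ unitary, then $W^\alpha(x)=U\,\mathrm{diag}(\lambda_i^\alpha)U^*$. For $1<p<\infty$, $p'=p/(p-1)$. Class $\mathcal{A}_p$: for $1<p<\infty$, $W\in\mathcal{A}_p$ iff $\sup_Q\frac1{|Q|}\int_Q\left(\frac1{|Q|}\int_Q\|W^{1/p}(x)W^{-1/p}(y)\|^{p'}dy\right)^{p/p'}dx<\infty$; for $0<p\le1$, $W\in\mathcal{A}_p$ iff $\sup_Q\operatorname{ess\,sup}_{y\in Q}\frac1{|Q|}\int_Q\|W^{1/p}(x)W^{-1/p}(y)\|^p dx<\infty$; suprema over all cubes $Q\subset\mathbb{R}^n$. $\mathcal{A}_p$-dimension: $W$ has the $\mathcal{A}_p$-dimension $\tilde d\in\mathbb{R}$ if there is $C>0$ such that for every cube $Q\subset\mathbb{R}^n$ and every $i\in\mathbb{N}_0=\{0,1,2,\dots\}$: if $0<p\le1$, $\operatorname{ess\,sup}_{y\in2^iQ}\frac1{|Q|}\int_Q\|W^{1/p}(x)W^{-1/p}(y)\|^pdx\le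 C2^{i\tilde d}$; if $1<p<\infty$, $\frac1{|Q|}\int_Q\left(\frac1{|2^iQ|}\int_{2^iQ}\|W^{1/p}(x)W^{-1/p}(y)\|^{p'}dy\right)^{p/p'}dx\le C2^{i\tilde d}$. Here $\lambda Q$ is the cube with the same center as $Q$ and side length $\lambda\ell(Q)$. $L^p_{\mathrm{loc}}(W)$ is the set of measurable $\vec f:\mathbb{R}^n\to\mathbb{C}^d$ with $\int_K |W^{1/p}(x)\vec f(x)|^p\,dx<\infty$ for every compact $K$. For $j\in\mathbb{Z}$, $k\in\mathbb{Z}^n$, $Q_{j,k}=\prod_{i=1}^n[2^{-j}k_i,2^{-j}(k_i+1))$ are the dyadic cubes, and $\mathcal{D}_j=\{Q_{j,k}:k\in\mathbb{Z}^n\}$. For a cube $Q$, $W(Q):=\int_Q\|W(y)\|\,dy$. For $0<p<t<r<\infty$ or $0<p\le t<r=\infty$, the matrix weighted Bourgain-Morrey space $M_p^{t,r}(W)$ is the set of all $\vec f\in L^p_{\mathrm{loc}}(W)$ such that $$\|\vec f\|_{M_p^{t,r}(W)}:=\left\|\left\{W(Q_{j,k})^{1/t-1/p}\left(\int_{Q_{j,k}}|W^{1/p}(y)\vec f(y)|^p\,dy\right)^{1/p}\right\}_{j\in\mathbb{Z},k\in\mathbb{Z}^n}\right\|_{\ell^r}<\infty.$$ Functions equal a.e. are identified. The dyadic average operator is, for $a\in\mathbb{Z}$, $E_{d,a}\vec f(x):=\sum_{Q\in\mathcal{D}_{-a}}\frac{\chi_Q(x)}{|Q|}\int_Q\vec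 f(y)\,dy$ (cubes of side length $2^a$; the subscript $d$ stands for ''dyadic''). $B(0,R)$ is the open ball of center $0$ and radius $R$, $B^c(0,R)$ its complement, and $\chi_E$ the characteristic function of $E$. A set in a metric space is totally bounded if for each $\epsilon>0$ it has a finite $\epsilon$-net. *)

(* Defs.v *)
From HB Require Import structures.
From mathcomp Require Import all_boot all_order all_algebra.
From mathcomp Require Import complex.
From mathcomp Require Import all_classical all_reals all_analysis ess_sup_inf.

Set Implicit Arguments.
Unset Strict Implicit.
Unset Printing Implicit Defensive.

Import Order.TTheory GRing.Theory Num.Theory.
Import numFieldNormedType.Exports.

Local Open Scope classical_set_scope.
Local Open Scope ring_scope.

(** * Lebesgue measure on R^n *)

(* R^n with the sigma-algebra generated by the coordinates. *)
Definition borelRn (R : realType) (n : nat) : Type := 'rV[R]_n.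

Definition borelRn_display : measure_display.
Proof. exact: default_measure_display. Qed.

Section borelRn.
Context {R : realType} {n : nat}.

Definition borelRn_coord (i : 'I_n) (x : borelRn R n) : measurableTypeR R :=
  (x : 'rV[R]_n) ord0 i.

Let borelRn0 : g_sigma_preimage borelRn_coord set0.
Proof. exact: sigma_algebra0. Qed.

Let borelRnC A :
  g_sigma_preimage borelRn_coord A -> g_sigma_preimage borelRn_coord (~` A).
Proof. exact: sigma_algebraC. Qed.

Let borelRnU (F : (set (borelRn R n))^nat) :
  (forall i, g_sigma_preimage borelRn_coord (F i)) ->
  g_sigma_preimage borelRn_coord (\bigcup_i F i).
Proof. exact: sigma_algebra_bigcup. Qed.

HB.instance Definition _ := Pointed.on (borelRn R n).
HB.instance Definition _ := @isMeasurable.Build borelRn_display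
  (borelRn R n) (g_sigma_preimage borelRn_coord) borelRn0 borelRnC borelRnU.

Lemma measurable_borelRn_coord (i : 'I_n) :
  measurable_fun [set: borelRn R n] (borelRn_coord i).
Proof.
move=> _ Y mY; rewrite setTI; apply: sub_sigma_algebra => /=.
rewrite -bigcup_seq/=; exists i => /=; first by rewrite mem_index_enum.
by exists Y => //; rewrite setTI.
Qed.

Lemma measurable_fun_borelRn d (T : measurableType d) (f : T -> borelRn R n) :
  (forall i, measurable_fun [set: T] (borelRn_coord i \o f)) ->
  measurable_fun [set: T] f.
Proof.
move=> mf _ A mA; rewrite setTI.
suff : g_sigma_preimage borelRn_coord `<=` [set B | measurable (f @^-1` B)].
  exact.
apply: smallest_sub.
  split => //= [|B mB|F mF].
  - by rewrite preimage_set0.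
  - by rewrite setTD -preimage_setC; exact: measurableC.
  - by rewrite preimage_bigcup; exact: bigcup_measurable.
move=> B; rewrite -bigcup_seq /= => -[i _ [C mC <-]] /=.
by rewrite setTI -[X in measurable X]setTI; exact: mf.
Qed.

End borelRn.

Definition consRn (R : realType) (n : nat)
  (x : measurableTypeR R * borelRn R n) : borelRn R n.+1 :=
  row_mx (x.1)%:M (x.2 : 'rV[R]_n).

Lemma measurable_consRn (R : realType) (n : nat) :
  measurable_fun setT (@consRn R n).
Proof.
apply: measurable_fun_borelRn => i.
have [j ->|->] := unliftP ord0 i.
  rewrite (_ : _ \o _ = borelRn_coord j \o snd).
    by apply: measurableT_comp => //; exact: measurable_borelRn_coord.
  apply/funext => -[x y]; rewrite /= /borelRn_coord /consRn.
  by rewrite (_ : lift ord0 j = rshift 1 j); [exact: row_mxEr|exact: ord_inj].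
rewrite (_ : _ \o _ = fst)//; apply/funext => -[x y].
rewrite /= /borelRn_coord /consRn.
have -> : (ord0 : 'I_n.+1) = lshift n (ord0 : 'I_1) by exact: ord_inj.
by apply: etrans (row_mxEl _ _ _ _) _; rewrite mxE eqxx mulr1n.
Qed.

Section lebesgue_borelRnS.
Context {R : realType} {n : nat}.
Variable mu : {sigma_finite_measure set (borelRn R n) -> \bar R}.

Definition lebesgue_borelRnS : set (borelRn R n.+1) -> \bar R :=
  pushforward (lebesgue_measure \x mu)%E (@consRn R n).

Let lebesgue_borelRnS0 : lebesgue_borelRnS set0 = 0%E.
Proof. by rewrite /lebesgue_borelRnS /pushforward preimage_set0 measure0. Qed.

Let lebesgue_borelRnS_ge0 A : (0 <= lebesgue_borelRnS A)%E.
Proof. by rewrite /lebesgue_borelRnS /pushforward measure_ge0. Qed.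

Let lebesgue_borelRnS_sigma_additive : semi_sigma_additive lebesgue_borelRnS.
Proof.
pose m := measure_function_pushforward__canonical__measure_function_Measure
  (lebesgue_measure \x mu)%E (@measurable_consRn R n).
exact: (@measure_semi_sigma_additive _ _ _ m).
Qed.

HB.instance Definition _ := isMeasure.Build _ _ _ lebesgue_borelRnS
  lebesgue_borelRnS0 lebesgue_borelRnS_ge0 lebesgue_borelRnS_sigma_additive.

Let lebesgue_borelRnS_sigma_finite : sigma_finite setT lebesgue_borelRnS.
Proof.
have [F TF Foo] : sigma_finite setT (lebesgue_measure \x mu)%E.
  have /sigma_finiteP[F [TF ndF Foo]] := sigma_finiteT (@lebesgue_measure R).
  have /sigma_finiteP[G [TG ndG Goo]] := sigma_finiteT mu.
  exists (fun k => F k `*` G k).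
    rewrite -setXTT TF TG predeqE => -[x y]; split.
      move=> [/= [k _ Fkx] [l _ Gly]]; exists (maxn k l) => //; split.
      - by move: x Fkx; exact/subsetPset/ndF/leq_maxl.
      - by move: y Gly; exact/subsetPset/ndG/leq_maxr.
    by move=> [k _ []/= ? ?]; split; exists k.
  move=> k; have [? ?] := Foo k; have [? ?] := Goo k.
  split; first exact: measurableX.
  by rewrite product_measure1E// lte_mul_pinfty// ge0_fin_numE.
pose tl (x : borelRn R n.+1) : measurableTypeR R * borelRn R n :=
  (borelRn_coord ord0 x, \row_i borelRn_coord (lift ord0 i) x).
have consK : cancel (@consRn R n) tl.
  move=> [x y]; rewrite /tl /borelRn_coord /consRn; congr pair.
    have -> : (ord0 : 'I_n.+1) = lshift n (ord0 : 'I_1) by exact: ord_inj.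
    by apply: etrans (row_mxEl _ _ _ _) _; rewrite mxE eqxx mulr1n.
  apply/rowP => i; rewrite mxE (_ : lift ord0 i = rshift 1 i).
    exact: row_mxEr.
  exact: ord_inj.
have mtl : measurable_fun setT tl.
  apply/measurable_fun_pairP; split.
    exact: measurable_borelRn_coord.
  apply: measurable_fun_borelRn => i.
  rewrite (_ : _ \o _ = borelRn_coord (lift ord0 i)).
    exact: measurable_borelRn_coord.
  by apply/funext => x; rewrite /= /borelRn_coord mxE.
exists (fun k => tl @^-1` F k).
  by rewrite -preimage_bigcup -TF preimage_setT.
move=> k; have [mF Fk] := Foo k; split.
  by rewrite -[X in measurable X]setTI; exact: mtl.
rewrite /lebesgue_borelRnS /pushforward -comp_preimage.
by rewrite (_ : tl \o _ = id)//; apply/funext => x; exact: consK.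
Qed.

HB.instance Definition _ := @Measure_isSigmaFinite.Build _ _ _
  lebesgue_borelRnS lebesgue_borelRnS_sigma_finite.

End lebesgue_borelRnS.

Fixpoint lebesgue_borelRn (R : realType) (n : nat) :
    {sigma_finite_measure set (borelRn R n) -> \bar R} :=
  match n with
  | 0 => \d_((0 : 'rV[R]_0) : borelRn R 0)
  | k.+1 => lebesgue_borelRnS (lebesgue_borelRn R k)
  end.

(* R^n with the sigma-algebra of Lebesgue measurable sets. *)
Notation lebRn R n :=
  (caratheodory_type (measure_extension.mu_ext (lebesgue_borelRn R n))).

Definition lebesgueRn (R : realType) (n : nat) : set (lebRn R n) -> \bar R :=
  @completed_measure_extension _ _ _ (lebesgue_borelRn R n).

HB.instance Definition _ (R : realType) (n : nat) :=
  Measure.on (@lebesgueRn R n).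

Arguments lebesgueRn : clear implicits.

(** * Cubes, averages and balls *)

Section geometry.
Context {R : realType} {n : nat}.
Local Notation mu := (lebesgueRn R n).

(* The cube of center c and side length l, half-open as the dyadic cubes are. *)
Definition cube (c : 'rV[R]_n) (l : R) : set 'rV[R]_n :=
  [set x | forall i, c ord0 i - l / 2 <= x ord0 i < c ord0 i + l / 2].

Definition dyadic_cube (j : int) (k : 'rV[int]_n) : set 'rV[R]_n :=
  [set x | forall i, 2 ^ (- j) * (k ord0 i)%:~R <= x ord0 i
                     < 2 ^ (- j) * ((k ord0 i)%:~R + 1)].

Definition vol (Q : set 'rV[R]_n) : R := fine (mu Q).

Definition avg (Q : set 'rV[R]_n) (g : 'rV[R]_n -> \bar R) : \bar R :=
  (((vol Q)^-1)%:E * \int[mu]_(x in Q) g x)%E.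

Definition ess_sup_on (P : set 'rV[R]_n) (g : 'rV[R]_n -> \bar R) : \bar R :=
  ess_sup mu (patch (fun=> -oo%E) P g : lebRn R n -> \bar R).

(* The open Euclidean ball; the library norm on 'rV[R]_n is the sup norm. *)
Definition eball (rho : R) : set 'rV[R]_n :=
  [set x | Num.sqrt (\sum_i x ord0 i ^+ 2) < rho].

End geometry.

(** * Complex vectors and matrices *)

Section complex_matrices.
Context {R : realType} {d : nat}.
Local Open Scope sesquilinear_scope.
Local Open Scope complex_scope.
Local Notation C := R[i].

Definition vnorm (z : 'cV[C]_d) : R :=
  Num.sqrt (\sum_i Normc.normc (z i ord0) ^+ 2).

Definition opnorm (A : 'M[C]_d) : R :=
  sup [set vnorm (A *m z) | z in [set z | vnorm z = 1]].

(* In the order of R[i], 0 <= z means that z is real and nonnegative. *)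
Definition nonneg_definite (A : 'M[C]_d) : Prop :=
  forall z : 'cV[C]_d, 0 <= (z ^t* *m A *m z) ord0 ord0.

(* spectralmx A is unitary and, for A normal,
   A = invmx (spectralmx A) *m diag_mx (spectral_diag A) *m spectralmx A. *)
Definition mxpow (A : 'M[C]_d) (alpha : R) : 'M[C]_d :=
  invmx (spectralmx A)
  *m diag_mx (map_mx (fun z => (complex.Re z `^ alpha)%:C) (spectral_diag A))
  *m spectralmx A.

End complex_matrices.

Section complex_functions.
Context {R : realType} {n : nat}.
Local Open Scope complex_scope.
Local Notation C := R[i].
Local Notation mu := (lebesgueRn R n).

Definition cmeasurable (g : 'rV[R]_n -> C) : Prop :=
  measurable_fun [set: lebRn R n] (fun x => complex.Re (g x)) /\
  measurable_fun [set: lebRn R n] (fun x => complex.Im (g x)).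

Definition cintegral (D : set 'rV[R]_n) (g : 'rV[R]_n -> C) : C :=
  (\int[mu]_(x in D) complex.Re (g x)) +i* (\int[mu]_(x in D) complex.Im (g x)).

Definition vintegral d (D : set 'rV[R]_n) (f : 'rV[R]_n -> 'cV[C]_d) : 'cV[C]_d :=
  \col_i cintegral D (fun x => f x i ord0).

Definition locally_integrable_c (g : 'rV[R]_n -> C) : Prop :=
  cmeasurable g /\
  forall K : set 'rV[R]_n, compact K ->
    (\int[mu]_(x in K) (Normc.normc (g x))%:E < +oo)%E.

End complex_functions.

(** * Matrix weights *)

Section weights.
Context {R : realType} {n d : nat}.
Local Notation C := R[i].
Local Notation mu := (lebesgueRn R n).
Implicit Types (W : 'rV[R]_n -> 'M[C]_d) (p : R) (Q P : set 'rV[R]_n).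

Definition matrix_weight W : Prop :=
  [/\ forall x, nonneg_definite (W x),
      {ae mu, forall x, W x \in unitmx} &
      forall i j, locally_integrable_c (fun x => W x i j)].

Definition conj_exp p : R := p / (p - 1).

Definition Ap_kernel p W (x y : 'rV[R]_n) : R :=
  opnorm (mxpow (W x) p^-1 *m mxpow (W y) (- p^-1)).

(* The quantity common to the A_p condition (P = Q) and to the A_p-dimension
   (P = 2^i Q). *)
Definition Ap_mean p W Q P : \bar R :=
  if p <= 1 then
    ess_sup_on P (fun y => avg Q (fun x => (Ap_kernel p W x y `^ p)%:E))
  else
    avg Q (fun x => poweR
      (avg P (fun y => (Ap_kernel p W x y `^ conj_exp p)%:E)) (p / conj_exp p)).

Definition Ap_class p W : Prop :=
  (ereal_sup [set e | exists (c : 'rV[R]_n) (l : R),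
     (0 < l)%R /\ e = Ap_mean p W (cube c l) (cube c l)] < +oo)%E.

Definition Ap_dimension p W (dim : R) : Prop :=
  exists2 K : R, 0 < K & forall (c : 'rV[R]_n) (l : R) (i : nat), 0 < l ->
    (Ap_mean p W (cube c l) (cube c (2 ^+ i * l)%R) <= (K * 2 `^ (i%:R * dim))%:E)%E.

Definition weight W Q : \bar R := (\int[mu]_(y in Q) (opnorm (W y))%:E)%E.

End weights.

(** * Matrix weighted Bourgain-Morrey spaces *)

Section bourgain_morrey.
Context {R : realType} {n d : nat}.
Local Open Scope complex_scope.
Local Notation C := R[i].
Local Notation mu := (lebesgueRn R n).
Implicit Types (W : 'rV[R]_n -> 'M[C]_d) (f : 'rV[R]_n -> 'cV[C]_d).
Implicit Types (p t r : R) (F : set ('rV[R]_n -> 'cV[C]_d)).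

Definition Lp_mass p W (D : set 'rV[R]_n) f : \bar R :=
  (\int[mu]_(x in D) (vnorm (mxpow (W x) p^-1 *m f x) `^ p)%:E)%E.

Definition Lp_loc p W f : Prop :=
  (forall i, cmeasurable (fun x => f x i ord0)) /\
  forall K : set 'rV[R]_n, compact K -> (Lp_mass p W K f < +oo)%E.

Definition BM_norm p t r W f : \bar R :=
  poweR (\esum_(jk in [set: int * 'rV[int]_n])
    let Q := dyadic_cube jk.1 jk.2 in
    poweR (poweR (weight W Q) (t^-1 - p^-1) * poweR (Lp_mass p W Q f) p^-1)%E r)
    r^-1.

Definition BM_space p t r W : set ('rV[R]_n -> 'cV[C]_d) :=
  [set f | Lp_loc p W f /\ (BM_norm p t r W f < +oo)%E].

(* At each x at most one term of the sum is nonzero. *)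
Definition dyadic_average (a : int) f : 'rV[R]_n -> 'cV[C]_d := fun x =>
  \sum_(k \in [set: 'rV[int]_n])
    let Q := dyadic_cube (- a) k in (\1_Q x / vol Q)%:C *: vintegral Q f.

(* Functions are not quotiented by almost everywhere equality; BM_norm does not
   distinguish two almost everywhere equal functions. *)
Definition BM_totally_bounded p t r W F : Prop :=
  forall eps : R, 0 < eps ->
    exists G : set ('rV[R]_n -> 'cV[C]_d),
      [/\ finite_set G, G `<=` BM_space p t r W &
        forall f, F f ->
          exists2 g, G g & (BM_norm p t r W (f \- g)%R < eps%:E)%E].

(* The supremum in [0, +oo], so that it is 0 over the empty family. *)
Definition family_sup F (N : ('rV[R]_n -> 'cV[C]_d) -> \bar R) : \bar R :=
  maxe 0%E (ereal_sup (N @` F)).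

End bourgain_morrey.

Definition int_ninfty_nbhs : set_system int :=
  filter_from setT (fun a0 : int => [set a : int | (a <= a0)%R]).

(* Main.v *)
Require Import Defs.
From HB Require Import structures.
From mathcomp Require Import all_boot all_order all_algebra.
From mathcomp Require Import complex.
From mathcomp Require Import all_classical all_reals all_analysis ess_sup_inf.
From mathcomp Require Import measurable_realfun.
From mathcomp Require Import zify ring lra.
Import Order.TTheory GRing.Theory Num.Theory.
Import numFieldNormedType.Exports.

(** The theorem is a Kolmogorov-Riesz criterion, and its proof rests on two properties of
    the averaging operators [E_J] over the dyadic cubes of level [J]: they are bounded
    uniformly in [J] on the Bourgain-Morrey space, and [E_J f] converges to [f] when the
    cubes shrink.

    Both come from one estimate. On a cube [P] the average of [f] is controlled through
    the kernel [|W^(1/p)(x) W^(-1/p)(y)|], by Hölder's inequality in [y]. The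
    [A_p]-dimension of [W] then bounds the mass that the average keeps on a cube [Q] of
    level [J + m] inside [P]: it is at most [C 2^(m (dt - n))] times the mass of [f] on [P]
    ([mass_avg_small]). Cubes larger than those of level [J] are unions of cubes of
    level [J], and on each of them the operator is bounded ([mass_avg_large]). For the
    smaller cubes, [2^(m n)] of them lie in [P], and the negative power [1/t - 1/p] of
    their weights is compared with that of [P] by doubling. The dimension of the dual
    weight, through an application of Markov's inequality, gives the doubling exponent
    [beta] ([weight_doubling]). The assumption on the exponents says exactly that the sum
    over the level [J + m] then decays geometrically in [m] ([level_avg_small]), and
    summing over the levels gives the uniform bound ([total_on_avg], [total_avg]).

    Convergence on one cube ([mass_avg_cvg]) is clear for functions constant on small
    cubes, and the uniform bound extends it to all functions of finite mass, since
    dyadic cubes generate the measurable sets up to null sets. In the whole space, all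
    but finitely many cubes contribute little to the sum defining the norm
    ([total_avg_cvg]). That functions vanish at infinity is proved in the same way
    ([total_far]).

    Necessity: each condition holds for a single function, hence for the finitely many
    members of a net, hence for the family, as truncations and averages are uniformly
    bounded. Sufficiency: the conditions bring every member of the family close to a step
    function on finitely many fixed cubes ([total_sub_step]), with bounded values
    ([avgv_bounded]); rounding the values gives a finite net. Here the indicator of a
    cube must have finite norm ([total_ind]). Above the level of the cube this is the
    geometric decay again, and below it the weights of the ancestors of the cube grow
    geometrically, as doubling makes a cube and its siblings comparable.

    The powers [W^(1/p)] are measurable ([mxmfun_mxpow]) because they are limits of
    polynomials in [W]. *)

Local Open Scope classical_set_scope.
Local Open Scope ring_scope.

Set Implicit Arguments.
Unset Strict Implicit.
Unset Printing Implicit Defensive.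

(** * Euclidean norms of complex matrices *)

Lemma sum_sqr_le {R : realType} (I : Type) (s : seq I) (f : I -> R) :
  (forall i, 0 <= f i) -> \sum_(i <- s) f i ^+ 2 <= (\sum_(i <- s) f i) ^+ 2.
Proof.
move=> f0; elim: s => [|i s IH]; first by rewrite !big_nil expr0n.
rewrite !big_cons; have s0 : 0 <= \sum_(j <- s) f j by apply: sumr_ge0.
by have := f0 i; set x := f i; set y := \sum_(j <- s) f j in s0 IH *; nra.
Qed.

Section frobenius.
Context {R : realType}.
Local Open Scope sesquilinear_scope.
Local Open Scope complex_scope.
Local Notation C := R[i].

Definition cabs2 (z : C) : R := complex.Re z ^+ 2 + complex.Im z ^+ 2.

Lemma cabs2_ge0 z : 0 <= cabs2 z.
Proof. by rewrite addr_ge0 // sqr_ge0. Qed.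

Lemma normc_sqr z : Normc.normc z ^+ 2 = cabs2 z.
Proof. by case: z => a b /=; rewrite sqr_sqrtr // addr_ge0 ?sqr_ge0. Qed.

Lemma ReM (x y : C) :
  complex.Re (x * y) = complex.Re x * complex.Re y - complex.Im x * complex.Im y.
Proof. by case: x y => a b [c e]. Qed.

Lemma ImM (x y : C) :
  complex.Im (x * y) = complex.Re x * complex.Im y + complex.Im x * complex.Re y.
Proof. by case: x y => a b [c e]. Qed.

Lemma ReD (x y : C) : complex.Re (x + y) = complex.Re x + complex.Re y.
Proof. by case: x y => a b [c e]. Qed.

Lemma ImD (x y : C) : complex.Im (x + y) = complex.Im x + complex.Im y.
Proof. by case: x y => a b [c e]. Qed.

Lemma Re_sum (I : Type) (s : seq I) (P : pred I) (F : I -> C) :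
  complex.Re (\sum_(i <- s | P i) F i) = \sum_(i <- s | P i) complex.Re (F i).
Proof. exact: (big_morph (@complex.Re R) ReD erefl). Qed.

Lemma Im_sum (I : Type) (s : seq I) (P : pred I) (F : I -> C) :
  complex.Im (\sum_(i <- s | P i) F i) = \sum_(i <- s | P i) complex.Im (F i).
Proof. exact: (big_morph (@complex.Im R) ImD erefl). Qed.

Lemma cabs2M x y : cabs2 (x * y) = cabs2 x * cabs2 y.
Proof. by rewrite /cabs2 ReM ImM; ring. Qed.

Lemma cabs2_conj x : cabs2 (Num.conj x) = cabs2 x.
Proof. by case: x => a b; rewrite /cabs2 /= sqrrN. Qed.

Lemma cabs2D x y : cabs2 (x + y) <= 2 * (cabs2 x + cabs2 y).
Proof.
rewrite /cabs2 ReD ImD -subr_ge0.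
rewrite (_ : _ - _ = (complex.Re x - complex.Re y) ^+ 2 +
                     (complex.Im x - complex.Im y) ^+ 2); last ring.
by rewrite addr_ge0 // sqr_ge0.
Qed.

Lemma cabs2_real (a : R) : cabs2 a%:C = a ^+ 2.
Proof. by rewrite /cabs2 /= expr0n addr0. Qed.

Lemma cabs2_eq0 z : cabs2 z = 0 -> z = 0.
Proof.
case: z => a b /eqP; rewrite /cabs2 /= paddr_eq0 ?sqr_ge0 // !sqrf_eq0.
by move=> /andP[/eqP -> /eqP ->].
Qed.

(** Cauchy-Schwarz, one term at a time: a term [x * y] raises the left side by
    at most [2 |s| |x| |y|], which the arithmetic-geometric mean inequality bounds
    by the cross terms on the right. *)
Lemma cabs2_sum_le (I : Type) (s : seq I) (a b : I -> C) :
  cabs2 (\sum_(k <- s) a k * b k) <=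
  (\sum_(k <- s) cabs2 (a k)) * (\sum_(k <- s) cabs2 (b k)).
Proof.
elim: s => [|k s IH].
  by rewrite !big_nil /cabs2 /= expr0n mul0r addr0.
rewrite !big_cons.
set S := \sum_(j <- s) _ in IH *; set A := \sum_(j <- s) cabs2 _ in IH *.
set B := \sum_(j <- s) cabs2 _ in IH *.
have A0 : 0 <= A by apply: sumr_ge0 => i _; exact: cabs2_ge0.
have B0 : 0 <= B by apply: sumr_ge0 => i _; exact: cabs2_ge0.
set z := a k * b k; set x := complex.Re z * complex.Re S + complex.Im z * complex.Im S.
have -> : cabs2 (z + S) = cabs2 z + 2 * x + cabs2 S.
  by rewrite /cabs2 ReD ImD /x; ring.
have x2 : x ^+ 2 <= cabs2 z * (A * B).
  apply: (@le_trans _ _ (cabs2 z * cabs2 S)); last by rewrite ler_wpM2l ?cabs2_ge0.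
  rewrite -subr_ge0 /cabs2.
  rewrite (_ : _ - _ = (complex.Re z * complex.Im S - complex.Im z * complex.Re S) ^+ 2).
    exact: sqr_ge0.
  by rewrite /x; ring.
have h : 2 * x <= cabs2 (a k) * B + A * cabs2 (b k).
  have h0 : 0 <= cabs2 (a k) * B + A * cabs2 (b k).
    by rewrite addr_ge0 // mulr_ge0 // cabs2_ge0.
  apply: (le_trans (ler_norm _)).
  rewrite -(@ler_pXn2r _ 2) // ?nnegrE //.
  rewrite -normrX ger0_norm ?sqr_ge0 //.
  rewrite cabs2M in x2; rewrite -subr_ge0.
  rewrite (_ : _ - _ = (cabs2 (a k) * B - A * cabs2 (b k)) ^+ 2 +
     4 * (cabs2 (a k) * cabs2 (b k) * (A * B) - x ^+ 2)); last ring.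
  by rewrite addr_ge0 ?sqr_ge0 // mulr_ge0 // subr_ge0.
rewrite [cabs2 z]cabs2M; move: h IH; clear; clearbody A B x.
set p := cabs2 (a k); set q := cabs2 (b k); set u := cabs2 S.
by clearbody p q u; move=> h IH; rewrite mulrDl !mulrDr; lra.
Qed.

Definition fnorm m n (A : 'M[C]_(m, n)) : R :=
  Num.sqrt (\sum_i \sum_j cabs2 (A i j)).

Section fnorm_theory.
Variables m n : nat.
Implicit Types A B : 'M[C]_(m, n).

Let fnorm2_ge0 A : 0 <= \sum_i \sum_j cabs2 (A i j).
Proof. by apply: sumr_ge0 => i _; apply: sumr_ge0 => j _; exact: cabs2_ge0. Qed.

Lemma fnorm_ge0 A : 0 <= fnorm A.
Proof. exact: sqrtr_ge0. Qed.

Lemma fnorm_sqr A : fnorm A ^+ 2 = \sum_i \sum_j cabs2 (A i j).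
Proof. by rewrite sqr_sqrtr ?fnorm2_ge0. Qed.

Lemma fnormP A (c : R) : 0 <= c ->
  (fnorm A <= c) = (\sum_i \sum_j cabs2 (A i j) <= c ^+ 2).
Proof. by move=> c0; rewrite -fnorm_sqr ler_pXn2r // nnegrE // fnorm_ge0. Qed.

Lemma cabs2_le_fnorm A i j : cabs2 (A i j) <= fnorm A ^+ 2.
Proof.
rewrite fnorm_sqr (bigD1 i) //= (bigD1 j) //= -addrA lerDl addr_ge0 //.
  by apply: sumr_ge0 => k _; exact: cabs2_ge0.
by apply: sumr_ge0 => k _; apply: sumr_ge0 => l _; exact: cabs2_ge0.
Qed.

Lemma normRe_le_fnorm A i j : `|complex.Re (A i j)| <= fnorm A.
Proof.
rewrite -(@ler_pXn2r _ 2) // ?nnegrE ?fnorm_ge0 // -normrX ger0_norm ?sqr_ge0 //.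
by apply: le_trans (cabs2_le_fnorm A i j); rewrite /cabs2 lerDl sqr_ge0.
Qed.

Lemma normIm_le_fnorm A i j : `|complex.Im (A i j)| <= fnorm A.
Proof.
rewrite -(@ler_pXn2r _ 2) // ?nnegrE ?fnorm_ge0 // -normrX ger0_norm ?sqr_ge0 //.
by apply: le_trans (cabs2_le_fnorm A i j); rewrite /cabs2 lerDr sqr_ge0.
Qed.

Lemma fnorm_eq0 A : fnorm A = 0 -> A = 0.
Proof.
move=> A0; apply/matrixP => i j; rewrite mxE; apply: cabs2_eq0; apply/eqP.
by have := cabs2_le_fnorm A i j; rewrite A0 expr0n /= eq_le cabs2_ge0 andbT.
Qed.

Lemma fnorm0 : fnorm (0 : 'M[C]_(m, n)) = 0.
Proof.
rewrite /fnorm big1 ?sqrtr0 // => i _; rewrite big1 // => j _.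
by rewrite mxE /cabs2 /= expr0n addr0.
Qed.

Lemma fnormD A B : fnorm (A + B) <= 2 * (fnorm A + fnorm B).
Proof.
rewrite fnormP; last by rewrite mulr_ge0 // addr_ge0 // fnorm_ge0.
apply: (@le_trans _ _ (2 * (fnorm A ^+ 2 + fnorm B ^+ 2))).
  rewrite !fnorm_sqr -big_split /= mulr_sumr; apply: ler_sum => i _.
  rewrite -big_split /= mulr_sumr; apply: ler_sum => j _.
  by rewrite mxE cabs2D.
have := fnorm_ge0 A; have := fnorm_ge0 B; nra.
Qed.

Lemma fnormZ (c : C) A : fnorm (c *: A) = Num.sqrt (cabs2 c) * fnorm A.
Proof.
rewrite /fnorm -sqrtrM ?cabs2_ge0 //; congr Num.sqrt.
rewrite mulr_sumr; apply: eq_bigr => i _; rewrite mulr_sumr.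
by apply: eq_bigr => j _; rewrite mxE cabs2M.
Qed.

Lemma fnorm_trC A : fnorm (A ^t*) = fnorm A.
Proof.
rewrite /fnorm exchange_big /=; congr Num.sqrt.
by apply: eq_bigr => i _; apply: eq_bigr => j _; rewrite !mxE cabs2_conj.
Qed.

Lemma fnorm_le_sum A :
  fnorm A <= \sum_i \sum_j (`|complex.Re (A i j)| + `|complex.Im (A i j)|).
Proof.
pose a i j := `|complex.Re (A i j)| + `|complex.Im (A i j)|.
have a0 i j : 0 <= a i j by rewrite addr_ge0.
have b0 i : 0 <= \sum_j a i j by exact: sumr_ge0.
rewrite fnormP; last by apply: sumr_ge0 => i _; exact: b0.
apply: (le_trans _ (sum_sqr_le _ b0)); apply: ler_sum => i _.
apply: (le_trans _ (sum_sqr_le _ (a0 i))); apply: ler_sum => j _.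
rewrite /cabs2 /a -[X in X + _ <= _]ger0_norm ?sqr_ge0 //.
rewrite -[X in _ + X <= _]ger0_norm ?sqr_ge0 // !normrX.
have := normr_ge0 (complex.Re (A i j)); have := normr_ge0 (complex.Im (A i j)); nra.
Qed.

End fnorm_theory.

Lemma fnormM m n l (A : 'M[C]_(m, n)) (B : 'M[C]_(n, l)) :
  fnorm (A *m B) <= fnorm A * fnorm B.
Proof.
rewrite fnormP; last by rewrite mulr_ge0 // fnorm_ge0.
rewrite exprMn !fnorm_sqr mulr_suml; apply: ler_sum => i _.
apply: (@le_trans _ _ (\sum_j ((\sum_k cabs2 (A i k)) * \sum_k cabs2 (B k j)))).
  by apply: ler_sum => j _; rewrite mxE; exact: cabs2_sum_le.
by rewrite -mulr_sumr [X in _ * X <= _]exchange_big.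
Qed.

Lemma vnormE d (z : 'cV[C]_d) : vnorm z = fnorm z.
Proof.
rewrite /vnorm /fnorm; congr Num.sqrt; apply: eq_bigr => i _.
by rewrite big_ord1 normc_sqr.
Qed.

Let opnorm_set d (A : 'M[C]_d) := [set vnorm (A *m z) | z in [set z | vnorm z = 1]].

Let opnorm_ub d (A : 'M[C]_d) : ubound (opnorm_set A) (fnorm A).
Proof.
move=> _ [z /= z1 <-]; rewrite vnormE in z1; rewrite vnormE.
by apply: (le_trans (fnormM _ _)); rewrite z1 mulr1.
Qed.

Lemma opnorm_ge0 d (A : 'M[C]_d) : 0 <= opnorm A.
Proof.
rewrite /opnorm -/(opnorm_set A).
have [->|/set0P[y yA]] := eqVneq (opnorm_set A) set0; first by rewrite sup0.
apply: le_trans (ub_le_sup _ yA); first by case: yA => z _ <-; exact: sqrtr_ge0.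
by exists (fnorm A); exact: opnorm_ub.
Qed.

Lemma opnorm_le_fnorm d (A : 'M[C]_d) : opnorm A <= fnorm A.
Proof.
rewrite /opnorm -/(opnorm_set A).
have [->|/set0P nE] := eqVneq (opnorm_set A) set0; first by rewrite sup0 fnorm_ge0.
by apply: ge_sup => //; exact: opnorm_ub.
Qed.

Lemma fnorm_le_opnorm d (A : 'M[C]_d) : fnorm A <= Num.sqrt d%:R * opnorm A.
Proof.
rewrite fnormP; last by rewrite mulr_ge0 ?sqrtr_ge0 ?opnorm_ge0.
rewrite exprMn sqr_sqrtr ?ler0n // exchange_big /=.
apply: (@le_trans _ _ (\sum_(j < d) opnorm A ^+ 2)).
  apply: ler_sum => j _.
  have -> : \sum_i cabs2 (A i j) = vnorm (A *m delta_mx j (0 : 'I_1)) ^+ 2.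
    rewrite vnormE fnorm_sqr; apply: eq_bigr => i _.
    by rewrite big_ord1 -colE mxE.
  rewrite ler_pXn2r // ?nnegrE ?opnorm_ge0 ?sqrtr_ge0 //.
  apply: ub_le_sup; first by exists (fnorm A); exact: opnorm_ub.
  exists (delta_mx j 0) => //=; rewrite vnormE /fnorm (bigD1 j) //= big_ord1 mxE !eqxx.
  rewrite /= cabs2_real expr1n big1 ?addr0 ?sqrtr1 // => i ij.
  by rewrite big_ord1 mxE (negbTE ij) /cabs2 /= expr0n addr0.
by rewrite sumr_const card_ord mulr_natl.
Qed.

End frobenius.

(** * Functional calculus of nonnegative definite matrices *)

Section unitary_functional_calculus.
Context {C : numClosedFieldType} {d : nat}.
Local Open Scope sesquilinear_scope.
Implicit Types (A P : 'M[C]_d) (l : 'rV[C]_d) (f g : C -> C).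

Definition fcalc g A : 'M[C]_d :=
  invmx (spectralmx A) *m diag_mx (map_mx g (spectral_diag A)) *m spectralmx A.

Lemma fcalcM f g A : fcalc f A *m fcalc g A = fcalc (fun x => f x * g x) A.
Proof.
rewrite /fcalc !mulmxA (mulmxK (spectral_unit A)) -[_ *m _ *m diag_mx (map_mx g _)]mulmxA.
by rewrite mulmx_diag; congr (_ *m diag_mx _ *m _); apply/rowP => i; rewrite !mxE.
Qed.

Lemma fcalc1 A : fcalc (fun=> 1) A = 1%:M.
Proof.
rewrite /fcalc (_ : diag_mx _ = 1%:M) ?mulmx1 ?mulVmx ?spectral_unit //.
by apply/matrixP => i j; rewrite !mxE.
Qed.

Lemma fcalcE g A i j : fcalc g A i j = \sum_k
  invmx (spectralmx A) i k * g (spectral_diag A ord0 k) * spectralmx A k j.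
Proof.
rewrite /fcalc mxE; apply: eq_bigr => k _; rewrite mul_mx_diag !mxE.
by rewrite (ord1 0).
Qed.

Lemma fcalc_ext f g A :
  (forall k, f (spectral_diag A ord0 k) = g (spectral_diag A ord0 k)) -> fcalc f A = fcalc g A.
Proof.
by move=> e; rewrite /fcalc; congr (_ *m diag_mx _ *m _); apply/rowP => k; rewrite !mxE.
Qed.

Lemma trC_mul m n q (X : 'M[C]_(m, n)) (Y : 'M[C]_(n, q)) :
  (X *m Y) ^t* = Y ^t* *m X ^t*.
Proof. by rewrite trmx_mul map_mxM. Qed.

Lemma trCK m n (X : 'M[C]_(m, n)) : X ^t* ^t* = X.
Proof. by apply/matrixP => i j; rewrite !mxE conjCK. Qed.

Lemma invmx_spectral A : invmx (spectralmx A) = (spectralmx A) ^t*.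
Proof. by rewrite invmx_unitary // spectral_unitarymx. Qed.

Lemma fcalc_trC g A : (forall z, Num.conj (g z) = g z) -> (fcalc g A) ^t* = fcalc g A.
Proof.
move=> gr; rewrite /fcalc invmx_spectral !trC_mul trCK mulmxA.
congr (_ *m _ *m _); apply/matrixP => i j; rewrite !mxE eq_sym.
case: eqP => [->|_] /=; first by rewrite mulr1n gr.
by rewrite mulr0n conjC0.
Qed.

Lemma hermP A : A ^t* = A -> A \is hermsymmx.
Proof. by move=> AE; rewrite qualifE /= expr0 scale1r; apply/eqP. Qed.

Lemma herm_spectral A : A ^t* = A ->
  A = invmx (spectralmx A) *m diag_mx (spectral_diag A) *m spectralmx A.
Proof. by move=> AE; apply/orthomx_spectralP/hermitian_normalmx/hermP. Qed.

Lemma herm_spectral_real A k : A ^t* = A -> spectral_diag A ord0 k \is Num.real.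
Proof. by move=> /hermP/hermitian_spectral_diag_real/mxOverP/(_ ord0 k). Qed.

Lemma fcalc_id A g : A ^t* = A -> (forall z, z \is Num.real -> g z = z) -> fcalc g A = A.
Proof.
move=> AE gid; rewrite [RHS](herm_spectral AE) /fcalc; congr (_ *m diag_mx _ *m _).
by apply/rowP => k; rewrite mxE gid // herm_spectral_real.
Qed.

(** Two unitary diagonalisations [P^* l P] and [Q^* m Q] of a matrix are
    intertwined by [T = Q P^*], and [T] only mixes equal eigenvalues; it therefore
    still intertwines [g l] and [g m]. *)
Lemma fcalc_unique A P l g :
  A ^t* = A -> P \in unitmx -> A = invmx P *m diag_mx l *m P ->
  fcalc g A = invmx P *m diag_mx (map_mx g l) *m P.
Proof.
move=> AE uP defA; pose Q := spectralmx A; pose m := spectral_diag A.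
have uQ : Q \in unitmx by exact: spectral_unit.
pose T := Q *m invmx P.
have h1 : diag_mx m *m T = T *m diag_mx l.
  have : Q *m A *m invmx P = Q *m A *m invmx P by [].
  by rewrite {1}[A](herm_spectral AE) -/Q -/m defA !mulmxA (mulmxV uQ) mul1mx (mulmxK uP).
have h2 : diag_mx (map_mx g m) *m T = T *m diag_mx (map_mx g l).
  clearbody T m; apply/matrixP => i j; move/matrixP/(_ i j): h1.
  rewrite !mul_diag_mx !mul_mx_diag !mxE => h.
  have [->|T0] := eqVneq (T i j) 0; first by rewrite mulr0 mul0r.
  by move: h; rewrite [LHS]mulrC => /(mulfI T0) ->; exact: mulrC.
rewrite /fcalc -/Q -/m.
have -> : diag_mx (map_mx g m) = T *m diag_mx (map_mx g l) *m P *m invmx Q.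
  by rewrite -h2 /T !mulmxA (mulmxKV uP) (mulmxK uQ).
by rewrite /T !mulmxA (mulVmx uQ) mul1mx (mulmxKV uQ).
Qed.

Lemma fcalc_comp f g A : (forall z, Num.conj (f z) = f z) ->
  fcalc g (fcalc f A) = fcalc (g \o f) A.
Proof.
move=> fr; rewrite (fcalc_unique g (fcalc_trC A fr) (spectral_unit A) (erefl _)).
by rewrite /fcalc; congr (_ *m diag_mx _ *m _); apply/rowP => k; rewrite !mxE.
Qed.

Lemma spectral_form A k : A ^t* = A ->
  spectral_diag A ord0 k = (row k (spectralmx A) *m A *m (row k (spectralmx A)) ^t*) ord0 ord0.
Proof.
move=> AE; set Q := spectralmx A.
have QQ : Q *m Q ^t* = 1%:M by apply/unitarymxP; exact: spectral_unitarymx.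
have -> : row k Q *m A *m (row k Q) ^t* =
    (delta_mx 0 k *m diag_mx (spectral_diag A)) *m delta_mx k 0.
  rewrite rowE {1}[A](herm_spectral AE) -/Q trC_mul [invmx Q]invmx_spectral.
  rewrite !mulmxA -[_ *m Q *m Q ^t*]mulmxA QQ mulmx1 -[_ *m Q *m Q ^t*]mulmxA QQ mulmx1.
  congr (_ *m _); apply/matrixP => i j; rewrite !mxE andbC.
  by case: (_ && _) => /=; rewrite ?conjC1 ?conjC0.
rewrite mul_mx_diag mxE (bigD1 k) //= big1 ?addr0 => [|j jk]; last first.
  by rewrite !mxE (negbTE jk) mulr0.
by rewrite !mxE !eqxx mul1r mulr1 (ord1 0).
Qed.

Lemma spectral_neq0 A k : A ^t* = A -> A \in unitmx -> spectral_diag A ord0 k != 0.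
Proof.
move=> AE uA; apply/negP => /eqP l0.
move: uA; rewrite unitmxE [A](herm_spectral AE) !det_mulmx det_diag (bigD1 k) //=.
by rewrite l0 mul0r mulr0 mul0r unitr0.
Qed.

Lemma diag_fcalc g A :
  diag_mx (map_mx g (spectral_diag A)) = spectralmx A *m fcalc g A *m invmx (spectralmx A).
Proof. by rewrite /fcalc !mulmxA mulmxV ?spectral_unit // mul1mx mulmxK ?spectral_unit. Qed.

End unitary_functional_calculus.

(** [mxpow] is the case of the power functions; other functions enter through the
    measurability of [mxpow]. The definition is locked because unfolding it exposes
    the choice of a diagonalisation. *)
HB.lock Definition rcalc {R : realType} {d : nat} (phi : R -> R) (A : 'M[R[i]]_d) : 'M[R[i]]_d :=
  fcalc (fun z => (phi (complex.Re z))%:C%C) A.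

Section functional_calculus.
Context {R : realType} {d : nat}.
Local Open Scope sesquilinear_scope.
Local Open Scope complex_scope.
Local Notation C := R[i].
Implicit Types (A P : 'M[C]_d) (phi psi : R -> R).

Lemma mxpowE A alpha : mxpow A alpha = rcalc (fun x => x `^ alpha) A.
Proof. by rewrite rcalc.unlock. Qed.

Let rcalc_fcalc phi A : rcalc phi A = fcalc (fun z => (phi (complex.Re z))%:C) A.
Proof. by rewrite rcalc.unlock. Qed.

Let conj_real (x : R) : Num.conj x%:C = x%:C.
Proof. by rewrite /Num.conj /= /conjc oppr0. Qed.

Lemma rcalcM phi psi A : rcalc phi A *m rcalc psi A = rcalc (fun x => phi x * psi x) A.
Proof.
rewrite rcalc.unlock fcalcM; apply: fcalc_ext => k; symmetry; exact: rmorphM.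
Qed.

Lemma rcalcE phi A i j : rcalc phi A i j = \sum_k
  invmx (spectralmx A) i k * (phi (complex.Re (spectral_diag A ord0 k)))%:C *
  spectralmx A k j.
Proof. by rewrite rcalc.unlock; exact: fcalcE. Qed.

Lemma rcalc1 A : rcalc (fun=> 1) A = 1%:M.
Proof. by rewrite rcalc.unlock; exact: fcalc1. Qed.

Lemma rcalc_trC phi A : (rcalc phi A) ^t* = rcalc phi A.
Proof. by rewrite rcalc.unlock; apply: fcalc_trC => z; exact: conj_real. Qed.

Lemma rcalc_id A : A ^t* = A -> rcalc id A = A.
Proof.
move=> AE; rewrite rcalc.unlock; apply: (fcalc_id AE) => -[a b].
by rewrite complex_real /= => /eqP ->.
Qed.

Lemma rcalc_comp phi psi A : rcalc psi (rcalc phi A) = rcalc (psi \o phi) A.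
Proof. by rewrite rcalc.unlock fcalc_comp => [//|z]; exact: conj_real. Qed.

(** Polarisation: the form of [B = A - A^*] vanishes on the diagonal, and its values
    at [e_i + e_j] and [e_i + 'i e_j] determine the off-diagonal entries. *)
Lemma nonneg_definite_herm A : nonneg_definite A -> A ^t* = A.
Proof.
move=> A0.
have form (z : 'cV[C]_d) : (z ^t* *m A *m z) ord0 ord0 = \sum_i \sum_j Num.conj (z i ord0) * A i j * z j ord0.
  rewrite mxE exchange_big /=; apply: eq_bigr => j _; rewrite mxE mulr_suml.
  by apply: eq_bigr => i _; rewrite !mxE.
have im (z : 'cV[C]_d) : complex.Im (\sum_i \sum_j Num.conj (z i ord0) * A i j * z j ord0) = 0.
  by have := A0 z; rewrite form lecE => /andP[/eqP].
have form2 i j (x y : C) : i != j ->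
    complex.Im (Num.conj x * A i i * x + Num.conj x * A i j * y
              + Num.conj y * A j i * x + Num.conj y * A j j * y) = 0.
  move=> ij; have := im (x *: delta_mx i ord0 + y *: delta_mx j ord0).
  have E k : (x *: delta_mx i ord0 + y *: delta_mx j ord0 : 'cV[C]_d) k ord0 =
      if k == i then x else if k == j then y else 0.
    rewrite !mxE !eqxx !andbT; have [->|ki] := eqVneq k i.
      by rewrite (negbTE ij) mulr1 mulr0 addr0.
    by case: eqP; rewrite mulr0 add0r ?mulr1 ?mulr0.
  under eq_bigr do under eq_bigr do rewrite !E.
  have row z k : \sum_l z * A k l * (if l == i then x else if l == j then y else 0) =
      z * A k i * x + z * A k j * y.
    rewrite (bigD1 i) //= eqxx (bigD1 j) /=; last by rewrite eq_sym.
    rewrite eq_sym (negbTE ij) eqxx big1 ?addr0 // => l /andP[li lj].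
    by rewrite (negbTE li) (negbTE lj) mulr0.
  under eq_bigr do rewrite row.
  rewrite (bigD1 i) //= eqxx (bigD1 j) /=; last by rewrite eq_sym.
  rewrite eq_sym (negbTE ij) eqxx big1 ?addr0 => [|l /andP[li lj]].
    by rewrite addrA.
  by rewrite (negbTE li) (negbTE lj) conjC0 !mul0r add0r.
have diag i : complex.Im (A i i) = 0.
  have := im (delta_mx i ord0); rewrite (bigD1 i) //= (bigD1 i) //= !mxE !eqxx.
  rewrite conjC1 mul1r mulr1 big1 => [|j ji]; last first.
    by rewrite !mxE (negbTE ji) mulr0.
  rewrite big1 ?addr0 // => j ji; rewrite big1 // => k _.
  by rewrite !mxE (negbTE ji) conjC0 !mul0r.
apply/matrixP => i j; rewrite !mxE.
have [->|ij] := eqVneq i j.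
  by case: (A j j) (diag j) => a b /= ->; rewrite /Num.conj /= oppr0.
have h1 := form2 i j 1 1 ij; have h2 := form2 i j 1 (0 +i* 1) ij.
move: h1 h2 (diag i) (diag j).
case: (A i i) (A i j) (A j i) (A j j) => [a1 b1] [a2 b2] [a3 b3] [a4 b4].
rewrite /Num.conj /= => h1 h2 h3 h4.
by apply/eqP; rewrite eq_complex /=; apply/andP; split; apply/eqP; lra.
Qed.

Lemma spectral_ge0 A k : nonneg_definite A ->
  0 <= complex.Re (spectral_diag A ord0 k).
Proof.
move=> A0; have AE := nonneg_definite_herm A0.
rewrite (spectral_form k AE).
have := A0 ((row k (spectralmx A)) ^t*); rewrite trCK.
by rewrite lecE => /andP[_].
Qed.

Lemma spectral_gt0 A k : nonneg_definite A -> A \in unitmx ->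
  0 < complex.Re (spectral_diag A ord0 k).
Proof.
move=> A0 uA; rewrite lt_neqAle spectral_ge0 // andbT eq_sym.
have AE := nonneg_definite_herm A0.
have := spectral_neq0 k AE uA; have := herm_spectral_real k AE.
case: (spectral_diag A ord0 k) => a b; rewrite complex_real /= => /eqP -> /eqP h.
by apply/eqP => a0; apply: h; rewrite a0.
Qed.

Lemma rcalc_ext A phi psi : nonneg_definite A ->
  (forall k, phi (complex.Re (spectral_diag A ord0 k)) =
             psi (complex.Re (spectral_diag A ord0 k))) -> rcalc phi A = rcalc psi A.
Proof.
by move=> A0 e; rewrite rcalc.unlock; apply: fcalc_ext => k; rewrite e.
Qed.

Lemma mxpow_mxpow A a b : mxpow (mxpow A a) b = mxpow A (a * b).
Proof.
have -> : mxpow A (a * b) = rcalc ((fun x => x `^ b) \o (fun x => x `^ a)) A.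
  by rewrite mxpowE; congr rcalc; apply/funext => x; rewrite /= powRrM.
by rewrite !mxpowE; exact: rcalc_comp.
Qed.

Lemma mxpow_trC A a : (mxpow A a) ^t* = mxpow A a.
Proof. by rewrite mxpowE rcalc_trC. Qed.

Lemma mxpow_mulN A a : nonneg_definite A -> A \in unitmx ->
  mxpow A a *m mxpow A (- a) = 1%:M.
Proof.
move=> A0 uA; rewrite !mxpowE rcalcM -[RHS](rcalc1 A).
apply: (rcalc_ext A0) => k.
by rewrite powRN mulfV // gt_eqF // powR_gt0 // spectral_gt0.
Qed.

Lemma mxpow_mulNV A a : nonneg_definite A -> A \in unitmx ->
  mxpow A (- a) *m mxpow A a = 1%:M.
Proof. by move=> A0 uA; rewrite -{2}(opprK a) mxpow_mulN. Qed.

Let sumsq (phi : R -> R) A := \sum_k phi (complex.Re (spectral_diag A ord0 k)) ^+ 2.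

Lemma fnorm_unitary P : P \is unitarymx -> fnorm P = Num.sqrt d%:R.
Proof.
move=> uP; congr Num.sqrt; transitivity (\sum_(i < d) 1 : R).
  apply: eq_bigr => i _; move/unitarymxP/matrixP/(_ i i): uP; rewrite !mxE eqxx.
  move/(congr1 (@complex.Re R)); rewrite Re_sum /= => <-; apply: eq_bigr => j _.
  by rewrite !mxE; case: (P i j) => a b; rewrite /cabs2 /= mulrN opprK -!expr2.
by rewrite sumr_const card_ord.
Qed.

Let fnorm_rdiag (phi : R -> R) A :
  fnorm (diag_mx (map_mx (fun z => (phi (complex.Re z))%:C) (spectral_diag A))) = Num.sqrt (sumsq phi A).
Proof.
congr Num.sqrt; apply: eq_bigr => i _; rewrite (bigD1 i) //= !mxE eqxx mulr1n.
rewrite (ord1 0) cabs2_real big1 ?addr0 // => j ji.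
by rewrite !mxE eq_sym (negbTE ji) mulr0n /cabs2 /= expr0n addr0.
Qed.

Lemma fnorm_rcalc_le phi A : fnorm (rcalc phi A) <= d%:R * Num.sqrt (sumsq phi A).
Proof.
have uQ := spectral_unitarymx A.
rewrite rcalc.unlock /fcalc; apply: (le_trans (fnormM _ _)).
apply: (@le_trans _ _ (fnorm (invmx (spectralmx A)) *
  fnorm (diag_mx (map_mx (fun z => (phi (complex.Re z))%:C) (spectral_diag A))) * fnorm (spectralmx A))).
  by rewrite ler_wpM2r ?fnorm_ge0 // fnormM.
rewrite invmx_spectral fnorm_trC fnorm_rdiag (fnorm_unitary uQ) mulrAC.
by rewrite -expr2 sqr_sqrtr ?ler0n.
Qed.

Lemma le_fnorm_rcalc phi A k :
  phi (complex.Re (spectral_diag A ord0 k)) <= d%:R * fnorm (rcalc phi A).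
Proof.
have uQ := spectral_unitarymx A; have uQ' := spectral_unit A.
apply: (@le_trans _ _ (fnorm (diag_mx (map_mx (fun z => (phi (complex.Re z))%:C) (spectral_diag A))))).
  set D := diag_mx _; have := normRe_le_fnorm D k k.
  rewrite !mxE eqxx mulr1n /= (ord1 0); exact: le_trans (ler_norm _).
rewrite diag_fcalc -rcalc_fcalc.
apply: (le_trans (fnormM _ _)); apply: (@le_trans _ _ (fnorm (spectralmx A) *
  fnorm (rcalc phi A) * fnorm (invmx (spectralmx A)))).
  by rewrite ler_wpM2r ?fnorm_ge0 // fnormM.
rewrite invmx_spectral fnorm_trC (fnorm_unitary uQ) mulrAC.
by rewrite -expr2 sqr_sqrtr ?ler0n.
Qed.

Lemma fnorm_rcalc_ub phi A (c : R) : 0 <= c ->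
  (forall k, `|phi (complex.Re (spectral_diag A ord0 k))| <= c) ->
  fnorm (rcalc phi A) <= d%:R * (Num.sqrt d%:R * c).
Proof.
move=> c0 h; apply: (le_trans (fnorm_rcalc_le _ _)); rewrite ler_wpM2l ?ler0n //.
rewrite -[X in _ * X](ger0_norm c0) -sqrtr_sqr -sqrtrM ?ler0n // ler_wsqrtr //.
apply: (@le_trans _ _ (\sum_(k < d) c ^+ 2)).
  apply: ler_sum => k _; rewrite -[X in X <= _]ger0_norm ?sqr_ge0 // normrX.
  by rewrite ler_pXn2r ?nnegrE.
by rewrite sumr_const card_ord mulr_natl.
Qed.

Definition cmp_const p : R :=
  (d%:R * (Num.sqrt d%:R * d%:R `^ p)) + (d%:R * (Num.sqrt d%:R * d%:R `^ p^-1)) `^ p.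

(** Both [A] and its [p]-th root are comparable with their largest eigenvalues,
    and these are the [p]-th power of one another. *)
Lemma fnorm_le_mxpow A p : nonneg_definite A -> 0 < p ->
  fnorm A <= cmp_const p * fnorm (mxpow A p^-1) `^ p.
Proof.
move=> A0 p0; set s := fnorm (mxpow A p^-1).
apply: (@le_trans _ _ (d%:R * (Num.sqrt d%:R * d%:R `^ p) * s `^ p)); last first.
  by rewrite ler_wpM2r ?powR_ge0 // lerDl powR_ge0.
rewrite -{1}(rcalc_id (nonneg_definite_herm A0)) -!mulrA -powRM ?ler0n ?fnorm_ge0 //.
rewrite ?mxpowE; apply: fnorm_rcalc_ub; first exact: powR_ge0.
move=> k; rewrite ger0_norm; last exact: spectral_ge0.
have := @le_fnorm_rcalc (fun x => x `^ p^-1) A k; rewrite -mxpowE -/s.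
have l0 := spectral_ge0 k A0.
move=> /(@ge0_ler_powR _ p (ltW p0)); rewrite -powRrM mulVf ?gt_eqF // powRr1 //.
by apply; rewrite nnegrE ?powR_ge0 // mulr_ge0 ?ler0n // fnorm_ge0.
Qed.

Lemma mxpow_le_fnorm A p : nonneg_definite A -> 0 < p ->
  fnorm (mxpow A p^-1) `^ p <= cmp_const p * fnorm A.
Proof.
move=> A0 p0; set s := fnorm A.
have s0 : 0 <= s by exact: fnorm_ge0.
apply: (@le_trans _ _ ((d%:R * (Num.sqrt d%:R * d%:R `^ p^-1)) `^ p * s)); last first.
  by rewrite ler_wpM2r // lerDr !mulr_ge0 ?ler0n ?sqrtr_ge0 ?powR_ge0.
have p1 : 0 <= p^-1 by rewrite invr_ge0 ltW.
have {1}-> : s = (s `^ p^-1) `^ p by rewrite -powRrM mulVf ?gt_eqF // powRr1.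
rewrite -powRM; last 2 first.
- by rewrite !mulr_ge0 ?ler0n ?sqrtr_ge0 ?powR_ge0.
- exact: powR_ge0.
apply: ge0_ler_powR; rewrite ?nnegrE ?fnorm_ge0 ?(ltW p0) //.
  by rewrite !mulr_ge0 ?ler0n ?sqrtr_ge0 ?powR_ge0.
rewrite -!mulrA -powRM ?ler0n //.
rewrite mxpowE; apply: fnorm_rcalc_ub; first exact: powR_ge0.
move=> k; rewrite ger0_norm ?powR_ge0 //.
have := @le_fnorm_rcalc id A k; rewrite (rcalc_id (nonneg_definite_herm A0)) -/s.
by move/(@ge0_ler_powR _ _ p1); apply; rewrite nnegrE ?mulr_ge0 ?ler0n ?spectral_ge0.
Qed.

End functional_calculus.

(** * Measurability of the powers of a matrix function *)

Section complex_measurable.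
Context {R : realType} {disp : measure_display} {T : measurableType disp}.
Local Open Scope sesquilinear_scope.
Local Open Scope complex_scope.
Local Notation C := R[i].

Definition cmfun (g : T -> C) : Prop :=
  measurable_fun setT (fun x => complex.Re (g x)) /\
  measurable_fun setT (fun x => complex.Im (g x)).

Definition mxmfun m n (X : T -> 'M[C]_(m, n)) := forall i j, cmfun (fun x => X x i j).

Lemma cmfun_cst c : cmfun (fun=> c).
Proof. by split; exact: measurable_cst. Qed.

Lemma cmfunD f g : cmfun f -> cmfun g -> cmfun (fun x => f x + g x).
Proof.
move=> [f1 f2] [g1 g2]; split.
  by under eq_fun do rewrite ReD; exact: measurable_funD.
by under eq_fun do rewrite ImD; exact: measurable_funD.
Qed.

Lemma cmfunM f g : cmfun f -> cmfun g -> cmfun (fun x => f x * g x).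
Proof.
move=> [f1 f2] [g1 g2]; split.
  under eq_fun do rewrite ReM.
  by apply: measurable_funB; exact: measurable_funM.
under eq_fun do rewrite ImM.
by apply: measurable_funD; exact: measurable_funM.
Qed.

Lemma cmfun_real (f : T -> R) : measurable_fun setT f -> cmfun (fun x => (f x)%:C).
Proof. by move=> mf; split => //=; exact: measurable_cst. Qed.

Lemma cmfun_sum (I : Type) (s : seq I) (f : I -> T -> C) :
  (forall i, cmfun (f i)) -> cmfun (fun x => \sum_(i <- s) f i x).
Proof.
move=> mf; split.
  under eq_fun do rewrite Re_sum.
  by apply: measurable_sum => i; have [] := mf i.
under eq_fun do rewrite Im_sum.
by apply: measurable_sum => i; have [] := mf i.
Qed.

Lemma mxmfunM m n l (X : T -> 'M[C]_(m, n)) (Y : T -> 'M[C]_(n, l)) :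
  mxmfun X -> mxmfun Y -> mxmfun (fun x => X x *m Y x).
Proof.
move=> mX mY i j; under eq_fun do rewrite mxE.
by apply: cmfun_sum => k; exact: cmfunM.
Qed.

Lemma mxmfunD m n (X Y : T -> 'M[C]_(m, n)) :
  mxmfun X -> mxmfun Y -> mxmfun (fun x => X x + Y x).
Proof. by move=> mX mY i j; under eq_fun do rewrite mxE; exact: cmfunD. Qed.

Lemma mxmfunZ m n (c : T -> C) (X : T -> 'M[C]_(m, n)) :
  cmfun c -> mxmfun X -> mxmfun (fun x => c x *: X x).
Proof. by move=> mc mX i j; under eq_fun do rewrite mxE; exact: cmfunM. Qed.

Lemma mxmfun_cst m n (A : 'M[C]_(m, n)) : mxmfun (fun=> A).
Proof. by move=> i j; exact: cmfun_cst. Qed.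

Lemma measurable_fnorm m n (X : T -> 'M[C]_(m, n)) : mxmfun X ->
  measurable_fun setT (fun x => fnorm (X x)).
Proof.
move=> mX; rewrite /fnorm.
apply: (measurableT_comp (continuous_measurable_fun (@sqrt_continuous R))).
apply: measurable_sum => i; apply: measurable_sum => j.
by have [h1 h2] := mX i j; apply: measurable_funD; exact: measurable_funX.
Qed.

Section matrix_powers.
Context {d : nat}.
Variable X : T -> 'M[C]_d.
Hypothesis mX : mxmfun X.
Hypothesis X0 : forall x, nonneg_definite (X x).

(** The class of functions whose functional calculus preserves measurability. No
    measurable choice of a diagonalisation is made: the powers are reached from the
    polynomials by pointwise limits, through the exponential and the logarithm. *)
Definition mcalc (phi : R -> R) := mxmfun (fun x => rcalc phi (X x)).

Lemma mcalc_ext phi psi :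
  (forall t, 0 <= t -> phi t = psi t) -> mcalc phi -> mcalc psi.
Proof.
move=> e; rewrite /mcalc (_ : (fun x => rcalc psi (X x)) = fun x => rcalc phi (X x)).
  exact.
apply/funext => x; apply: (rcalc_ext (X0 x)) => k.
by rewrite e // spectral_ge0.
Qed.

Lemma mcalcM phi psi : mcalc phi -> mcalc psi -> mcalc (fun t => phi t * psi t).
Proof.
move=> h1 h2 i j; under eq_fun do rewrite -rcalcM.
exact: mxmfunM.
Qed.

Lemma mcalc_lin (a b : R) phi psi : mcalc phi -> mcalc psi ->
  mcalc (fun t => a * phi t + b * psi t).
Proof.
move=> h1 h2 i j.
rewrite (_ : (fun x => _) = fun x => a%:C * rcalc phi (X x) i j + b%:C * rcalc psi (X x) i j).
  by apply: cmfunD; apply: cmfunM; [exact: cmfun_cst|exact: h1|exact: cmfun_cst|exact: h2].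
apply/funext => x; rewrite !rcalcE !mulr_sumr -big_split /=.
apply: eq_bigr => k _; rewrite rmorphD !rmorphM /= mulrDr mulrDl.
by congr (_ + _); rewrite -!mulrA; rewrite mulrCA.
Qed.

Lemma mcalc1 : mcalc (fun=> 1).
Proof. by move=> i j; under eq_fun do rewrite rcalc1; exact: mxmfun_cst. Qed.

Lemma mcalc_id : mcalc id.
Proof.
move=> i j; under eq_fun do rewrite (rcalc_id (nonneg_definite_herm (X0 _))).
exact: mX.
Qed.

Lemma mcalcX phi n : mcalc phi -> mcalc (fun t => phi t ^+ n).
Proof.
move=> h; elim: n => [|n IH]; first by under eq_fun do rewrite expr0; exact: mcalc1.
by under eq_fun do rewrite exprS; exact: mcalcM.
Qed.

Lemma mcalcZ (a : R) phi : mcalc phi -> mcalc (fun t => a * phi t).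
Proof.
move=> h; apply: (@mcalc_ext (fun t => a * phi t + 0 * phi t)); last exact: mcalc_lin.
by move=> t _; rewrite mul0r addr0.
Qed.

Lemma mcalcD phi psi : mcalc phi -> mcalc psi -> mcalc (fun t => phi t + psi t).
Proof.
move=> h1 h2; apply: (@mcalc_ext (fun t => 1 * phi t + 1 * psi t)); last exact: mcalc_lin.
by move=> t _; rewrite !mul1r.
Qed.

Let cvg_linear_sum (I : Type) (s : seq I) (u : I -> R) (v : I -> nat -> R) (l : I -> R) :
  (forall i, v i k @[k --> \oo] --> l i) ->
  \sum_(i <- s) u i * v i k @[k --> \oo] --> \sum_(i <- s) u i * l i.
Proof.
move=> h; elim: s => [|i s IH].
  by rewrite big_nil; under eq_fun do rewrite big_nil; exact: cvg_cst.
rewrite big_cons; under eq_fun do rewrite big_cons.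
by apply: cvgD => //; apply: cvgMr; exact: h.
Qed.

(** Pointwise convergence is enough, since only finitely many eigenvalues occur at
    each point. *)
Lemma mcalc_cvg (phi : nat -> R -> R) psi : (forall k, mcalc (phi k)) ->
  (forall t, 0 <= t -> phi k t @[k --> \oo] --> psi t) -> mcalc psi.
Proof.
move=> mphi h i j.
pose c x k := invmx (spectralmx (X x)) i k * spectralmx (X x) k j.
have cE f x : rcalc f (X x) i j =
    \sum_k c x k * (f (complex.Re (spectral_diag (X x) ord0 k)))%:C.
  by rewrite rcalcE; apply: eq_bigr => k _; rewrite mulrAC.
split.
- apply: (@measurable_fun_cvg _ _ _ _ (fun k x => complex.Re (rcalc (phi k) (X x) i j))).
    by move=> k; have [] := mphi k i j.
  move=> x _.
  have E f : complex.Re (rcalc f (X x) i j) =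
      \sum_k complex.Re (c x k) * f (complex.Re (spectral_diag (X x) ord0 k)).
    by rewrite cE Re_sum; apply: eq_bigr => k _; rewrite ReM /= mulr0 subr0.
  rewrite E; under eq_fun do rewrite E.
  by apply: cvg_linear_sum => k; apply: h; exact: spectral_ge0.
- apply: (@measurable_fun_cvg _ _ _ _ (fun k x => complex.Im (rcalc (phi k) (X x) i j))).
    by move=> k; have [] := mphi k i j.
  move=> x _.
  have E f : complex.Im (rcalc f (X x) i j) =
      \sum_k complex.Im (c x k) * f (complex.Re (spectral_diag (X x) ord0 k)).
    by rewrite cE Im_sum; apply: eq_bigr => k _; rewrite ImM /= mulr0 add0r.
  rewrite E; under eq_fun do rewrite E.
  by apply: cvg_linear_sum => k; apply: h; exact: spectral_ge0.
Qed.

Lemma mcalc_exp phi : mcalc phi -> mcalc (fun t => expR (phi t)).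
Proof.
move=> h; apply: (@mcalc_cvg (fun n t => series (exp_coeff (phi t)) n)); last first.
  by move=> t _; exact: is_cvg_series_exp_coeff.
elim=> [|n IH].
  apply: (@mcalc_ext (fun=> 0 * 1)); last by apply: mcalcZ; exact: mcalc1.
  by move=> t _; rewrite mul0r /series /= big_geq.
apply: (@mcalc_ext (fun t => series (exp_coeff (phi t)) n + (n`!%:R)^-1 * phi t ^+ n)).
  by move=> t _; rewrite seriesSr exp_coeffE.
by apply: mcalcD => //; apply: mcalcZ; exact: mcalcX.
Qed.

(** Newton's iteration for the root [ln t] of the convex function [e^y - t]. *)
Fixpoint newton_ln (k : nat) (t : R) : R :=
  if k is k'.+1 then newton_ln k' t - 1 + t * expR (- newton_ln k' t) else t - 1.

Lemma newton_ln_cvg t : 0 < t -> newton_ln k t @[k --> \oo] --> ln t.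
Proof.
move=> t0; have tE y : t * expR (- y) = expR (ln t - y) by rewrite expRD lnK // posrE.
have lb k : ln t <= newton_ln k t.
  case: k => [|k] /=.
    by have := expR_ge1Dx (ln t); rewrite lnK ?posrE //; lra.
  by rewrite tE; have := expR_ge1Dx (ln t - newton_ln k t); lra.
have dec : {homo newton_ln^~ t : n m / (n <= m)%N >-> m <= n}.
  apply/nonincreasing_seqP => k /=.
  have : t * expR (- newton_ln k t) <= 1 by rewrite tE expR_le1 subr_le0 lb.
  lra.
have cv : cvgn (newton_ln^~ t).
  apply: nonincreasing_is_cvgn => //; exists (ln t) => _ [k _ <-]; exact: lb.
set L := limn (newton_ln^~ t).
have LE : newton_ln^~ t @ \oo --> L by [].
have h : newton_ln k.+1 t @[k --> \oo] --> L - 1 + t * expR (- L).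
  apply: cvgD; first by apply: cvgB => //; exact: cvg_cst.
  apply: cvgMr.
  apply: (@continuous_cvg _ _ _ _ _ _ expR); first exact: continuous_expR.
  exact: cvgN.
have h' : newton_ln k.+1 t @[k --> \oo] --> L.
  by move: LE; rewrite -(cvg_shiftS (newton_ln^~ t)).
have LL : L = L - 1 + t * expR (- L) by apply: (cvg_unique _ h' h).
have tL : t * expR (- L) = 1 by lra.
suff -> : ln t = L by [].
have {1}-> : t = expR L.
  by rewrite -[LHS]mulr1 -[X in _ * X](@expRxMexpNx_1 _ L) mulrCA tL mulr1.
by rewrite expRK.
Qed.

(** The factor [1 - e^(-k t)] selects the value [0] of the powers at [t = 0]. *)
Lemma mcalc_powR (alpha : R) : alpha != 0 -> mcalc (fun t => t `^ alpha).
Proof.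
move=> a0.
have mln k : mcalc (newton_ln k).
  elim: k => [|k IH] /=.
    apply: (@mcalc_ext (fun t => 1 * t + (-1) * 1)); first by move=> t _; rewrite mul1r mulN1r.
    by apply: mcalc_lin; [exact: mcalc_id|exact: mcalc1].
  apply: mcalcD.
    apply: (@mcalc_ext (fun t => 1 * newton_ln k t + (-1) * 1)).
      by move=> t _; rewrite mul1r mulN1r.
    by apply: mcalc_lin => //; exact: mcalc1.
  apply: mcalcM; first exact: mcalc_id.
  apply: mcalc_exp; apply: (@mcalc_ext (fun t => -1 * newton_ln k t)); last exact: mcalcZ.
  by move=> t _; rewrite mulN1r.
apply: (@mcalc_cvg (fun k t => (1 - expR (- t) ^+ k) * expR (alpha * newton_ln k t))).
  move=> k; apply: mcalcM; last by apply: mcalc_exp; exact: mcalcZ.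
  apply: (@mcalc_ext (fun t => 1 * 1 + (-1) * expR (-1 * t) ^+ k)).
    by move=> t _; rewrite mul1r !mulN1r.
  apply: mcalc_lin; first exact: mcalc1.
  by apply: mcalcX; apply: mcalc_exp; apply: mcalcZ; exact: mcalc_id.
move=> t; rewrite le_eqVlt => /predU1P[<-|t0].
  rewrite powR0 //; apply: cvg_near_cst; near=> k.
  by rewrite oppr0 expR0 expr1n subrr mul0r.
rewrite /powR gt_eqF // -[X in _ --> X]mul1r; apply: cvgM.
  rewrite -[X in _ --> X](subr0 1); apply: cvgB; first exact: cvg_cst.
  apply: cvg_expr; rewrite ger0_norm ?expR_ge0 //.
  by rewrite expR_lt1 oppr_lt0.
apply: (@continuous_cvg _ _ _ _ _ _ expR); first exact: continuous_expR.
apply: cvgMr.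
exact: newton_ln_cvg.
Unshelve. all: by end_near. Qed.

Lemma mxmfun_mxpow alpha : alpha != 0 -> mxmfun (fun x => mxpow (X x) alpha).
Proof. by move=> a0; under eq_fun do rewrite mxpowE; exact: mcalc_powR. Qed.

End matrix_powers.
End complex_measurable.

(** * Dyadic cubes *)

Section dyadic_geometry.
Context {R : realType} {n : nat}.
Implicit Types (x : 'rV[R]_n) (j : int) (k : 'rV[int]_n) (m : nat).

Definition side j : R := 2 ^ (- j).

Lemma side_gt0 j : 0 < side j.
Proof. by rewrite /side exprz_gt0. Qed.

Lemma sideD j m : side j = 2 ^+ m * side (j + m%:Z).
Proof.
rewrite /side [X in X * _]exprnP -expfzDr ?pnatr_eq0 //.
by congr (_ ^ _); rewrite opprD addrCA subrr addr0.
Qed.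

Definition cube_index j x : 'rV[int]_n := \row_i Num.floor ((side j)^-1 * x ord0 i).

Definition ancestor m k : 'rV[int]_n := \row_i (k ord0 i %/ (2 ^ m)%N)%Z.

Lemma dyadic_cubeP j k x : dyadic_cube j k x <-> k = cube_index j x.
Proof.
have s0 := side_gt0 j; have su : side j != 0 by rewrite gt_eqF.
have E (a y : R) : (side j * a <= y < side j * (a + 1)) = (a <= (side j)^-1 * y < a + 1).
  by rewrite ler_pdivlMl // ltr_pdivrMl.
split=> [h|-> i]; last first.
  by rewrite -/(side j) E !mxE; have := floor_itv ((side j)^-1 * x ord0 i); rewrite intrD.
apply/rowP => i; rewrite mxE; symmetry; apply: floor_def.
by have := h i; rewrite -/(side j) E intrD.
Qed.

Lemma cube_indexP j x : dyadic_cube j (cube_index j x) x.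
Proof. exact/dyadic_cubeP. Qed.

Lemma ancestor_index j m x : ancestor m (cube_index (j + m%:Z) x) = cube_index j x.
Proof.
apply/rowP => i; rewrite !mxE; set y := x ord0 i; symmetry; apply: floor_def.
have s0 := side_gt0 (j + m%:Z); have := floor_itv ((side (j + m%:Z))^-1 * y).
set f := Num.floor _; move=> /andP[h1 h2].
have p0 : 0 < (2 ^ m)%N%:Z by rewrite ltz_nat expn_gt0.
rewrite (sideD j m) invfM -mulrA; set z := _^-1 * y in h1 h2 *.
have p0' : 0 < 2 ^+ m :> R by rewrite exprn_gt0.
have pE : ((2 ^ m)%N%:Z)%:~R = 2 ^+ m :> R by rewrite -pmulrn natrX.
rewrite ler_pdivlMl // ltr_pdivrMl // -pE -!intrM.
have fE := divz_eq f (2 ^ m)%N%:Z.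
have r0 := modz_ge0 f (lt0r_neq0 p0); have r1 := ltz_pmod f p0.
apply/andP; split; first by apply: le_trans h1; rewrite ler_int {2}fE; nia.
by apply: lt_le_trans h2 _; rewrite ler_int {1}fE; nia.
Qed.

Lemma dyadic_cube_ancestor j m k x :
  dyadic_cube (j + m%:Z) k x -> dyadic_cube j (ancestor m k) x.
Proof. by move=> /dyadic_cubeP ->; rewrite ancestor_index; exact: cube_indexP. Qed.

Lemma dyadic_cube_disj j k k' x : dyadic_cube j k x -> dyadic_cube j k' x -> k = k'.
Proof. by move=> /dyadic_cubeP -> /dyadic_cubeP ->. Qed.

Definition child m k (e : 'rV['I_(2 ^ m)]_n) : 'rV[int]_n :=
  \row_i (k ord0 i * (2 ^ m)%N%:Z + (e ord0 i : nat)%:Z).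

Lemma ancestor_child m k e : ancestor m (@child m k e) = k.
Proof.
have p0 : (2 ^ m)%N%:Z != 0 by rewrite eqz_nat -lt0n expn_gt0.
apply/rowP => i; rewrite !mxE (divzMDl _ _ p0) divz_small ?addr0 //.
have := ltn_ord (e ord0 i); set a := nat_of_ord (e ord0 i); clearbody a; lia.
Qed.

Lemma child_inj m k : injective (@child m k).
Proof.
move=> e e' /rowP h; apply/rowP => i; have := h i; rewrite !mxE.
by move=> /addrI [] /ord_inj.
Qed.

Lemma child_surj m k : exists e, k = @child m (ancestor m k) e.
Proof.
have p0 : 0 < (2 ^ m)%N%:Z by rewrite ltz_nat expn_gt0.
have h i : (`|(k ord0 i %% (2 ^ m)%N)%Z| < 2 ^ m)%N.
  have := ltz_pmod (k ord0 i) p0; have := modz_ge0 (k ord0 i) (lt0r_neq0 p0).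
  by case: (_ %% _)%Z.
exists (\row_i Ordinal (h i)); apply/rowP => i; rewrite !mxE /=.
rewrite {1}(divz_eq (k ord0 i) (2 ^ m)%N) gez0_abs //.
exact: modz_ge0 (lt0r_neq0 p0).
Qed.

(** The cubes of level [j + m] are numbered by their ancestor of level [j] and
    their position in it. *)
Lemma child_bij m : set_bij [set: 'rV[int]_n * 'rV['I_(2 ^ m)]_n] [set: 'rV[int]_n]
  (fun ke => @child m ke.1 ke.2).
Proof.
split=> //.
- move=> [k e] [k' e'] _ _ /= h.
  have kk : k = k' by rewrite -(ancestor_child k e) h ancestor_child.
  by rewrite kk in h *; rewrite (child_inj h).
- by move=> k _ /=; have [e ke] := child_surj m k; exists (ancestor m k, e).
Qed.

Lemma dyadic_cube_children j m k :
  dyadic_cube j k = \big[setU/set0]_(e <- enum 'rV['I_(2 ^ m)]_n)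
    dyadic_cube (j + m%:Z) (@child m k e) :> set 'rV[R]_n.
Proof.
apply/seteqP; split=> x.
  move=> /dyadic_cubeP kE; have := cube_indexP (j + m%:Z) x.
  have [e ->] := child_surj m (cube_index (j + m%:Z) x).
  rewrite ancestor_index -kE => h; rewrite -bigcup_seq; exists e => //=.
  by rewrite mem_enum.
rewrite -bigcup_seq => -[e _] /dyadic_cube_ancestor.
by rewrite ancestor_child.
Qed.

Definition center j k : 'rV[R]_n := \row_i (side j * ((k ord0 i)%:~R + 2^-1)).

Lemma dyadic_cubeE j k : dyadic_cube j k = cube (center j k) (side j).
Proof.
apply/seteqP; split=> x h i; have := h i; rewrite -/(side j) mxE.
  by move=> /andP[h1 h2]; apply/andP; split; lra.
by move=> /andP[h1 h2]; apply/andP; split; lra.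
Qed.

(** A dyadic cube lies in every cube of twice its side centered in it. *)
Lemma dyadic_cube_ancestor_sub j m k :
  dyadic_cube j (ancestor m k) `<=`
  cube (center (j + m%:Z) k) (2 ^+ m.+1 * side (j + m%:Z)).
Proof.
have s0 := side_gt0 (j + m%:Z).
set c := center _ _ => x xQ.
have : dyadic_cube (j + m%:Z) k c.
  move=> i; rewrite -/(side _) mxE ler_pM2l // ltr_pM2l //; apply/andP; split; lra.
move=> /dyadic_cube_ancestor cQ i; have := xQ i; have := cQ i.
have e : 2 ^+ m.+1 * side (j + m%:Z) = 2 * side j by rewrite exprS -mulrA -sideD.
rewrite e -/(side j).
move: (c ord0 i) (x ord0 i) (side j) ((ancestor m k) ord0 i)%:~R => a b s q.
by move=> /andP[h1 h2] /andP[h3 h4]; apply/andP; split; lra.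
Qed.

Lemma index_bounded j (N : R) : finite_set
  [set k : 'rV[int]_n | exists2 x : 'rV[R]_n, (forall i, `|x ord0 i| <= N) & k = cube_index j x].
Proof.
pose M := `|Num.floor ((side j)^-1 * N)|%N.+1.
pose f (e : 'rV['I_(M + M).+1]_n) : 'rV[int]_n := \row_i ((e ord0 i : nat)%:Z - M%:Z).
apply: (@sub_finite_set _ _ [set f e | e in [set: 'rV['I_(M + M).+1]_n]]); last first.
  by apply: finite_image; exact: finite_finset.
move=> k [x xN ->].
have s0 : 0 < (side j)^-1 by rewrite invr_gt0 side_gt0.
have h i : - M%:Z <= Num.floor ((side j)^-1 * x ord0 i) <= M%:Z.
  have := xN i; rewrite ler_norml => /andP[h1 h2].
  have N1 : Num.floor ((side j)^-1 * N) < M%:Z.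
    by rewrite /M; case: (Num.floor _) => a //=; rewrite ltz_nat.
  apply/andP; split; last first.
    by apply: (le_trans _ (ltW N1)); apply: le_floor; rewrite ler_pM2l.
  rewrite floor_ge_int rmorphN /=.
  apply: (@le_trans _ _ (- ((side j)^-1 * N))); last by rewrite -mulrN ler_pM2l.
  rewrite lerN2; apply/ltW; have /andP[_] := floor_itv ((side j)^-1 * N).
  by move/lt_le_trans; apply; rewrite ler_int lezD1.
have h' i : (`|(Num.floor ((side j)^-1 * x ord0 i) + M%:Z)%R|%N < (M + M).+1)%N.
  by have := h i; move: (Num.floor _) => z; lia.
exists (\row_i Ordinal (h' i)) => //; apply/rowP => i; rewrite !mxE /= gez0_abs ?addrK //.
by have /andP[h1 _] := h i; rewrite -lerBlDr sub0r.
Qed.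

Lemma finite_box_cover j (N : R) : exists s : seq 'rV[int]_n, uniq s /\
  forall x : 'rV[R]_n, (forall i, `|x ord0 i| <= N) ->
    exists2 k, k \in s & dyadic_cube j k x.
Proof.
have /finite_seqP[s sE] := index_bounded j N; exists (undup s); split.
  exact: undup_uniq.
move=> x xN; exists (cube_index j x); last exact: cube_indexP.
have : [set` s] (cube_index j x) by rewrite -sE; exists x.
by rewrite mem_undup.
Qed.

Lemma compact_box (K : set 'rV[R]_n) : compact K ->
  exists N : R, forall x, K x -> forall i, `|x ord0 i| <= N.
Proof.
move=> cK.
have h (i : 'I_n) : exists N : R, forall x, K x -> `|x ord0 i| <= N.
  have : compact [set x ord0 i | x in K].
    apply: continuous_compact => //; apply: continuous_subspaceT.
    exact: coord_continuous.
  move=> /compact_bounded [M [_ hM]]; exists (M + 1) => x Kx.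
  by apply: (hM (M + 1)) => //=; [rewrite ltrDl|exists x].
have [N hN] := choice h.
exists (\sum_i `|N i|) => x Kx i; apply: (le_trans (hN i x Kx)).
apply: (le_trans (ler_norm _)).
by rewrite (bigD1 i) //= lerDl sumr_ge0.
Qed.

Lemma eball_box (rho : R) (x : 'rV[R]_n) i : eball rho x -> `|x ord0 i| <= rho.
Proof.
move=> /ltW; apply: le_trans; rewrite -sqrtr_sqr ler_wsqrtr //.
by rewrite (bigD1 i) //= lerDl sumr_ge0 // => k _; exact: sqr_ge0.
Qed.

Lemma dyadic_cube_compact j k :
  exists2 K : set 'rV[R]_n, compact K & dyadic_cube j k `<=` K.
Proof.
pose A (i : 'I_n) : set R := `[side j * (k ord0 i)%:~R, side j * ((k ord0 i)%:~R + 1)]%classic.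
exists [set x : 'rV[R]_n | forall i, A i (x ord0 i)].
  by apply: rV_compact => i; exact: segment_compact.
move=> x xQ i; have := xQ i; rewrite -/(side j) /A /= in_itv /= => /andP[-> /ltW ->].
by [].
Qed.

Lemma dyadic_cube_eball j k : exists rho : R, dyadic_cube j k `<=` eball rho.
Proof.
have [K cK QK] := dyadic_cube_compact j k; have [N KN] := compact_box cK.
exists (Num.sqrt (\sum_(i < n) N ^+ 2) + 1) => x /QK /KN h /=.
apply: (@le_lt_trans _ _ (Num.sqrt (\sum_(i < n) N ^+ 2))); last by rewrite ltrDl.
rewrite ler_wsqrtr // ler_sum // => i _; have := h i; rewrite ler_norml => /andP[h1 h2].
nra.
Qed.

End dyadic_geometry.

(** * Lebesgue measure of cubes *)

HB.instance Definition _ (R : realType) (n : nat) :=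
  Measure_isSigmaFinite.Build _ _ _ (lebesgueRn R n)
    (@completed_measure_extension_sigma_finite _ _ _ (lebesgue_borelRn R n)
      (sigma_finiteT (lebesgue_borelRn R n))).

Section lebesgue_cubes.
Context {R : realType}.

Lemma borel_lebesgue n (A : set (borelRn R n)) :
  measurable A -> measurable (A : set (lebRn R n)).
Proof. by move=> mA; apply: sub_caratheodory; exact: sub_sigma_algebra. Qed.

Lemma lebesgueRnE n (A : set (borelRn R n)) :
  measurable A -> lebesgueRn R n A = lebesgue_borelRn R n A.
Proof. exact: measurable_mu_extE. Qed.

Lemma measurable_coord n (i : 'I_n) :
  measurable_fun [set: lebRn R n] (fun x => (x : 'rV[R]_n) ord0 i).
Proof.
move=> _ Y mY; apply: borel_lebesgue; rewrite setTI.
rewrite -[X in measurable X]setTI.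
exact: (@measurable_borelRn_coord R n i measurableT Y mY).
Qed.

Definition box n (c : 'rV[R]_n) (l : R) : set (borelRn R n) :=
  [set x | forall i, c ord0 i <= (x : 'rV[R]_n) ord0 i < c ord0 i + l].

Lemma measurable_box n (c : 'rV[R]_n) l : measurable (box c l).
Proof.
have -> : box c l = \bigcap_(i : 'I_n)
    ((@borelRn_coord R n i) @^-1` `[c ord0 i, c ord0 i + l[%classic).
  apply/seteqP; split=> x h i.
    by move=> _; rewrite /= in_itv /=; exact: h.
  by have := h i Logic.I; rewrite /= in_itv.
apply: fin_bigcap_measurable; first exact: finite_finset.
move=> i _; rewrite -[X in measurable X]setTI.
exact: measurable_borelRn_coord.
Qed.

Let consRn0 n (x : measurableTypeR R) (y : borelRn R n) :
  (consRn (x, y) : 'rV[R]_n.+1) ord0 ord0 = x.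
Proof.
rewrite /consRn; have -> : (ord0 : 'I_n.+1) = lshift n (ord0 : 'I_1) by exact: ord_inj.
by apply: etrans (row_mxEl _ _ _ _) _; rewrite mxE eqxx mulr1n.
Qed.

Let consRnS n (x : measurableTypeR R) (y : borelRn R n) i :
  (consRn (x, y) : 'rV[R]_n.+1) ord0 (lift ord0 i) = (y : 'rV[R]_n) ord0 i.
Proof.
rewrite /consRn (_ : lift ord0 i = rshift 1 i); last exact: ord_inj.
exact: row_mxEr.
Qed.

(** A box is the image of the product of an interval and a box of one dimension
    less. *)
Lemma lebesgue_borelRn_box n (c : 'rV[R]_n) l : 0 <= l ->
  lebesgue_borelRn R n (box c l) = (l ^+ n)%:E.
Proof.
move=> l0; elim: n c => [|n IH] c.
  rewrite expr0 /= diracE mem_set // => -[] //.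
pose c' : 'rV[R]_n := \row_i c ord0 (lift ord0 i).
have E : (@consRn R n) @^-1` box c l =
    `[c ord0 ord0, c ord0 ord0 + l[%classic `*` box c' l.
  apply/seteqP; split => -[x y] /=.
    move=> h; split => /=; first by have := h ord0; rewrite consRn0 in_itv.
    by move=> i; have := h (lift ord0 i); rewrite consRnS mxE.
  move=> [/= hx hy] i; have [j ->|->] := unliftP ord0 i.
    by have := hy j; rewrite consRnS mxE.
  by move: hx; rewrite consRn0 in_itv.
rewrite /= /lebesgue_borelRnS /pushforward E product_measure1E //; last first.
  exact: measurable_box.
rewrite [X in (_ * X)%E]IH [X in (X * _)%E]lebesgue_measure_itv /= lte_fin ltrDl.
rewrite exprS EFinM; case: ltP => [l1|l1]; first by rewrite -EFinB addrC addKr.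
have -> : l = 0 by apply/eqP; rewrite eq_le l0 l1.
by rewrite mul0e.
Qed.

Context {n : nat}.

Lemma measurable_cube (c : 'rV[R]_n) l : measurable (cube c l : set (lebRn R n)).
Proof.
have -> : cube c l = box (\row_i (c ord0 i - l / 2)) l.
  apply/seteqP; split=> x h i; have := h i; rewrite mxE => /andP[h1 h2];
  by apply/andP; split; lra.
by apply: borel_lebesgue; exact: measurable_box.
Qed.

Lemma lebesgue_cube (c : 'rV[R]_n) l : 0 <= l -> lebesgueRn R n (cube c l) = (l ^+ n)%:E.
Proof.
move=> l0; have -> : cube c l = box (\row_i (c ord0 i - l / 2)) l.
  apply/seteqP; split=> x h i; have := h i; rewrite mxE => /andP[h1 h2];
  by apply/andP; split; lra.
rewrite lebesgueRnE; first exact: lebesgue_borelRn_box.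
exact: measurable_box.
Qed.

Lemma vol_cube (c : 'rV[R]_n) l : 0 <= l -> vol (cube c l) = l ^+ n.
Proof. by move=> l0; rewrite /vol lebesgue_cube. Qed.

Lemma measurable_dyadic j k : measurable (dyadic_cube j k : set (lebRn R n)).
Proof. by rewrite dyadic_cubeE; exact: measurable_cube. Qed.

Lemma lebesgue_dyadic j k : lebesgueRn R n (dyadic_cube j k) = (side j ^+ n)%:E.
Proof. by rewrite dyadic_cubeE lebesgue_cube // ltW // side_gt0. Qed.

Lemma vol_dyadic j k : vol (dyadic_cube j k : set 'rV[R]_n) = side j ^+ n.
Proof. by rewrite /vol lebesgue_dyadic. Qed.

Lemma measurable_eball (rho : R) : measurable (eball rho : set (lebRn R n)).
Proof.
pose f (x : lebRn R n) := Num.sqrt (\sum_i (x : 'rV[R]_n) ord0 i ^+ 2).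
have mf : measurable_fun setT f.
  apply: (measurableT_comp (continuous_measurable_fun (@sqrt_continuous R))).
  by apply: measurable_sum => i; apply: measurable_funX; exact: measurable_coord.
have -> : eball rho = f @^-1` `]-oo, rho[%classic.
  by apply/seteqP; split=> x /=; rewrite in_itv.
by rewrite -[X in measurable X]setTI; exact: mf.
Qed.

End lebesgue_cubes.

Lemma ae_imp disp (T : measurableType disp) (R : realType)
    (mu : {measure set T -> \bar R}) (P Q : T -> Prop) :
  {ae mu, forall x, P x} -> (forall x, P x -> Q x) -> {ae mu, forall x, Q x}.
Proof. by move=> h PQ; apply: filterS h => x; exact: PQ. Qed.

(** * Integrals of nonnegative functions *)

Section integral_tools.
Local Open Scope ereal_scope.

(** The integral of a nonnegative function is a supremum over simple functions, and
    as such it is monotone without any measurability. *)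
Lemma ge0_le_integral_any disp (T : measurableType disp) (R : realType)
    (mu : {measure set T -> \bar R}) (D E : set T) (f g : T -> \bar R) :
  (forall x, D x -> 0 <= f x) -> (forall x, E x -> 0 <= g x) -> D `<=` E ->
  (forall x, D x -> f x <= g x) -> \int[mu]_(x in D) f x <= \int[mu]_(x in E) g x.
Proof.
move=> f0 g0 DE fg; rewrite !ge0_integralE //.
apply: ge_ereal_sup => _ [h hf <-]; apply: ereal_sup_ubound; exists h => //= x.
apply: le_trans (hf x) _; rewrite /patch.
case: ifPn => [/set_mem Dx|_].
  by rewrite mem_set; [exact: fg|exact: DE].
by case: ifPn => // /set_mem Ex; exact: g0.
Qed.

Lemma ge0_integralMl disp (T : measurableType disp) (R : realType)
    (mu : {measure set T -> \bar R}) (D : set T) (f : T -> \bar R) (k : R) :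
  measurable D -> measurable_fun setT f -> (forall x, 0 <= f x) -> (0 <= k)%R ->
  k%:E * \int[mu]_(x in D) f x = \int[mu]_(x in D) (k%:E * f x).
Proof.
by move=> mD mf f0 k0; rewrite ge0_integralZl //; exact: measurable_funTS.
Qed.

Lemma ae_ge0_le_integral_any disp (T : measurableType disp) (R : realType)
    (mu : {measure set T -> \bar R}) (D : set T) (f g : T -> \bar R) :
  measurable D -> measurable_fun D f -> measurable_fun D g ->
  (forall x, 0 <= f x) -> (forall x, 0 <= g x) ->
  {ae mu, forall x, D x -> f x <= g x} ->
  \int[mu]_(x in D) f x <= \int[mu]_(x in D) g x.
Proof.
by move=> mD mf mg f0 g0 h; apply: ae_ge0_le_integral.
Qed.

Section tonelli.
Context {d1 d2 : measure_display} {T1 : measurableType d1} {T2 : measurableType d2}.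
Context {R : realType}.
Variable m1 : {sigma_finite_measure set T1 -> \bar R}.
Variable m2 : {sigma_finite_measure set T2 -> \bar R}.
Variable f : T1 * T2 -> \bar R.
Hypothesis mf : measurable_fun setT f.
Hypothesis f0 : forall z, 0 <= f z.

Let mrestr (P : set T1) (Q : set T2) : measurable P -> measurable Q ->
  measurable_fun setT (f \_ (P `*` Q)).
Proof.
move=> mP mQ; apply/(measurable_restrictT f (measurableX mP mQ)).
exact: measurable_funTS.
Qed.

Let restr0 (P : set T1) (Q : set T2) z : 0 <= (f \_ (P `*` Q)) z.
Proof. by rewrite /patch; case: ifP. Qed.

Lemma measurable_integral_snd (Q : set T2) : measurable Q ->
  measurable_fun setT (fun x => \int[m2]_(y in Q) f (x, y)).
Proof.
move=> mQ; have := @measurable_fun_fubini_tonelli_F _ _ _ _ _ m2 _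
  (mrestr measurableT mQ) (restr0 setT Q).
congr measurable_fun; apply/funext => x; rewrite /fubini_F [RHS]integral_mkcond.
apply: eq_integral => y _; rewrite /patch.
by congr (if _ then _ else _); apply/idP/idP => /set_mem h; apply/mem_set => //; case: h.
Qed.

Lemma tonelli_rect (P : set T1) (Q : set T2) : measurable P -> measurable Q ->
  \int[m1]_(x in P) \int[m2]_(y in Q) f (x, y) =
  \int[m2]_(y in Q) \int[m1]_(x in P) f (x, y).
Proof.
move=> mP mQ; have := @fubini_tonelli _ _ _ _ _ m1 m2 _ (mrestr mP mQ) (restr0 P Q).
move=> e; rewrite [LHS]integral_mkcond [RHS]integral_mkcond.
apply: etrans (etrans e _).
  apply: eq_integral => x _; rewrite {1}/patch.
  case: ifPn => [/set_mem Px|/negP Px].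
    rewrite integral_mkcond; apply: eq_integral => y _; rewrite /patch.
    by congr (if _ then _ else _); apply/idP/idP => /set_mem h; apply/mem_set => //; case: h.
  rewrite integral0_eq // => y _; rewrite /patch ifF //; apply/negP => /set_mem[/= h _].
  by apply: Px; exact: mem_set.
apply: eq_integral => y _; rewrite [in RHS]/patch.
case: ifPn => [/set_mem Qy|/negP Qy].
  rewrite [RHS]integral_mkcond; apply: eq_integral => x _; rewrite /patch.
  by congr (if _ then _ else _); apply/idP/idP => /set_mem h; apply/mem_set => //; case: h.
rewrite integral0_eq // => x _; rewrite /patch ifF //; apply/negP => /set_mem[/= _ h].
by apply: Qy; exact: mem_set.
Qed.

End tonelli.

Section powers.
Context {R : realType}.

Lemma le_poweR (p : R) (a b : \bar R) : (0 <= p)%R -> 0 <= a -> a <= b ->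
  poweR a p <= poweR b p.
Proof.
move=> p0 a0 ab; apply: gt0_ler_poweR => //; rewrite in_itv /= leey andbT //.
exact: le_trans ab.
Qed.

Lemma poweR_EFinM (p a : R) (x : \bar R) : (0 <= a)%R -> 0 <= x ->
  poweR (a%:E * x) p = (a `^ p)%:E * poweR x p.
Proof. by move=> a0 x0; rewrite poweRM // ?lee_fin // poweR_EFin. Qed.

(** The power of a sum is at most the power of twice the larger term. *)
Lemma powR_add_le (p a b : R) : (0 <= p)%R -> (0 <= a)%R -> (0 <= b)%R ->
  ((a + b) `^ p <= 2 `^ p * (a `^ p + b `^ p))%R.
Proof.
move=> p0 a0 b0; wlog ab : a b a0 b0 / (a <= b)%R.
  by move=> H; case: (leP a b) => [/H|/ltW /H]; [exact|rewrite addrC [X in (_ * X)%R]addrC; exact].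
apply: (@le_trans _ _ ((2 * b) `^ p))%R.
  by apply: ge0_ler_powR; rewrite ?nnegrE; lra.
by rewrite powRM // ler_wpM2l ?powR_ge0 // lerDr powR_ge0.
Qed.

Lemma poweR_add_le (p : R) (a b : \bar R) : (0 < p)%R -> 0 <= a -> 0 <= b ->
  poweR (a + b) p <= (2 `^ p)%:E * (poweR a p + poweR b p).
Proof.
move=> p0; have c0 : (0 < 2 `^ p :> R)%R by rewrite powR_gt0.
case: a => [a| |]// a0; case: b => [b| |]// b0.
- rewrite -EFinD !poweR_EFin -EFinD -EFinM lee_fin.
  by apply: powR_add_le; [exact: ltW|rewrite -lee_fin|rewrite -lee_fin].
- by rewrite addeC /= gt_eqF // addey ?gt0_muley ?leey ?lte_fin.
- by rewrite /= gt_eqF // addye ?gt0_muley ?leey ?lte_fin // -ltNye (lt_le_trans _ (poweR_ge0 _ _)).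
- by rewrite /= gt_eqF // gt0_muley ?leey ?lte_fin.
Qed.

End powers.

(** Hölder's inequality raised to the power [p], which keeps the left side an iterated
    integral to which Tonelli's theorem applies. *)
Lemma hoelder_poweR disp (T : measurableType disp) (R : realType)
    (mu : {measure set T -> \bar R}) (D : set T) (f g : T -> R) (p q : R) :
  measurable D -> measurable_fun setT f -> measurable_fun setT g ->
  (forall x, 0 <= f x)%R -> (forall x, 0 <= g x)%R ->
  (0 < p)%R -> (0 < q)%R -> (p^-1 + q^-1 = 1)%R ->
  poweR (\int[mu]_(x in D) (f x * g x)%:E) p <=
  poweR (\int[mu]_(x in D) (f x `^ q)%:E) (p / q)%R * \int[mu]_(x in D) (g x `^ p)%:E.
Proof.
move=> mD mf mg f0 g0 p0 q0 pq.
pose f1 := (f \_ D)%R; pose g1 := (g \_ D)%R.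
have mf1 : measurable_fun setT f1.
  by apply/(measurable_restrictT f mD); exact: measurable_funTS.
have mg1 : measurable_fun setT g1.
  by apply/(measurable_restrictT g mD); exact: measurable_funTS.
have f10 x : (0 <= f1 x)%R by rewrite /f1 /patch; case: ifP.
have g10 x : (0 <= g1 x)%R by rewrite /g1 /patch; case: ifP.
have qp : (q^-1 + p^-1 = 1)%R by rewrite addrC.
have restr (h h1 : T -> R) (e : R) : e != 0%R -> (h1 = h \_ D)%R ->
    \int[mu]_x (h1 x `^ e)%:E = \int[mu]_(x in D) (h x `^ e)%:E.
  move=> e0 ->; rewrite [RHS]integral_mkcond; apply: eq_integral => x _.
  by rewrite /patch; case: ifP => // _; rewrite powR0.
have := hoelder mu mf1 mg1 q0 p0 qp; rewrite Lnorm1.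
have Nf (h : T -> R) (e : R) : (0 < e)%R -> (forall x, 0 <= h x)%R ->
    'N[mu]_e%:E[EFin \o h] = poweR (\int[mu]_x (h x `^ e)%:E) e^-1.
  move=> e0 h0; rewrite unlock /Lnorm; congr poweR; apply: eq_integral => x _ /=.
  by rewrite ger0_norm.
rewrite !Nf // (restr f f1) ?gt_eqF // (restr g g1) ?gt_eqF //.
have -> : \int[mu]_x `|(EFin \o (f1 \* g1)%R) x| = \int[mu]_(x in D) (f x * g x)%:E.
  rewrite [RHS]integral_mkcond; apply: eq_integral => x _ /=.
  rewrite ger0_norm ?mulr_ge0 // /f1 /g1 /patch; case: ifP => // _.
  by rewrite mulr0.
move=> /(@le_poweR _ p _ _ (ltW p0)) h; apply: (le_trans (h _)).
  by apply: integral_ge0 => x _; rewrite lee_fin mulr_ge0.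
rewrite poweRM ?poweR_ge0 // -!poweRrM mulVf ?gt_eqF // poweRe1; last first.
  by apply: integral_ge0 => x _; rewrite lee_fin powR_ge0.
by rewrite mulrC.
Qed.

End integral_tools.

(** * The kernel of the averaging operators *)

(** Locked for the same reason as [rcalc]. *)
HB.lock Definition mpow {R : realType} {d : nat} (A : 'M[R[i]]_d) (a : R) : 'M[R[i]]_d :=
  mxpow A a.

Lemma mpowE {R : realType} {d : nat} (A : 'M[R[i]]_d) a : mxpow A a = mpow A a.
Proof. by rewrite mpow.unlock. Qed.

Section kernel.
Context {R : realType} {n d : nat}.
Local Notation C := R[i].
Local Notation mu := (lebesgueRn R n).
Local Open Scope ereal_scope.
Implicit Types (W : lebRn R n -> 'M[C]_d) (P Q : set (lebRn R n)).

(** The Frobenius norm is comparable with the operator norm, and its measurability is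
    that of the entries. *)
Definition kernel p W (x y : lebRn R n) : R :=
  fnorm (mpow (W x) p^-1 *m mpow (W y) (- p^-1)).

Lemma kernel_ge0 p W x y : (0 <= kernel p W x y)%R.
Proof. exact: fnorm_ge0. Qed.

Lemma measurable_kernel p W : (p != 0)%R ->
  mxmfun W -> (forall x, nonneg_definite (W x)) ->
  measurable_fun setT (fun z : lebRn R n * lebRn R n => kernel p W z.1 z.2).
Proof.
move=> p0 mW W0; have pi0 : (p^-1 != 0)%R by rewrite invr_neq0.
have h a (pr : lebRn R n * lebRn R n -> lebRn R n) : a != 0%R -> measurable_fun setT pr ->
    mxmfun (fun z => mpow (W (pr z)) a).
  move=> a0 mpr i j; under eq_fun do rewrite -mpowE.
  have := @mxmfun_mxpow R _ (lebRn R n) d W mW W0 a a0 i j.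
  by move=> [m1 m2]; split; [exact: (measurableT_comp m1 mpr)|exact: (measurableT_comp m2 mpr)].
have ni0 : (- p^-1 != 0)%R by rewrite oppr_eq0.
apply: measurable_fnorm; apply: mxmfunM.
  exact: (h _ fst pi0 measurable_fst).
exact: (h _ snd ni0 measurable_snd).
Qed.

Lemma kernel_le_Ap_kernel p W x y :
  (kernel p W x y <= Num.sqrt d%:R * Ap_kernel p W x y)%R.
Proof. by rewrite /kernel -!mpowE; exact: fnorm_le_opnorm. Qed.

Lemma Ap_kernel_ge0 p W x y : (0 <= Ap_kernel p W x y)%R.
Proof. exact: opnorm_ge0. Qed.

(** The averages are turned into integrals and the operator norm into the Frobenius
    norm. *)
Lemma Ap_mean_kernel_gt1 p W Q P (c : R) : (0 < d)%N -> (1 < p)%R ->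
  measurable_fun setT (fun z : lebRn R n * lebRn R n => kernel p W z.1 z.2) ->
  measurable Q -> measurable P -> (0 < vol Q)%R -> (0 < vol P)%R ->
  Ap_mean p W Q P <= c%:E ->
  \int[mu]_(x in Q) poweR (\int[mu]_(y in P) (kernel p W x y `^ conj_exp p)%:E) (p / conj_exp p)
  <= (((Num.sqrt d%:R `^ conj_exp p * vol P) `^ (p / conj_exp p)) * (vol Q * c))%:E.
Proof.
move=> d0 p1 mker mQ mP vQ vP; set p' := conj_exp p.
have p0 : (0 < p)%R by lra.
have p'0 : (0 < p')%R by rewrite /p' /conj_exp divr_gt0 //; lra.
have pp0 : (0 <= p / p')%R by rewrite divr_ge0 // ltW.
rewrite /Ap_mean (leNgt p 1%R) p1 /= /avg -/p' lee_pdivrMl // => h.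
have sd : (0 < Num.sqrt d%:R :> R)%R by rewrite sqrtr_gt0 ltr0n.
pose b : R := ((Num.sqrt d%:R `^ p' * vol P)^-1)%R.
have b0 : (0 < b)%R by rewrite invr_gt0 mulr_gt0 // powR_gt0.
pose G x := \int[mu]_(y in P) (kernel p W x y `^ p')%:E.
have mk : measurable_fun setT (fun z : lebRn R n * lebRn R n => (kernel p W z.1 z.2 `^ p')%:E).
  by apply/measurable_EFinP; apply: (measurableT_comp (measurable_powR p')).
have k0 z : 0 <= (kernel p W z.1 z.2 `^ p')%:E by rewrite lee_fin powR_ge0.
have mG : measurable_fun setT G by exact: (measurable_integral_snd mu mk k0 mP).
have G0 x : 0 <= G x by apply: integral_ge0 => y _; exact: (k0 (x, y)).
have mG' : measurable_fun setT (fun x => poweR (G x) (p / p')).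
  exact: (measurableT_comp (measurable_poweR _) mG).
have mGy x : measurable_fun setT (fun y => (kernel p W x y `^ p')%:E).
  exact: (measurableT_comp mk (measurable_pair1 _)).
have h2 : (b `^ (p / p'))%:E * \int[mu]_(x in Q) poweR (G x) (p / p') <= (vol Q)%:E * c%:E.
  apply: le_trans h; rewrite (ge0_integralMl mu mQ mG').
  - apply: ge0_le_integral_any => [x _|x _|//|x _].
    + by apply: mule_ge0; [rewrite lee_fin powR_ge0|exact: poweR_ge0].
    + exact: poweR_ge0.
    rewrite -poweR_EFinM; [|exact: ltW|exact: G0]; apply: le_poweR; first exact: pp0.
      by apply: mule_ge0; [rewrite lee_fin ltW|exact: G0].
    rewrite /b invfM mulrC EFinM -muleA; apply: lee_wpmul2l.
      by rewrite lee_fin invr_ge0 ltW.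
    rewrite (ge0_integralMl mu mP (mGy x)).
    + apply: ge0_le_integral_any => [y _|y _|//|y _].
      * by rewrite -EFinM lee_fin mulr_ge0 ?invr_ge0 ?powR_ge0.
      * by rewrite lee_fin powR_ge0.
      rewrite -EFinM lee_fin ler_pdivrMl ?powR_gt0 //.
      rewrite -(powRM _ (ltW sd) (Ap_kernel_ge0 _ _ _ _)).
      apply: ge0_ler_powR; rewrite ?nnegrE ?kernel_ge0 ?(ltW p'0) //.
        by rewrite mulr_ge0 ?Ap_kernel_ge0 ?ltW.
      exact: kernel_le_Ap_kernel.
    + by move=> y; exact: (k0 (x, y)).
    + by rewrite invr_ge0 powR_ge0.
  - by move=> x; exact: poweR_ge0.
  - exact: powR_ge0.
have bE : (((Num.sqrt d%:R `^ p' * vol P) `^ (p / p')) = (b `^ (p / p'))^-1)%R.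
  have K0 : (0 < Num.sqrt d%:R `^ p' * vol P)%R by rewrite mulr_gt0 // powR_gt0.
  rewrite /b; move: (Num.sqrt d%:R `^ p' * vol P)%R K0 => K K0.
  apply: (@mulIf _ (K^-1 `^ (p / p'))); first by apply/lt0r_neq0/powR_gt0; rewrite invr_gt0.
  rewrite mulVf; last by apply/lt0r_neq0/powR_gt0; rewrite invr_gt0.
  by rewrite -powRM ?invr_ge0 ?(ltW K0) // mulfV ?gt_eqF // powR1.
by rewrite EFinM bE lee_pdivlMl ?powR_gt0 // -EFinM.
Qed.

Lemma Ap_mean_kernel_1 W Q P (c : R) : (0 < d)%N ->
  measurable_fun setT (fun z : lebRn R n * lebRn R n => kernel 1 W z.1 z.2) ->
  measurable Q -> (0 < vol Q)%R ->
  Ap_mean 1 W Q P <= c%:E ->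
  {ae mu, forall y, P y ->
    \int[mu]_(x in Q) (kernel 1 W x y)%:E <= (Num.sqrt d%:R * (vol Q * c))%:E}.
Proof.
move=> d0 mker mQ vQ; rewrite /Ap_mean lexx /ess_sup_on => /ess_supP.
have sd : (0 < Num.sqrt d%:R :> R)%R by rewrite sqrtr_gt0 ltr0n.
have mk : measurable_fun setT (fun z : lebRn R n * lebRn R n => (kernel 1 W z.1 z.2)%:E).
  exact/measurable_EFinP.
apply: filterS => y; rewrite /patch => + Py; rewrite mem_set // /avg.
rewrite lee_pdivrMl // => h.
rewrite EFinM -lee_pdivrMl // EFinM; apply: le_trans h.
rewrite (ge0_integralMl mu mQ (measurableT_comp mk (measurable_pair2 y))).
- apply: ge0_le_integral_any => [x _|x _|//|x _].
  + by rewrite -EFinM lee_fin mulr_ge0 ?kernel_ge0 // invr_ge0 ltW.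
  + by rewrite lee_fin powR_ge0.
  rewrite powRr1 ?Ap_kernel_ge0 // -EFinM lee_fin ler_pdivrMl //.
  exact: kernel_le_Ap_kernel.
- by move=> x; rewrite lee_fin kernel_ge0.
- by rewrite invr_ge0 ltW.
Qed.

End kernel.

(** * Averaging and doubling estimates *)

Section estimates.
Context {R : realType} {n d : nat}.
Local Notation C := R[i].
Local Notation mu := (lebesgueRn R n).
Variables (p : R) (W : lebRn R n -> 'M[C]_d) (dt : R).
Hypotheses (d0 : (0 < d)%N) (p1 : 1 <= p).
Hypothesis W0 : forall x, nonneg_definite (W x).
Hypothesis Wu : {ae mu, forall x, W x \in unitmx}.
Hypothesis mW : mxmfun W.
Hypothesis Wdim : Ap_dimension p W dt.

Let p0 : 0 < p. Proof. exact: lt_le_trans ltr01 p1. Qed.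

Let conjE : p / conj_exp p = p - 1.
Proof. by rewrite /conj_exp invf_div mulrCA divff ?mulr1 // gt_eqF. Qed.

Lemma vol_dyadic_gt0 j k : 0 < vol (dyadic_cube j k : set 'rV[R]_n).
Proof. by rewrite vol_dyadic exprn_gt0 // side_gt0. Qed.

Lemma vol_dyadic_child j m k k' :
  vol (dyadic_cube (j + m%:Z) k : set 'rV[R]_n) =
  vol (dyadic_cube j k' : set 'rV[R]_n) * 2 `^ (- (m%:R * n%:R)).
Proof.
rewrite !vol_dyadic [side j](sideD j m) exprMn powRN powRrM !powR_mulrn ?powR_ge0 //.
by rewrite mulrAC divff ?mul1r // gt_eqF // exprn_gt0 // exprn_gt0.
Qed.

Lemma vol_enclosing_cube j m k k' :
  vol (cube (center (j + m%:Z) k) (2 ^+ m.+1 * side (j + m%:Z)) : set 'rV[R]_n) =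
  2 ^+ n * vol (dyadic_cube j k' : set 'rV[R]_n).
Proof.
rewrite vol_cube; last by rewrite mulr_ge0 ?exprn_ge0 // ltW // side_gt0.
by rewrite exprS -mulrA -sideD exprMn vol_dyadic.
Qed.

Let mker : measurable_fun setT (fun z : lebRn R n * lebRn R n => kernel p W z.1 z.2).
Proof. by apply: measurable_kernel => //; rewrite gt_eqF. Qed.

Let mker1 x : measurable_fun setT (kernel p W x).
Proof. exact: (measurableT_comp mker (measurable_pair1 x)). Qed.

Local Open Scope ereal_scope.

(** A dyadic cube [Q] and its [m]-th ancestor [P] are compared through the
    [A_p]-dimension on [Q] and [2^(m+1) Q], which contains [P]. *)
Lemma kernel_bound : exists2 K : R, (0 < K)%R & forall j m k (phi : lebRn R n -> R),
  measurable_fun setT phi -> (forall y, 0 <= phi y)%R ->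
  \int[mu]_(x in dyadic_cube (j + m%:Z) k)
     poweR (\int[mu]_(y in dyadic_cube j (ancestor m k)) (kernel p W x y * phi y)%:E) p <=
  (K * vol (dyadic_cube j (ancestor m k)) `^ p * 2 `^ (m%:R * (dt - n%:R)))%:E *
  \int[mu]_(y in dyadic_cube j (ancestor m k)) (phi y `^ p)%:E.
Proof.
have [K0 K00 dimK] := Wdim.
have sd : (0 < Num.sqrt d%:R :> R)%R by rewrite sqrtr_gt0 ltr0n.
pose K := (Num.sqrt d%:R `^ p * (2 ^+ n) `^ (p - 1) * (K0 * 2 `^ dt))%R.
have K_gt0 : (0 < K)%R by rewrite !mulr_gt0 ?powR_gt0 ?exprn_gt0.
exists K => // j m k phi mphi phi0.
set Q := dyadic_cube (j + m%:Z) k; set P := dyadic_cube j (ancestor m k).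
set V := vol P; have V0 : (0 < V)%R by exact: vol_dyadic_gt0.
have mQ : measurable (Q : set (lebRn R n)) by exact: measurable_dyadic.
have mP : measurable (P : set (lebRn R n)) by exact: measurable_dyadic.
pose P' := cube (center (j + m%:Z) k : 'rV[R]_n) (2 ^+ m.+1 * side (j + m%:Z)).
have mP' : measurable (P' : set (lebRn R n)) by exact: measurable_cube.
have PP' : P `<=` P' by exact: dyadic_cube_ancestor_sub.
have dimQ : Ap_mean p W Q P' <= (K0 * 2 `^ (m.+1%:R * dt))%:E.
  rewrite /Q dyadic_cubeE; apply: dimK; exact: side_gt0.
have volQ : vol Q = (V * 2 `^ (- (m%:R * n%:R)))%R by exact: vol_dyadic_child.
have volQ0 : (0 < vol Q)%R by exact: vol_dyadic_gt0.
have volP' : vol P' = (2 ^+ n * V)%R by exact: vol_enclosing_cube.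
have mkp : measurable_fun setT (fun z : lebRn R n * lebRn R n => (kernel p W z.1 z.2 * phi z.2)%:E).
  apply/measurable_EFinP; apply: measurable_funM; first exact: mker.
  exact: (measurableT_comp mphi measurable_snd).
have kp0 z : 0 <= (kernel p W z.1 z.2 * phi z.2)%:E.
  by rewrite lee_fin mulr_ge0 // kernel_ge0.
have expE : (2 `^ (m.+1%:R * dt) * 2 `^ (- (m%:R * n%:R)) =
    2 `^ dt * 2 `^ (m%:R * (dt - n%:R)) :> R)%R.
  by rewrite -!powRD ?pnatr_eq0 ?implybT //; congr (_ `^ _)%R; rewrite -natr1; ring.
have [pE|pN1] := eqVneq p 1%R.
  rewrite pE in dimQ mkp kp0 *.
  have mk : measurable_fun setT (fun z : lebRn R n * lebRn R n => kernel 1 W z.1 z.2).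
    by have := mker; rewrite pE.
  have h := Ap_mean_kernel_1 d0 mk mQ volQ0 dimQ.
  have -> : \int[mu]_(x in Q) poweR (\int[mu]_(y in P) (kernel 1 W x y * phi y)%:E) 1 =
      \int[mu]_(x in Q) \int[mu]_(y in P) (kernel 1 W x y * phi y)%:E.
    by apply: eq_integral => x _; rewrite poweRe1 //; apply: integral_ge0 => y _; exact: (kp0 (x, y)).
  rewrite (tonelli_rect _ _ mkp kp0 mQ mP).
  rewrite (ge0_integralMl mu mP); last 3 first.
  - by apply/measurable_EFinP; apply: (measurableT_comp (measurable_powR _) mphi).
  - by move=> y; rewrite lee_fin powR_ge0.
  - by rewrite !mulr_ge0 ?powR_ge0 // ltW.
  apply: ae_ge0_le_integral_any; first exact: mP.
  - have mkp' : measurable_fun setT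
        (fun z : lebRn R n * lebRn R n => (kernel 1 W z.2 z.1 * phi z.1)%:E).
      apply/measurable_EFinP; apply: measurable_funM; last exact: (measurableT_comp mphi measurable_fst).
      exact: (measurableT_comp mk (@measurable_swap _ _ (lebRn R n) (lebRn R n))).
    apply: measurable_funTS.
    exact: (measurable_integral_snd mu mkp' (fun z => kp0 (z.2, z.1)) mQ).
  - apply: measurable_funTS; apply: emeasurable_funM; first exact: measurable_cst.
    by apply/measurable_EFinP; apply: (measurableT_comp (measurable_powR _) mphi).
  - by move=> y; apply: integral_ge0 => x _; exact: (kp0 (x, y)).
  - by move=> y; rewrite mule_ge0 // lee_fin ?powR_ge0 // !mulr_ge0 ?powR_ge0 // ltW.
  apply: filterS h => y hy Py.
  have mky : measurable_fun setT (fun x => (kernel 1 W x y)%:E).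
    by apply/measurable_EFinP; exact: (measurableT_comp mk (measurable_pair2 y)).
  have -> : \int[mu]_(x in Q) (kernel 1 W x y * phi y)%:E =
      (phi y)%:E * \int[mu]_(x in Q) (kernel 1 W x y)%:E.
    rewrite (ge0_integralMl mu mQ mky) //.
      by apply: eq_integral => x _; rewrite EFinM muleC.
    by move=> x; rewrite lee_fin kernel_ge0.
  apply: le_trans (lee_wpmul2l _ (hy (PP' _ Py))) _; first by rewrite lee_fin.
  rewrite -!EFinM lee_fin !powRr1 //; last exact: ltW.
  rewrite mulrC ler_wpM2r // volQ /K pE subrr powRr0 (powRr1 (ltW sd)) mulr1.
  rewrite le_eqVlt; apply/orP; left; apply/eqP.
  transitivity (Num.sqrt d%:R * V * K0 * (2 `^ (m.+1%:R * dt) * 2 `^ (- (m%:R * n%:R))))%R.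
    by ring.
  by rewrite expE; ring.
have p1' : (1 < p)%R by rewrite lt_neqAle eq_sym pN1.
set p' := conj_exp p.
have p'0 : (0 < p')%R by rewrite /p' /conj_exp divr_gt0 // subr_gt0.
have pp' : (p^-1 + p'^-1 = 1)%R.
  by rewrite /p' /conj_exp invf_div -[X in (X + _)%R]div1r -mulrDl addrC subrK divff // gt_eqF.
have volP'0 : (0 < vol P')%R by rewrite volP' mulr_gt0 // exprn_gt0.
have h := Ap_mean_kernel_gt1 d0 p1' mker mQ mP' volQ0 volP'0 dimQ.
pose Phi := \int[mu]_(y in P) (phi y `^ p)%:E.
have Phi0 : 0 <= Phi by apply: integral_ge0 => y _; rewrite lee_fin powR_ge0.
pose G x := poweR (\int[mu]_(y in P') (kernel p W x y `^ p')%:E) (p / p').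
have mkp'' : measurable_fun setT
    (fun z : lebRn R n * lebRn R n => (kernel p W z.1 z.2 `^ p')%:E).
  by apply/measurable_EFinP; apply: (measurableT_comp (measurable_powR p')).
have kp'0 z : 0 <= (kernel p W z.1 z.2 `^ p')%:E by rewrite lee_fin powR_ge0.
have mG : measurable_fun setT G.
  apply: (measurableT_comp (measurable_poweR _)).
  exact: (measurable_integral_snd mu mkp'' kp'0 mP').
have G0 x : 0 <= G x by exact: poweR_ge0.
apply: (@le_trans _ _ (\int[mu]_(x in Q) (Phi * G x))).
  apply: ge0_le_integral_any => [x _|x _|//|x _].
  - exact: poweR_ge0.
  - exact: mule_ge0.
  apply: (le_trans (hoelder_poweR mu mP (mker1 x) mphi (kernel_ge0 p W x) phi0 p0 p'0 pp')).
  rewrite muleC; apply: lee_wpmul2l => //; apply: le_poweR.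
  - by rewrite divr_ge0 // ltW.
  - by apply: integral_ge0 => y _; exact: (kp'0 (x, y)).
  apply: ge0_le_integral_any => [y _|y _|//|//].
  - exact: (kp'0 (x, y)).
  - exact: (kp'0 (x, y)).
rewrite (ge0_integralZl mu mQ (measurable_funTS mG) (fun x _ => G0 x) Phi0).
rewrite muleC; apply: lee_wpmul2r; first exact: Phi0.
apply: (le_trans h).
have v0 := ltW V0; rewrite lee_fin volP' volQ conjE -/p' !powRM ?mulr_ge0 ?powR_ge0 ?exprn_ge0 //.
rewrite -powRrM; have -> : (p' * (p - 1) = p)%R.
  by rewrite /p' /conj_exp divfK // gt_eqF // subr_gt0.
rewrite le_eqVlt; apply/orP; left; apply/eqP.
transitivity (Num.sqrt d%:R `^ p * (2 ^+ n) `^ (p - 1) * (V `^ (p - 1) * V) * K0 *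
  (2 `^ (m.+1%:R * dt) * 2 `^ (- (m%:R * n%:R))))%R; first by ring.
rewrite expE -[X in (V `^ (p - 1) * X)%R](powRr1 (ltW V0)) -powRD; last first.
  by rewrite (gt_eqF V0) implybT.
by rewrite subrK /K; ring.
Qed.

End estimates.

Section doubling.
Context {R : realType} {n d : nat}.
Local Notation C := R[i].
Local Notation mu := (lebesgueRn R n).
Variables (p : R) (W : lebRn R n -> 'M[C]_d) (dt dtt : R).
Hypotheses (d0 : (0 < d)%N) (p1 : 1 <= p).
Hypothesis W0 : forall x, nonneg_definite (W x).
Hypothesis Wu : {ae mu, forall x, W x \in unitmx}.
Hypothesis mW : mxmfun W.
Hypothesis Wdim : Ap_dimension p W dt.
Hypothesis Wdual : 1 < p ->
  Ap_dimension (conj_exp p) (fun x => mxpow (W x) (- (p - 1)^-1)) dtt.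
Local Open Scope sesquilinear_scope.

Let p0 : 0 < p. Proof. exact: lt_le_trans ltr01 p1. Qed.

(** A density comparable with the norm of [W], so that it measures cubes as the weight
    does; its values at two points are compared by [kernel_split]. *)
Definition wdens (x : lebRn R n) : R := fnorm (mpow (W x) p^-1) `^ p.

Lemma wdens_ge0 x : 0 <= wdens x. Proof. exact: powR_ge0. Qed.

Lemma mpow_trC (A : 'M[C]_d) a : (mpow A a) ^t* = mpow A a.
Proof. by rewrite -mpowE mxpow_trC. Qed.

Lemma mpow_mulN (A : 'M[C]_d) a : nonneg_definite A -> A \in unitmx ->
  mpow A a *m mpow A (- a) = 1%:M.
Proof. by rewrite -!mpowE; exact: mxpow_mulN. Qed.

Lemma mpow_mulNV (A : 'M[C]_d) a : nonneg_definite A -> A \in unitmx ->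
  mpow A (- a) *m mpow A a = 1%:M.
Proof. by rewrite -!mpowE; exact: mxpow_mulNV. Qed.

Lemma mxmfun_mpow a : a != 0 -> mxmfun (fun x => mpow (W x) a).
Proof. by move=> a0; under eq_fun do rewrite -mpowE; exact: mxmfun_mxpow. Qed.

Lemma measurable_wdens : measurable_fun setT wdens.
Proof.
apply: (measurableT_comp (measurable_powR p)); apply: measurable_fnorm.
by apply: mxmfun_mpow; rewrite invr_neq0 // gt_eqF.
Qed.

Definition doubling_exp : R := if p == 1 then n%:R else n%:R + dtt * p / conj_exp p.

(** The power [1/p'] of the dual weight is [W^(-1/p)], and adjoint matrices have the
    same Frobenius norm. *)
Lemma dual_kernel x y : 1 < p ->
  kernel (conj_exp p) (fun x => mxpow (W x) (- (p - 1)^-1)) x y = kernel p W y x.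
Proof.
move=> p1'; have q0 : p - 1 != 0 by rewrite gt_eqF // subr_gt0.
have e : (p - 1)^-1 * (conj_exp p)^-1 = p^-1.
  by rewrite /conj_exp invf_div mulrA mulVf // mul1r.
rewrite /kernel -!mpowE !mxpow_mxpow mulNr e mulNr mulrN opprK e !mpowE.
by rewrite -fnorm_trC trC_mul !mpow_trC.
Qed.

Lemma integral_cst_dyadic (I : \bar R) j k :
  (\int[mu]_(y in dyadic_cube j k) I = I * (vol (dyadic_cube j k))%:E)%E.
Proof.
apply: etrans (integral_cst mu (measurable_dyadic j k) I) _; congr (_ * _)%E.
by apply: etrans (lebesgue_dyadic j k) _; rewrite vol_dyadic.
Qed.

Lemma kernel_split x y : W y \in unitmx ->
  fnorm (mpow (W x) p^-1) <= kernel p W x y * fnorm (mpow (W y) p^-1).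
Proof.
move=> uy; rewrite -[X in fnorm X]mulmx1 -(mpow_mulNV p^-1 (W0 y) uy) mulmxA.
exact: fnormM.
Qed.

Local Open Scope ereal_scope.

Let mw : measurable_fun setT (fun x => (wdens x)%:E).
Proof. by apply/measurable_EFinP; exact: measurable_wdens. Qed.

Let mker : measurable_fun setT (fun z : lebRn R n * lebRn R n => kernel p W z.1 z.2).
Proof. by apply: measurable_kernel => //; rewrite gt_eqF. Qed.

Let w0 x : 0 <= (wdens x)%:E. Proof. by rewrite lee_fin wdens_ge0. Qed.

(** By [kernel_split] the density at [x] is at most the kernel times the density at
    [y]; for [p = 1] the integral of the kernel in [x] is bounded for almost every
    [y], and it remains to average over [y]. *)
Let doubling_1 : p = 1%R -> exists2 K : R, (0 < K)%R & forall j m k,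
  \int[mu]_(x in dyadic_cube j (ancestor m k)) (wdens x)%:E <=
  (K * 2 `^ (m%:R * n%:R))%:E * \int[mu]_(x in dyadic_cube (j + m%:Z) k) (wdens x)%:E.
Proof.
move=> pE; have [K0 K00 dimK] := Wdim.
have sd : (0 < Num.sqrt d%:R :> R)%R by rewrite sqrtr_gt0 ltr0n.
exists (Num.sqrt d%:R * K0)%R; first by rewrite mulr_gt0.
move=> j m k; set Q := dyadic_cube (j + m%:Z) k; set P := dyadic_cube j (ancestor m k).
have mQ : measurable (Q : set (lebRn R n)) by exact: measurable_dyadic.
have mP : measurable (P : set (lebRn R n)) by exact: measurable_dyadic.
have volP0 : (0 < vol P)%R by exact: vol_dyadic_gt0.
have volQ0 : (0 < vol Q)%R by exact: vol_dyadic_gt0.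
have dimP : Ap_mean p W P P <= K0%:E.
  have := dimK (center j (ancestor m k)) (side j) 0%N (side_gt0 j).
  by rewrite expr0 mul1r mul0r powRr0 mulr1 /P !dyadic_cubeE.
rewrite pE in dimP; have mk := mker; rewrite pE in mk.
have h := Ap_mean_kernel_1 d0 mk mP volP0 dimP.
have wE x : wdens x = fnorm (mpow (W x) p^-1) by rewrite /wdens pE powRr1 // fnorm_ge0.
set I := \int[mu]_(x in P) (wdens x)%:E.
have I0 : 0 <= I by apply: integral_ge0 => x _; exact: w0.
have hI : {ae mu, forall y, Q y -> I <= (Num.sqrt d%:R * (vol P * K0))%:E * (wdens y)%:E}.
  apply: filterS2 h Wu => y hy uy Qy.
  have mky : measurable_fun setT (fun x => (kernel 1 W x y)%:E).
    by apply/measurable_EFinP; exact: (measurableT_comp mk (measurable_pair2 y)).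
  apply: (@le_trans _ _ ((wdens y)%:E * \int[mu]_(x in P) (kernel 1 W x y)%:E)).
    rewrite (ge0_integralMl mu mP mky); last 2 first.
    - by move=> x; rewrite lee_fin kernel_ge0.
    - exact: wdens_ge0.
    apply: ge0_le_integral_any => [x _|x _|//|x _].
    - exact: w0.
    - by rewrite mule_ge0 // lee_fin kernel_ge0.
    by rewrite -EFinM lee_fin !wE mulrC; have := kernel_split x uy; rewrite pE.
  rewrite muleC; apply: lee_wpmul2r => //.
  exact: hy (dyadic_cube_ancestor Qy).
have : \int[mu]_(y in Q) I <=
    \int[mu]_(y in Q) ((Num.sqrt d%:R * (vol P * K0))%:E * (wdens y)%:E).
  apply: ae_ge0_le_integral_any; first exact: mQ.
  - exact: measurable_cst.
  - apply: measurable_funTS; apply: emeasurable_funM; first exact: measurable_cst.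
    exact: mw.
  - by move=> y; exact: I0.
  - by move=> y; rewrite mule_ge0 // lee_fin !mulr_ge0 // ltW.
  - exact: hI.
rewrite -(ge0_integralMl mu mQ mw w0); last by rewrite !mulr_ge0 // ltW.
rewrite (integral_cst_dyadic I (j + m%:Z) k).
rewrite muleC -lee_pdivlMl // muleA -EFinM => /le_trans; apply.
apply: lee_wpmul2r; first by apply: integral_ge0 => x _; exact: w0.
have vP : vol P = (vol Q * 2 `^ (m%:R * n%:R))%R.
  rewrite (vol_dyadic_child j m k (ancestor m k)) -/P -mulrA -powRD ?addNr ?powRr0 ?mulr1 //.
  by rewrite pnatr_eq0 implybT.
have q0 : vol Q != 0%R by rewrite gt_eqF.
rewrite lee_fin vP le_eqVlt; apply/orP; left; apply/eqP.
by move: (vol Q) q0 => q q0; field.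
Qed.

(** Let [I] be the integral of [w = wdens] over the ancestor, and [g] the inner
    integral of the kernel. Then [I <= g w] on [Q], so that [w >= I / l] or [g >= l].
    The second alternative is rare for the level [l] chosen below, by Markov's
    inequality. *)
Let doubling_gt1 : (1 < p)%R ->
  (forall j k, \int[mu]_(x in dyadic_cube j k) (wdens x)%:E < +oo) ->
  exists2 K : R, (0 < K)%R & forall j m k,
  \int[mu]_(x in dyadic_cube j (ancestor m k)) (wdens x)%:E <=
  (K * 2 `^ (m%:R * (n%:R + dtt * p / conj_exp p)))%:E *
    \int[mu]_(x in dyadic_cube (j + m%:Z) k) (wdens x)%:E.
Proof.
move=> p1' wfin; have [K0 K00 dimK] := Wdual p1'.
have sd : (0 < Num.sqrt d%:R :> R)%R by rewrite sqrtr_gt0 ltr0n.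
set p' := conj_exp p in dimK *; set W' := (fun x => mxpow _ _) in dimK.
have p'1 : (1 < p')%R by rewrite /p' /conj_exp ltr_pdivlMr ?subr_gt0 //; lra.
have p'p : conj_exp p' = p.
  have : (p - 1 != 0)%R by rewrite gt_eqF // subr_gt0.
  move=> q0; rewrite /conj_exp /p' /conj_exp; field.
  by rewrite q0 /=; lra.
have p'0 : (0 < p')%R by lra.
pose s := (p' / p)%R; have s0 : (0 < s)%R by rewrite divr_gt0.
pose c := (Num.sqrt d%:R `^ p * 2 ^+ n)%R.
have c0 : (0 < c)%R by rewrite mulr_gt0 ?powR_gt0 ?exprn_gt0.
pose e := (2 * (K0 * 2 `^ dtt))%R; have e0 : (0 < e)%R by rewrite !mulr_gt0 ?powR_gt0.
exists (2 * (c * e `^ s^-1))%R; first by rewrite !mulr_gt0 ?powR_gt0.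
move=> j m k; set Q := dyadic_cube (j + m%:Z) k; set P := dyadic_cube j (ancestor m k).
set V := vol P; have V0 : (0 < V)%R by exact: vol_dyadic_gt0.
have mQ : measurable (Q : set (lebRn R n)) by exact: measurable_dyadic.
have mP : measurable (P : set (lebRn R n)) by exact: measurable_dyadic.
have volQ0 : (0 < vol Q)%R by exact: vol_dyadic_gt0.
pose P' := cube (center (j + m%:Z) k : 'rV[R]_n) (2 ^+ m.+1 * side (j + m%:Z)).
have mP' : measurable (P' : set (lebRn R n)) by exact: measurable_cube.
have PP' : P `<=` P' by exact: dyadic_cube_ancestor_sub.
have dimQ : Ap_mean p' W' Q P' <= (K0 * 2 `^ (m.+1%:R * dtt))%:E.
  rewrite /Q dyadic_cubeE; apply: dimK; exact: side_gt0.
have volP' : vol P' = (2 ^+ n * V)%R by exact: vol_enclosing_cube.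
have volP'0 : (0 < vol P')%R by rewrite volP' mulr_gt0 // exprn_gt0.
have kE x y : kernel p' W' x y = kernel p W y x by exact: dual_kernel.
have mk : measurable_fun setT (fun z : lebRn R n * lebRn R n => kernel p W z.2 z.1).
  exact: (measurableT_comp mker (@measurable_swap _ _ (lebRn R n) (lebRn R n))).
have mk' : measurable_fun setT (fun z : lebRn R n * lebRn R n => kernel p' W' z.1 z.2).
  by under eq_fun do rewrite kE.
have := Ap_mean_kernel_gt1 d0 p'1 mk' mQ mP' volQ0 volP'0 dimQ.
rewrite p'p -/s; under eq_integral do under eq_integral do rewrite kE.
pose g x := \int[mu]_(y in P') (kernel p W y x `^ p)%:E; move=> hg.
have h : \int[mu]_(x in Q) poweR (g x) s <= _ := hg.
clear hg.
have mkp : measurable_fun setT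
    (fun z : lebRn R n * lebRn R n => (kernel p W z.2 z.1 `^ p)%:E).
  by apply/measurable_EFinP; exact: (measurableT_comp (measurable_powR p) mk).
have kp0 (z : lebRn R n * lebRn R n) : 0 <= (kernel p W z.2 z.1 `^ p)%:E.
  by rewrite lee_fin powR_ge0.
have mg : measurable_fun setT g by exact: (measurable_integral_snd mu mkp kp0 mP').
have g0 x : 0 <= g x by apply: integral_ge0 => y _; exact: (kp0 (x, y)).
set I := \int[mu]_(x in P) (wdens x)%:E.
have I0 : 0 <= I by apply: integral_ge0 => x _; exact: w0.
have Ifin : I \is a fin_num by rewrite ge0_fin_numE // wfin.
have Ig : {ae mu, forall x, Q x -> I <= g x * (wdens x)%:E}.
  apply: filterS Wu => x ux Qx.
  have mkx : measurable_fun setT (fun y => (kernel p W y x `^ p)%:E).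
    exact: (measurableT_comp mkp (measurable_pair1 x)).
  rewrite muleC (ge0_integralMl mu mP' mkx (fun y => kp0 (x, y)) (wdens_ge0 x)).
  apply: ge0_le_integral_any => [y _|y _|//|y _].
  - exact: w0.
  - by rewrite mule_ge0 ?w0 // (kp0 (x, y)).
  rewrite -EFinM lee_fin /wdens -powRM ?fnorm_ge0 ?kernel_ge0 //.
  apply: ge0_ler_powR; rewrite ?nnegrE ?fnorm_ge0 ?(ltW p0) //.
    by rewrite mulr_ge0 ?fnorm_ge0 // kernel_ge0.
  by rewrite mulrC; exact: kernel_split.
clearbody g I.
pose J := \int[mu]_(x in Q) (wdens x)%:E.
have J0 : 0 <= J by apply: integral_ge0 => x _; exact: w0.
have Jfin : J \is a fin_num by rewrite ge0_fin_numE // wfin.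
have JE : J = \int[mu]_(x in Q) (wdens x)%:E by [].
rewrite -JE; clearbody J.
pose l := (c * V * (e * 2 `^ (m%:R * dtt)) `^ s^-1)%R.
have l0 : (0 < l)%R by rewrite !mulr_gt0 ?powR_gt0 // mulr_gt0 ?powR_gt0.
have lg : {ae mu, forall x, Q x -> I <= l%:E * (wdens x)%:E + I * poweR (l^-1%:E * g x) s}.
  apply: (ae_imp Ig) => x Ixg Qx; have hx := Ixg Qx.
  have /orP[gl|gl] := le_total (g x) l%:E.
    apply: (le_trans hx); apply: (le_trans (lee_wpmul2r (w0 x) gl)).
    by rewrite leeDl // mule_ge0 // poweR_ge0.
  have h1 : 1 <= poweR (l^-1%:E * g x) s.
    rewrite -(poweR1r s); apply: le_poweR; [exact: ltW|exact: lee01|idtac].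
    apply: le_trans (lee_wpmul2l _ gl); last by rewrite lee_fin invr_ge0 ltW.
    by rewrite -EFinM mulVf // gt_eqF.
  apply: (@le_trans _ _ (I * poweR (l^-1%:E * g x) s)).
    by rewrite -[X in X <= _]mule1; exact: lee_wpmul2l.
  by rewrite leeDr // mule_ge0 ?w0 // lee_fin ltW.
have mgs : measurable_fun setT (fun x => poweR (g x) s).
  exact: (measurableT_comp (measurable_poweR _) mg).
have gsE x : I * poweR (l^-1%:E * g x) s = (fine I * (l^-1) `^ s)%:E * poweR (g x) s.
  rewrite poweR_EFinM ?invr_ge0 ?(ltW l0) // muleA; congr (_ * _).
  by rewrite EFinM fineK.
have a0 : (0 <= fine I * (l^-1) `^ s)%R by rewrite mulr_ge0 ?powR_ge0 // fine_ge0.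
have m1 : measurable_fun setT (fun x => l%:E * (wdens x)%:E).
  by apply: emeasurable_funM; [exact: measurable_cst|exact: mw].
have m2 : measurable_fun setT (fun x => (fine I * (l^-1) `^ s)%:E * poweR (g x) s).
  by apply: emeasurable_funM; [exact: measurable_cst|exact: mgs].
have m10 x : 0 <= l%:E * (wdens x)%:E by rewrite mule_ge0 ?w0 // lee_fin ltW.
have m20 x : 0 <= (fine I * (l^-1) `^ s)%:E * poweR (g x) s.
  by rewrite mule_ge0 ?poweR_ge0 // lee_fin.
have hint : I * (vol Q)%:E <=
    l%:E * J + (fine I * (l^-1) `^ s)%:E * \int[mu]_(x in Q) poweR (g x) s.
  rewrite JE (ge0_integralMl mu mQ mw w0 (ltW l0)).
  rewrite (ge0_integralMl mu mQ mgs (fun x => poweR_ge0 _ _) a0).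
  rewrite -(ge0_integralD mu mQ (fun x _ => m10 x) (measurable_funTS m1)
    (fun x _ => m20 x) (measurable_funTS m2)).
  rewrite -(integral_cst_dyadic I (j + m%:Z) k) -/Q.
  apply: ae_ge0_le_integral_any; first exact: mQ.
  - exact: measurable_cst.
  - by apply: measurable_funTS; exact: emeasurable_funD.
  - by move=> x; exact: I0.
  - by move=> x; exact: adde_ge0.
  - by apply: (ae_imp lg) => x hx Qx; rewrite -gsE; exact: hx.
have := le_trans hint (leeD2l _ (lee_wpmul2l _ h)).
rewrite lee_fin => /(_ a0).
have lsE : (l `^ s = (c * V) `^ s * (e * 2 `^ (m%:R * dtt)))%R.
  rewrite /l powRM ?powR_ge0 //; last by rewrite mulr_ge0 // ltW.
  by rewrite -[X in (_ * X)%R]powRrM mulVf ?gt_eqF // powRr1 // mulr_ge0 ?powR_ge0 // ltW.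
have DE : ((Num.sqrt d%:R `^ p * vol P') `^ s * (vol Q * (K0 * 2 `^ (m.+1%:R * dtt))) =
    l `^ s * (vol Q / 2))%R.
  have -> : (m.+1%:R * dtt = dtt + m%:R * dtt)%R by rewrite -natr1; ring.
  rewrite powRD ?pnatr_eq0 ?implybT // lsE volP' /e.
  have -> : (Num.sqrt d%:R `^ p * (2 ^+ n * V) = c * V)%R by rewrite /c mulrA.
  by field.
rewrite DE -(fineK Ifin) -(fineK Jfin) -!EFinM -EFinD lee_fin => hh.
have ll : (l^-1 `^ s * l `^ s = 1)%R.
  by rewrite -powRM ?invr_ge0 ?(ltW l0) // mulVf ?gt_eqF // powR1.
have {hh} : (fine I * (vol Q / 2) <= l * fine J)%R.
  have : (fine I * l^-1 `^ s * (l `^ s * (vol Q / 2)) = fine I * (vol Q / 2))%R.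
    by rewrite -mulrA [X in (_ * X)%R]mulrA ll mul1r.
  by move=> e1; move: hh; rewrite e1; clear; lra.
rewrite lee_fin => hh.
have q0 : vol Q != 0%R by rewrite gt_eqF.
have -> : (2 * (c * e `^ s^-1) * 2 `^ (m%:R * (n%:R + dtt * p / p')) = l * 2 / vol Q)%R.
  rewrite (vol_dyadic_child j m k (ancestor m k)) -/P -/V powRN.
  have -> : (m%:R * (n%:R + dtt * p / p') = m%:R * n%:R + m%:R * dtt * s^-1)%R.
    have -> : (s^-1 = p / p')%R by rewrite /s invf_div.
    by clearbody p'; ring.
  rewrite powRD ?pnatr_eq0 ?implybT // /l powRM ?powR_ge0 ?(ltW e0) //.
  rewrite -[X in (_ = c * V * (_ * X) * _ / _)%R]powRrM.
  have a0' : (2 `^ (m%:R * n%:R) != 0 :> R)%R by rewrite gt_eqF // powR_gt0.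
  have V0' : (V != 0)%R by rewrite gt_eqF.
  move: (2 `^ (m%:R * n%:R))%R a0' (2 `^ (m%:R * dtt * s^-1))%R (e `^ s^-1)%R.
  move: V0'; clearbody c V => V0' a a0' b f; field.
  by rewrite V0' a0'.
rewrite -mulrA -(ler_pM2r (x := vol Q / 2)) ?divr_gt0 //.
apply: (le_trans hh); rewrite le_eqVlt; apply/orP; left; apply/eqP.
by field.
Qed.

(** For [p > 1] the dual weight exchanges the variables of the kernel, so that its
    dimension governs the growth of the weights of the ancestors. *)
Lemma weight_doubling :
  (forall j k, \int[mu]_(x in dyadic_cube j k) (wdens x)%:E < +oo) ->
  exists2 K : R, (0 < K)%R & forall j m k,
  \int[mu]_(x in dyadic_cube j (ancestor m k)) (wdens x)%:E <=
  (K * 2 `^ (m%:R * doubling_exp))%:E *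
    \int[mu]_(x in dyadic_cube (j + m%:Z) k) (wdens x)%:E.
Proof.
move=> wfin; rewrite /doubling_exp; case: ifPn => [/eqP/doubling_1 //|pN1].
by apply: doubling_gt1 => //; rewrite lt_neqAle eq_sym pN1.
Qed.

End doubling.

(** * Sums of nonnegative families *)

Section esum_tools.
Context {R : realType}.
Local Open Scope ereal_scope.

Section choice_index.
Context {T : choiceType}.
Implicit Types (S : set T) (a b : T -> \bar R).

Lemma esum_subset S S' a : (forall i, 0 <= a i) -> S `<=` S' ->
  \esum_(i in S) a i <= \esum_(i in S') a i.
Proof.
move=> a0 SS'; rewrite (esumID S S') //.
rewrite (_ : S' `&` S = S); last by apply/seteqP; split=> [x []//|x Sx]; split => //; exact: SS'.
by rewrite leeDl // esum_ge0.
Qed.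

Lemma esumZl_le S a (c : R) : (0 <= c)%R -> (forall i, 0 <= a i) ->
  \esum_(i in S) (c%:E * a i) <= c%:E * \esum_(i in S) a i.
Proof.
move=> c0 a0; apply: ge_ereal_sup => _ [X [finX XS] <-].
rewrite -ge0_mule_fsumr //; apply: lee_wpmul2l; first by rewrite lee_fin.
by apply: ereal_sup_ubound; exists X.
Qed.

Lemma esum_tail a (eps : R) : (forall i, 0 <= a i) -> \esum_(i in setT) a i < +oo ->
  (0 < eps)%R -> exists2 X : set T, finite_set X & \esum_(i in ~` X) a i <= eps%:E.
Proof.
move=> a0 fin eps0; set s := \esum_(i in setT) a i in fin *.
have s0 : 0 <= s by exact: esum_ge0.
have sfin : s \is a fin_num by rewrite ge0_fin_numE.
have [_ [X [finX _] <-] hX] := ub_ereal_sup_adherent eps0 sfin.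
exists X => //; have sE : s = \esum_(i in X) a i + \esum_(i in ~` X) a i.
  by rewrite /s (esumID X) // !setTI.
move: hX; rewrite -/(esum setT a) -/s -(esum_fset finX (fun i _ => a0 i)) => hX.
have x0 : 0 <= \esum_(i in X) a i by exact: esum_ge0.
have y0 : 0 <= \esum_(i in ~` X) a i by exact: esum_ge0.
move: x0 y0 sE hX sfin; case: (esum X a) => [x| |]; case: (esum (~` X) a) => [y| |] // x0 y0 -> //=.
by move=> + _; rewrite -!EFinD lte_fin lee_fin; lra.
Qed.

End choice_index.

Lemma esum_fin_const (T : finType) (c : \bar R) : 0 <= c ->
  \esum_(i in [set: T]) c = (#|T|%:R)%:E * c.
Proof.
move=> c0; rewrite esum_fset //; last exact: finite_finset.
have -> : [set: T] = [set` enum T].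
  by apply/seteqP; split=> // x _ /=; rewrite mem_enum.
rewrite -fsbig_seq ?enum_uniq // big_const_seq count_predT -cardE.
elim: #|T| => [|m IH]; first by rewrite mul0e.
by rewrite iterS IH -natr1 EFinD ge0_muleDl ?lee_fin // mul1e addeC.
Qed.

(** A cube is the [m]-th ancestor of [2^(m n)] cubes. *)
Lemma esum_ancestor n m (F : 'rV[int]_n -> \bar R) : (forall k, 0 <= F k) ->
  \esum_(k in [set: 'rV[int]_n]) F (ancestor m k) =
  (((2 ^ m) ^ n)%N%:R)%:E * \esum_(k in [set: 'rV[int]_n]) F k.
Proof.
move=> F0; rewrite (reindex_esum _ _ _ _ (@child_bij n m)).
transitivity (\esum_(k in [set: 'rV[int]_n]) \esum_(e in [set: 'rV['I_(2 ^ m)]_n]) F k).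
  rewrite esum_esum // (_ : _ `*`` _ = [set: 'rV[int]_n * 'rV['I_(2 ^ m)]_n]).
    by apply: eq_esum => -[k e] _ /=; rewrite ancestor_child.
  by apply/seteqP; split => // -[].
have N0 : (0 < ((2 ^ m) ^ n)%N)%N by rewrite !expn_gt0.
apply/eqP; rewrite eq_le; apply/andP; split.
  apply: le_trans (esumZl_le _ _ _); [|by []|by []].
  by apply: le_esum => k _; rewrite esum_fin_const // card_mx card_ord mul1n.
rewrite -lee_pdivlMl ?ltr0n //; apply: le_trans (esumZl_le _ _ _).
- apply: le_esum => k _; rewrite esum_fin_const // card_mx card_ord mul1n muleA -EFinM.
  by rewrite mulVf ?mul1e // pnatr_eq0 -lt0n.
- by rewrite invr_ge0.
- by move=> k; exact: esum_ge0.
Qed.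

(** A translation moves the center to the origin, which makes the bound uniform in
    [J]. *)
Lemma esum_geometric (th : R) : (0 <= th < 1)%R -> exists2 G : R, (0 < G)%R &
  forall J : int, \esum_(j in [set: int]) (th ^+ absz (j - J)%R)%:E <= G%:E.
Proof.
move=> /andP[th0 th1]; pose G0 : R := ((1 - th)^-1)%R.
have G00 : (0 < G0)%R by rewrite invr_gt0 subr_gt0.
have p0 m : 0 <= (th ^+ m)%:E by rewrite lee_fin exprn_ge0.
have nat_sum : \esum_(m in [set: nat]) (th ^+ m)%:E <= G0%:E.
  rewrite -nneseries_esumT //; apply: lime_le; first exact: is_cvg_nneseries.
  apply: nearW => m; rewrite sumEFin lee_fin.
  have -> : (\sum_(0 <= i < m) th ^+ i = series (geometric 1 th) m)%R.
    by rewrite /series /geometric /=; apply: eq_bigr => i _; rewrite mul1r.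
  rewrite geometric_seriesE ?lt_eqF //= mul1r /G0 ler_pdivrMr ?subr_gt0 //.
  by rewrite mulVf ?gt_eqF ?subr_gt0 // lerBlDr lerDl exprn_ge0.
exists (G0 + G0)%R; first by rewrite addr_gt0.
move=> J.
have bJ : set_bij [set: int] [set: int] (fun j => j + J)%R.
  split=> // [i j _ _ /addIr //|j _]; exists (j - J)%R => //=.
  by rewrite subrK.
rewrite (reindex_esum _ _ _ _ bJ).
have -> : \esum_(i in [set: int]) (th ^+ absz (i + J - J)%R)%:E =
    \esum_(i in [set: int]) (th ^+ absz i)%:E.
  by apply: eq_esum => i _; rewrite addrK.
rewrite (esumID [set i : int | 0 <= i]%R) // !setTI EFinD; apply: leeD.
  have b1 : set_bij [set: nat] [set i : int | 0 <= i]%R Posz.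
    by split; [move=> i|move=> i j _ _ []|move=> [j|j] //= _; exists j].
  rewrite (reindex_esum _ _ _ _ b1); exact: nat_sum.
have b2 : set_bij [set: nat] (~` [set i : int | 0 <= i]%R) Negz.
  by split; [move=> i|move=> i j _ _ []|move=> [j|j] //= _; exists j].
rewrite (reindex_esum _ _ _ _ b2); apply: le_trans nat_sum; apply: le_esum => i _.
rewrite lee_fin NegzE abszN absz_nat exprS ler_piMl ?exprn_ge0 //; exact: ltW.
Qed.

End esum_tools.

(** * Dyadic cubes generate the measurable sets *)

Section dyadic_generation.
Context {R : realType} {n : nat}.
Local Notation mu := (lebesgueRn R n).

Definition dyadic_sets : set (set 'rV[R]_n) :=
  [set A | A = set0 \/ exists j k, A = dyadic_cube j k].

Lemma side_nat_lt (e : R) : 0 < e -> exists m : nat, side (R := R) m%:Z < e.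
Proof.
move=> e0; pose m := (Num.trunc e^-1).+1; exists m.
have h : e^-1 < m%:R by exact: truncnS_gt.
rewrite /side -exprz_inv -exprnP exprVn invf_plt ?posrE ?exprn_gt0 //.
by rewrite (lt_trans h) // -natrX ltr_nat ltn_expl.
Qed.

(** An open half-space is the union of the dyadic cubes that it contains. *)
Lemma borel_dyadic (A : set (borelRn R n)) : measurable A -> <<s dyadic_sets >> A.
Proof.
pose T := g_sigma_algebraType dyadic_sets.
suff mid : measurable_fun [set: T] (id : T -> borelRn R n).
  by move=> mA; have := mid measurableT A mA; rewrite setTI preimage_id.
apply: measurable_fun_borelRn => i.
apply: (measurability _ (RGenInftyO.measurableE R)) => _ [_ [x ->] <-]; rewrite setTI.
pose F (jk : int * 'rV[int]_n) : set T :=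
  if `[< dyadic_cube jk.1 jk.2 `<=` [set y : 'rV[R]_n | y ord0 i < x] >]
  then dyadic_cube jk.1 jk.2 else set0.
have -> : (@borelRn_coord R n i \o id) @^-1` `]-oo, x[%classic = \bigcup_jk F jk.
  apply/seteqP; split => y /=; rewrite in_itv /= /borelRn_coord.
    move=> yx; have [m hm] := @side_nat_lt (x - (y : 'rV[R]_n) ord0 i) (ltac:(by rewrite subr_gt0)).
    exists (m%:Z, cube_index m%:Z y) => //; rewrite /F /=.
    rewrite asboolT; first exact: cube_indexP.
    move=> z zQ /=; have := zQ i; have := cube_indexP m%:Z y i.
    rewrite -/(side m%:Z); move: (side _) hm ((cube_index _ y) ord0 i)%:~R => s hm q.
    by move=> /andP[h1 h2] /andP[h3 h4]; lra.
  by move=> [jk _]; rewrite /F; case: asboolP => // h /h.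
apply: countable_bigcupT_measurable; first exact: countableP.
move=> [j k]; rewrite /F; case: ifP => _; last exact: measurable0.
by apply: sub_sigma_algebra; right; exists j, k.
Qed.

(** The outer measure is an infimum over countable covers by Borel sets. *)
Lemma lebesgue_borel_cover (E : set (lebRn R n)) : measurable E -> (mu E < +oo)%E ->
  exists2 B : set (borelRn R n), measurable B &
    E `<=` B /\ (mu ((B : set (lebRn R n)) `\` E) = 0)%E.
Proof.
move=> mE Efin; have E0 : (0 <= mu E)%E by exact: measure_ge0.
have Enum : mu E \is a fin_num by rewrite ge0_fin_numE.
have cov (m : nat) : exists F : (set (borelRn R n))^nat, [/\ forall k, measurable (F k),
    E `<=` \bigcup_k F k & (mu (\bigcup_k F k) <= mu E + (m.+1%:R^-1)%:E)%E].
  have e0 : 0 < m.+1%:R^-1 :> R by rewrite invr_gt0.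
  have [_ [F [mF EF] <-] hF] := lb_ereal_inf_adherent e0 Enum.
  exists F; split => //; apply: le_trans (ltW hF).
  by apply: ereal_inf_lbound; exists F => //; split.
have [F hF] := choice cov.
pose B : set (borelRn R n) := \bigcap_m \bigcup_k F m k.
have mB : measurable B.
  apply: bigcap_measurable; first by exists 0%N.
  by move=> m _; apply: bigcup_measurable => k _; have [] := hF m.
have EB : E `<=` B by move=> x Ex m _; have [_ h _] := hF m; exact: h.
have mB' : measurable (B : set (lebRn R n)) by exact: borel_lebesgue.
have muB : (mu B <= mu E)%E.
  apply/lee_addgt0Pr => e e0.
  have [m hm] : exists m : nat, m.+1%:R^-1 < e.
    exists (Num.trunc e^-1); rewrite invf_plt ?posrE // truncnS_gt //.
  have [mF _ h] := hF m.
  apply: (@le_trans _ _ (mu (\bigcup_k F m k))).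
    apply: le_measure; rewrite ?inE //; last by move=> x; exact.
    by apply: borel_lebesgue; apply: bigcup_measurable => k _; exact: mF.
  by apply: (le_trans h); rewrite leeD2l // lee_fin ltW.
exists B => //; split => //.
apply/eqP; rewrite eq_le measure_ge0 andbT.
apply: (@le_trans _ _ (mu B - mu (B `&` E))%E).
  by rewrite (measureD mB' mE) //; exact: le_lt_trans muB Efin.
rewrite (_ : B `&` E = E); last by apply/setIidPr.
by rewrite leeBlDr // add0e.
Qed.

End dyadic_generation.

(** * Dyadic averages *)

(** What the estimates use of a weight of class [A_p]. *)
Record admissible {R : realType} {n d : nat} (p dt : R) (W : 'rV[R]_n -> 'M[R[i]]_d) : Prop := {
  adm_d : (0 < d)%N;
  adm_p : 1 <= p;
  adm_nonneg : forall x, nonneg_definite (W x);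
  adm_unit : {ae (lebesgueRn R n : {measure set (lebRn R n) -> \bar R}),
                forall x, W x \in unitmx};
  adm_meas : mxmfun (W : lebRn R n -> 'M[R[i]]_d);
  adm_dim : Ap_dimension p W dt }.

Section averages.
Context {R : realType} {n d : nat}.
Local Notation C := R[i].
Local Notation mu := (lebesgueRn R n).
Variables (p dt : R) (W : lebRn R n -> 'M[C]_d).
Hypothesis H : admissible p dt W.
Local Open Scope complex_scope.
Implicit Types (f g : lebRn R n -> 'cV[C]_d) (D : set (lebRn R n)).

Lemma adm_p0 : 0 < p. Proof. exact: lt_le_trans ltr01 (adm_p H). Qed.
Let p0 := adm_p0.

Let Wi_meas : mxmfun (fun x => mpow (W x) p^-1).
Proof.
by apply: (mxmfun_mpow (adm_nonneg H) (adm_meas H)); rewrite invr_neq0 // gt_eqF // adm_p0.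
Qed.

Lemma measurable_kernelW :
  measurable_fun setT (fun z : lebRn R n * lebRn R n => kernel p W z.1 z.2).
Proof.
by apply: measurable_kernel; [rewrite gt_eqF // adm_p0|exact: adm_meas H|exact: adm_nonneg H].
Qed.

Definition wnorm f x : R := fnorm (mpow (W x) p^-1 *m f x).

Definition mass (D : set (lebRn R n)) f : \bar R := (\int[mu]_(x in D) (wnorm f x `^ p)%:E)%E.

Lemma Lp_massE D f : Lp_mass p W D f = mass D f.
Proof. by rewrite /Lp_mass; apply: eq_integral => x _; rewrite vnormE mpowE. Qed.

Lemma mass_ge0 D f : (0 <= mass D f)%E.
Proof. by apply: integral_ge0 => x _; rewrite lee_fin powR_ge0. Qed.

Lemma wnorm_ge0 f x : 0 <= wnorm f x. Proof. exact: fnorm_ge0. Qed.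

Lemma measurable_wnorm f : mxmfun f -> measurable_fun setT (wnorm f).
Proof. by move=> mf; apply: measurable_fnorm; exact: (mxmfunM Wi_meas mf). Qed.

Lemma measurable_wnormp f : mxmfun f -> measurable_fun setT (fun x => (wnorm f x `^ p)%:E).
Proof.
move=> mf; apply/measurable_EFinP; apply: (measurableT_comp (measurable_powR p)).
exact: measurable_wnorm.
Qed.

Lemma ae_exists (A : lebRn R n -> Prop) j k : {ae mu, forall x, A x} ->
  exists2 x, dyadic_cube j k x & A x.
Proof.
move=> hA; apply: contrapT => h.
have : (mu : {measure set (lebRn R n) -> \bar R}).-negligible (dyadic_cube j k).
  apply: negligibleS hA => x Qx /= Ax; apply: h; by exists x.
move/(measure_negligible (measurable_dyadic j k)).
move/(etrans (esym (lebesgue_dyadic j k))) => [] /eqP.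
by rewrite gt_eqF // exprn_gt0 // side_gt0.
Qed.

Lemma dyadic_average_index a f (x : 'rV[R]_n) :
  dyadic_average a f x = ((vol (dyadic_cube (- a) (cube_index (- a) x) : set 'rV[R]_n))^-1)%:C *:
    vintegral (dyadic_cube (- a) (cube_index (- a) x)) f.
Proof.
rewrite /dyadic_average -(@fsbig_widen _ _ _ _ [set cube_index (- a) x] setT) //.
  rewrite fsbig_set1 indicE mem_set ?mul1r //; exact: cube_indexP.
move=> k [_ kx] /=; rewrite indicE memNset ?mul0r ?scale0r //.
by move=> /dyadic_cubeP; exact: kx.
Qed.

Definition avgv j k f : 'cV[C]_d :=
  ((vol (dyadic_cube j k : set 'rV[R]_n))^-1)%:C *: vintegral (dyadic_cube j k) f.

Definition avg_fun j f : lebRn R n -> 'cV[C]_d := fun x => avgv j (cube_index j x) f.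

Lemma dyadic_averageE a f : dyadic_average a f = avg_fun (- a) f.
Proof. by apply/funext => x; rewrite dyadic_average_index. Qed.

Lemma avg_funE j k f x : dyadic_cube j k x -> avg_fun j f x = avgv j k f.
Proof. by move=> /dyadic_cubeP ->. Qed.

Lemma mxmfun_avg j f : mxmfun (avg_fun j f).
Proof.
have h (F : 'rV[int]_n -> R) :
    measurable_fun [set: lebRn R n] (fun x => F (cube_index j (x : 'rV[R]_n))).
  move=> _ Y mY; rewrite setTI.
  have -> : (fun x : lebRn R n => F (cube_index j (x : 'rV[R]_n))) @^-1` Y =
      \bigcup_k (if `[< Y (F k) >] then dyadic_cube j k else set0).
    apply/seteqP; split=> x /=.
      by move=> Yx; exists (cube_index j x) => //; rewrite asboolT //; exact: cube_indexP.
    by move=> [k _]; case: asboolP => // Yk /dyadic_cubeP <-.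
  apply: countable_bigcupT_measurable; first exact: countableP.
  by move=> k; case: ifP => _; [exact: measurable_dyadic|exact: measurable0].
by move=> i l; split; exact: (h (fun k => _ (avgv j k f i l))).
Qed.

Definition vintegrable (D : set (lebRn R n)) f := forall i,
  mu.-integrable D (EFin \o (fun x => complex.Re (f x i ord0))) /\
  mu.-integrable D (EFin \o (fun x => complex.Im (f x i ord0))).

Lemma vintegrable_le D f (h : lebRn R n -> R) : measurable D -> mxmfun f ->
  {ae mu, forall x, D x -> fnorm (f x) <= h x} -> measurable_fun setT h ->
  (forall x, 0 <= h x) -> (\int[mu]_(x in D) (h x)%:E < +oo)%E -> vintegrable D f.
Proof.
move=> mD mf fh mh h0 hfin i.
have main (u : lebRn R n -> R) : measurable_fun setT u ->
    (forall x, `|u x| <= fnorm (f x)) -> mu.-integrable D (EFin \o u).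
  move=> mu' uf; apply/integrableP; split.
    by apply/measurable_EFinP; exact: measurable_funTS.
  apply: le_lt_trans hfin; apply: ae_ge0_le_integral_any; first exact: mD.
  - apply/measurable_EFinP; apply: measurable_funTS; exact: (measurableT_comp (@normr_measurable _ _)).
  - by apply: measurable_funTS; apply/measurable_EFinP.
  - by move=> x; exact: abse_ge0.
  - by move=> x; rewrite lee_fin.
  apply: filterS fh => x fx Dx /=; rewrite lee_fin; exact: le_trans (uf x) (fx Dx).
have [m1 m2] := mf i ord0; split; apply: main => // x.
  exact: normRe_le_fnorm.
exact: normIm_le_fnorm.
Qed.

Let linI (a b : R) D (u v : lebRn R n -> R) : measurable D ->
  mu.-integrable D (EFin \o u) -> mu.-integrable D (EFin \o v) ->
  mu.-integrable D (EFin \o (fun x => a * u x + b * v x)).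
Proof.
move=> mD Iu Iv.
have := integrableD mD (integrableZl mD a Iu) (integrableZl mD b Iv).
by apply: eq_integrable => // x _; rewrite /= EFinD !EFinM.
Qed.

Let lin (a b : R) D (u v : lebRn R n -> R) : measurable D ->
  mu.-integrable D (EFin \o u) -> mu.-integrable D (EFin \o v) ->
  \int[mu]_(x in D) (a * u x + b * v x) =
  a * \int[mu]_(x in D) u x + b * \int[mu]_(x in D) v x.
Proof.
move=> mD Iu Iv; have Ia := integrableZl mD a Iu; have Ib := integrableZl mD b Iv.
by rewrite (RintegralD mD Ia Ib) (RintegralZl _ mD Iu) (RintegralZl _ mD Iv).
Qed.

Let Rsum D (h : 'I_d -> lebRn R n -> R) : measurable D ->
  (forall i, mu.-integrable D (EFin \o h i)) ->
  \int[mu]_(x in D) (\sum_i h i x) = \sum_i \int[mu]_(x in D) h i x.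
Proof.
move=> mD Ih; rewrite /Rintegral.
under eq_integral do rewrite -sumEFin.
rewrite (integral_sum mD Ih) sum_fine => [//|i _].
exact: (integrable_fin_num mD (Ih i)).
Qed.

Lemma mul_vintegral (M : 'M[C]_d) D f : measurable D -> vintegrable D f ->
  M *m vintegral D f = vintegral D (fun x => M *m f x).
Proof.
move=> mD If; apply/colP => i; rewrite !mxE /cintegral.
apply/eqP; rewrite eq_complex /= Re_sum Im_sum; apply/andP; split; apply/eqP.
  transitivity (\sum_j \int[mu]_(x in D)
     (complex.Re (M i j) * complex.Re (f x j ord0) + - complex.Im (M i j) * complex.Im (f x j ord0))).
    by apply: eq_bigr => j _; have [I1 I2] := If j; rewrite mxE ReM (lin _ _ mD I1 I2) mulNr.
  rewrite -(Rsum mD) => [|j]; last by have [I1 I2] := If j; exact: linI.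
  apply: eq_Rintegral => x _; rewrite mxE Re_sum; apply: eq_bigr => j _.
  by rewrite ReM mulNr.
transitivity (\sum_j \int[mu]_(x in D)
   (complex.Im (M i j) * complex.Re (f x j ord0) + complex.Re (M i j) * complex.Im (f x j ord0))).
  by apply: eq_bigr => j _; have [I1 I2] := If j; rewrite mxE ImM (lin _ _ mD I1 I2) addrC.
rewrite -(Rsum mD) => [|j]; last by have [I1 I2] := If j; exact: linI.
apply: eq_Rintegral => x _; rewrite mxE Im_sum; apply: eq_bigr => j _.
by rewrite ImM addrC.
Qed.

Lemma ancestor0 (k : 'rV[int]_n) : ancestor 0 k = k.
Proof. by apply/rowP => i; rewrite mxE expn0 divz1. Qed.

Let mkf f : mxmfun f -> measurable_fun setT
  (fun z : lebRn R n * lebRn R n => (kernel p W z.1 z.2 * wnorm f z.2)%:E).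
Proof.
move=> mf; apply/measurable_EFinP; apply: measurable_funM; first exact: (measurable_kernelW).
exact: (measurableT_comp (measurable_wnorm mf) measurable_snd).
Qed.

Let mker1 x : measurable_fun setT (kernel p W x).
Proof. exact: (measurableT_comp (measurable_kernelW) (measurable_pair1 x)). Qed.

Let kf0 f (z : lebRn R n * lebRn R n) : (0 <= (kernel p W z.1 z.2 * wnorm f z.2)%:E)%E.
Proof. by rewrite lee_fin mulr_ge0 ?kernel_ge0 ?wnorm_ge0. Qed.

Let kf0' f x D : (0 <= \int[mu]_(y in D) (kernel p W x y * wnorm f y)%:E)%E.
Proof. by apply: integral_ge0 => y _; exact: (kf0 f (x, y)). Qed.

(** On a point [y] where [W] is invertible, [W^(1/p)(x) f(y)] is the product of
    [W^(1/p)(x) W^(-1/p)(y)] and [W^(1/p)(y) f(y)]. *)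
Lemma fnorm_kernel f x y : W y \in unitmx ->
  fnorm (mpow (W x) p^-1 *m f y) <= kernel p W x y * wnorm f y.
Proof.
move=> uy; rewrite -[X in fnorm (X *m _)]mulmx1 -(mpow_mulNV p^-1 (adm_nonneg H y) uy) mulmxA.
by rewrite -mulmxA; exact: fnormM.
Qed.

(** By [kernel_bound] the integral over [y] of the kernel times [wnorm f] is finite
    for almost every [x]; at one such [x] the invertible factor [W^(1/p)(x)] can be
    removed. *)
Lemma mass_vintegrable j k f : mxmfun f -> (mass (dyadic_cube j k) f < +oo)%E ->
  vintegrable (dyadic_cube j k) f.
Proof.
move=> mf fin.
have [K K0 hK] := kernel_bound (adm_d H) (adm_p H) (adm_nonneg H) (adm_meas H) (adm_dim H).
have := hK j 0%N k _ (measurable_wnorm mf) (wnorm_ge0 f).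
rewrite ancestor0 addr0; set P := dyadic_cube j k in fin * => h.
have mP : measurable (P : set (lebRn R n)) by exact: measurable_dyadic.
pose g x := poweR (\int[mu]_(y in P) (kernel p W x y * wnorm f y)%:E) p.
have mI := measurable_integral_snd mu (mkf mf) (@kf0 f) mP.
have mg : measurable_fun setT g by exact: (measurableT_comp (measurable_poweR _) mI).
have Ig : mu.-integrable P g.
  apply/integrableP; split; first exact: measurable_funTS.
  have -> : (\int[mu]_(x in P) `|g x| = \int[mu]_(x in P) g x)%E.
    by apply: eq_integral => x _; rewrite gee0_abs // poweR_ge0.
  apply: (le_lt_trans h); apply: lte_mul_pinfty => //.
  by rewrite lee_fin !mulr_ge0 ?powR_ge0 // ltW.
have hae : {ae mu, forall x, (P x -> g x \is a fin_num) /\ W x \in unitmx}.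
  apply: filterS2 (integrable_ae mP Ig) (adm_unit H) => x h1 h2; split => //.
have [x0 Px0 [gx0 ux0]] := ae_exists j k hae.
have Ifin : (\int[mu]_(y in P) (kernel p W x0 y * wnorm f y)%:E < +oo)%E.
  apply: (lty_poweRy (lt0r_neq0 p0)); rewrite ltey_eq.
  by rewrite gx0.
have mk0 : measurable_fun setT (fun y => kernel p W x0 y * wnorm f y).
  exact: (measurable_funM (mker1 x0) (measurable_wnorm mf)).
pose b := fnorm (mpow (W x0) (- p^-1)).
apply: (@vintegrable_le P f (fun y => b * (kernel p W x0 y * wnorm f y)) mP mf).
- apply: (ae_imp (adm_unit H)) => y uy _.
  rewrite -[X in fnorm X]mul1mx -(mpow_mulNV p^-1 (adm_nonneg H x0) ux0) -mulmxA.
  apply: (le_trans (fnormM _ _)); rewrite ler_wpM2l ?fnorm_ge0 //; exact: fnorm_kernel.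
- by apply: measurable_funM; [exact: measurable_cst|exact: mk0].
- by move=> y; rewrite !mulr_ge0 ?fnorm_ge0 ?kernel_ge0.
- under eq_integral do rewrite EFinM.
  rewrite -(ge0_integralMl mu mP); last 3 first.
  + exact/measurable_EFinP.
  + by move=> y; exact: (kf0 f (x0, y)).
  + exact: fnorm_ge0.
  by apply: lte_mul_pinfty => //; rewrite lee_fin fnorm_ge0.
Qed.

Lemma fnorm_vintegral D f : measurable D -> mxmfun f -> vintegrable D f ->
  ((fnorm (vintegral D f))%:E <= (2 * d%:R)%:E * \int[mu]_(x in D) (fnorm (f x))%:E)%E.
Proof.
move=> mD mf If; set J := (\int[mu]_(x in D) (fnorm (f x))%:E)%E.
have bound (u : lebRn R n -> R) : mu.-integrable D (EFin \o u) ->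
    (forall x, `|u x| <= fnorm (f x)) -> (`|\int[mu]_(x in D) u x|%:E <= J)%E.
  move=> Iu uf; rewrite /Rintegral -abse_EFin fineK; last exact: integrable_fin_num.
  apply: (@le_trans _ _ (\int[mu]_(x in D) `|(u x)%:E|)%E).
    by have /integrableP[mu' _] := Iu; exact: (le_abse_integral mu mD mu').
  apply: ge0_le_integral_any => [x _|x _|//|x _].
  - exact: abse_ge0.
  - by rewrite lee_fin fnorm_ge0.
  by rewrite lee_fin.
have J0 : (0 <= J)%E by apply: integral_ge0 => x _; rewrite lee_fin fnorm_ge0.
have re i : (`|complex.Re (vintegral D f i ord0)|%:E <= J)%E.
  rewrite mxE; apply: bound; first by have [] := If i.
  by move=> x; exact: normRe_le_fnorm.
have im i : (`|complex.Im (vintegral D f i ord0)|%:E <= J)%E.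
  rewrite mxE; apply: bound; first by have [] := If i.
  by move=> x; exact: normIm_le_fnorm.
have d0 : 0 < 2 * d%:R :> R by rewrite mulr_gt0 // ltr0n (adm_d H).
clearbody J; case: J J0 re im {bound} => [c| |//] J0 re im; last first.
  by rewrite gt0_muley ?lte_fin // leey.
rewrite -EFinM lee_fin; apply: (le_trans (fnorm_le_sum _)).
apply: (@le_trans _ _ (\sum_(i < d) (2 * c))).
  apply: ler_sum => i _; rewrite big_ord1 mulr_natl mulr2n lerD // -lee_fin.
    exact: re.
  exact: im.
by rewrite sumr_const card_ord -[X in X <= _]mulr_natl mulrA [d%:R * 2]mulrC.
Qed.

Let bound_const : R := 2 * d%:R.

Let bound_const_gt0 : 0 < bound_const.
Proof. by rewrite mulr_gt0 // ltr0n (adm_d H). Qed.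

Lemma avgv_bound j k f x : mxmfun f -> (mass (dyadic_cube j k) f < +oo)%E ->
  ((fnorm (mpow (W x) p^-1 *m avgv j k f))%:E <=
   (2 * d%:R / vol (dyadic_cube j k : set 'rV[R]_n))%:E *
   \int[mu]_(y in dyadic_cube j k) (kernel p W x y * wnorm f y)%:E)%E.
Proof.
move=> mf fin; have If := mass_vintegrable mf fin.
have mP : measurable (dyadic_cube j k : set (lebRn R n)) by exact: measurable_dyadic.
have v0 := vol_dyadic_gt0 (R:=R) (n:=n) j k.
set I := (\int[mu]_(y in _) _)%E.
have I0 : (0 <= I)%E by exact: kf0'.
have c0 : 0 < 2 * d%:R / vol (dyadic_cube j k : set 'rV[R]_n).
  by apply: divr_gt0 => //; exact: bound_const_gt0.
have [Iy|Ifin] := eqVneq I +oo%E.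
  by rewrite Iy gt0_muley ?lte_fin // leey.
have {}Ifin : (I < +oo)%E by rewrite ltey.
pose A := mpow (W x) p^-1; rewrite -/A.
have mAf : mxmfun (fun y => A *m f y).
  by apply: mxmfunM => //; exact: mxmfun_cst.
have mk0 : measurable_fun setT (fun y => kernel p W x y * wnorm f y).
  exact: (measurable_funM (mker1 x) (measurable_wnorm mf)).
have hk : {ae mu, forall y, dyadic_cube j k y -> fnorm (A *m f y) <= kernel p W x y * wnorm f y}.
  by apply: (ae_imp (adm_unit H)) => y uy _; exact: fnorm_kernel.
have IAf : vintegrable (dyadic_cube j k) (fun y => A *m f y).
  apply: (vintegrable_le mP mAf hk mk0) => //.
  by move=> y; rewrite mulr_ge0 ?kernel_ge0 ?wnorm_ge0.
rewrite /avgv -scalemxAr fnormZ cabs2_real sqrtr_sqr ger0_norm ?invr_ge0 ?(ltW v0) //.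
rewrite (mul_vintegral A mP If) EFinM.
apply: (le_trans (lee_wpmul2l _ (fnorm_vintegral mP mAf IAf))).
  by rewrite lee_fin invr_ge0 ltW.
rewrite muleA -EFinM mulrC; apply: lee_wpmul2l; first by rewrite lee_fin ltW.
apply: ae_ge0_le_integral_any; first exact: mP.
- by apply/measurable_EFinP; apply: measurable_funTS; exact: measurable_fnorm.
- by apply/measurable_EFinP; exact: measurable_funTS.
- by move=> y; rewrite lee_fin fnorm_ge0.
- by move=> y; exact: (kf0 f (x, y)).
by apply: (ae_imp hk) => y h Py; rewrite lee_fin; exact: h.
Qed.

(** On a small cube inside a cube of level [j] the average is constant, and
    [kernel_bound] measures how much of the mass the small cube can carry. *)
Lemma mass_avg_small : exists2 K : R, 0 < K & forall j m k f, mxmfun f ->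
  (mass (dyadic_cube (j + m%:Z) k) (avg_fun j f) <=
   (K * 2 `^ (m%:R * (dt - n%:R)))%:E * mass (dyadic_cube j (ancestor m k)) f)%E.
Proof.
have [K K0 hK] := kernel_bound (adm_d H) (adm_p H) (adm_nonneg H) (adm_meas H) (adm_dim H).
exists (bound_const `^ p * K); first by rewrite mulr_gt0 // powR_gt0.
move=> j m k f mf.
have c0 : 0 < bound_const `^ p * K * 2 `^ (m%:R * (dt - n%:R)).
  by rewrite !mulr_gt0 ?powR_gt0.
have := hK j m k _ (measurable_wnorm mf) (wnorm_ge0 f).
set P := dyadic_cube j (ancestor m k); set Q := dyadic_cube (j + m%:Z) k => h.
have mP : measurable (P : set (lebRn R n)) by exact: measurable_dyadic.
have mQ : measurable (Q : set (lebRn R n)) by exact: measurable_dyadic.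
have [My|Mfin] := eqVneq (mass P f) +oo%E.
  by rewrite My gt0_muley ?lte_fin // leey.
have {}Mfin : (mass P f < +oo)%E by rewrite ltey.
have v0 : 0 < vol P by exact: vol_dyadic_gt0.
pose a := bound_const / vol P; have a0 : 0 < a by rewrite divr_gt0.
pose g x := poweR (\int[mu]_(y in P) (kernel p W x y * wnorm f y)%:E) p.
have mg : measurable_fun setT g.
  apply: (measurableT_comp (measurable_poweR _)).
  exact: (measurable_integral_snd mu (mkf mf) (@kf0 f) mP).
apply: (@le_trans _ _ (\int[mu]_(x in Q) ((a `^ p)%:E * g x))%E).
  apply: ge0_le_integral_any => [x _|x _|//|x Qx].
  - by rewrite lee_fin powR_ge0.
  - by apply: mule_ge0; [rewrite lee_fin powR_ge0|exact: poweR_ge0].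
  rewrite -(poweR_EFinM _ (ltW a0) (kf0' f x P)) -poweR_EFin.
  apply: le_poweR; [exact: ltW|by rewrite lee_fin wnorm_ge0|].
  rewrite /wnorm (avg_funE f (dyadic_cube_ancestor Qx)).
  exact: avgv_bound.
rewrite -(ge0_integralMl mu mQ mg (fun x => poweR_ge0 _ _) (powR_ge0 a p)).
apply: (le_trans (lee_wpmul2l _ h)); first by rewrite lee_fin powR_ge0.
rewrite muleA -EFinM; apply: lee_wpmul2r; first exact: mass_ge0.
rewrite lee_fin le_eqVlt; apply/orP; left; apply/eqP.
have av : a `^ p * vol P `^ p = bound_const `^ p.
  by rewrite -powRM ?(ltW a0) ?(ltW v0) // /a divfK // gt_eqF.
by rewrite -av; ring.
Qed.

Lemma mass_children j m k f : mxmfun f -> mass (dyadic_cube j k) f =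
  (\sum_(e <- enum 'rV['I_(2 ^ m)]_n) mass (dyadic_cube (j + m%:Z) (@child n m k e)) f)%E.
Proof.
move=> mf; rewrite {1}(dyadic_cube_children j m k).
apply: ge0_integral_bigsetU.
- by move=> e; exact: measurable_dyadic.
- exact: enum_uniq.
- move=> e e' _ _ [x [Qx Qx']].
  exact: (@child_inj n m k _ _ (dyadic_cube_disj Qx Qx')).
- by apply: measurable_funTS; exact: (measurable_wnormp mf).
- by move=> x _; rewrite lee_fin powR_ge0.
Qed.

(** A cube of level [j] is a union of cubes of level [j + m], and on each of these the
    case [m = 0] of [mass_avg_small] applies. *)
Lemma mass_avg_large : exists2 K : R, 0 < K & forall j m k f, mxmfun f ->
  (mass (dyadic_cube j k) (avg_fun (j + m%:Z) f) <= K%:E * mass (dyadic_cube j k) f)%E.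
Proof.
have [K K0 hK] := mass_avg_small; exists K => // j m k f mf.
rewrite (mass_children j m k (mxmfun_avg (j + m%:Z) f)) (mass_children j m k mf).
rewrite ge0_sume_distrr => [|e _]; last exact: mass_ge0.
apply: lee_sum => e _; have := hK (j + m%:Z) 0%N (child k e) f mf.
by rewrite mul0r powRr0 mulr1 addr0 ancestor0.
Qed.

Lemma avgvD j k f g : vintegrable (dyadic_cube j k) f -> vintegrable (dyadic_cube j k) g ->
  avgv j k (fun x => f x + g x) = avgv j k f + avgv j k g.
Proof.
move=> If Ig; rewrite /avgv -scalerDr; congr (_ *: _); apply/colP => i; rewrite !mxE.
have mD : measurable (dyadic_cube j k : set (lebRn R n)) by exact: measurable_dyadic.
have [f1 f2] := If i; have [g1 g2] := Ig i.
apply/eqP; rewrite eq_complex /=; apply/andP; split; apply/eqP.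
  by rewrite -(RintegralD mD f1 g1); apply: eq_Rintegral => x _; rewrite mxE ReD.
by rewrite -(RintegralD mD f2 g2); apply: eq_Rintegral => x _; rewrite mxE ImD.
Qed.

Lemma avgv_eq j k f (v : 'cV[C]_d) : (forall x, dyadic_cube j k x -> f x = v) -> avgv j k f = v.
Proof.
move=> fv; rewrite /avgv; have v0 := vol_dyadic_gt0 (R:=R) (n:=n) j k.
have cst (u : lebRn R n -> R) (c : R) : (forall x, dyadic_cube j k x -> u x = c) ->
    \int[mu]_(x in dyadic_cube j k) u x = vol (dyadic_cube j k : set 'rV[R]_n) * c.
  move=> uc; rewrite /Rintegral.
  rewrite (@eq_integral _ _ _ mu _ (fun=> c%:E)) => [|x /set_mem Qx]; last by rewrite uc.
  by rewrite integral_cst_dyadic /= mulrC.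
apply/colP => i; rewrite !mxE /cintegral.
rewrite (cst _ (complex.Re (v i ord0))) => [|x /fv -> //].
rewrite (cst _ (complex.Im (v i ord0))) => [|x /fv -> //].
case: (v i ord0) => a b; apply/eqP; rewrite eq_complex ReM ImM /= !mul0r subr0 addr0.
by rewrite !(mulKf (lt0r_neq0 v0)) !eqxx.
Qed.

(** * Elementary properties of the mass *)

Lemma le_mass D D' f g : D `<=` D' -> (forall x, D x -> wnorm f x <= wnorm g x) ->
  (mass D f <= mass D' g)%E.
Proof.
move=> DD' fg; apply: ge0_le_integral_any => [x _|x _|//|x Dx].
- by rewrite lee_fin powR_ge0.
- by rewrite lee_fin powR_ge0.
by rewrite lee_fin; apply: ge0_ler_powR; rewrite ?nnegrE ?wnorm_ge0 ?(ltW p0) // fg.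
Qed.

Lemma eq_mass D f g : (forall x, D x -> f x = g x) -> mass D f = mass D g.
Proof.
move=> fg; apply/eqP; rewrite eq_le; apply/andP; split; apply: le_mass => // x Dx;
by rewrite /wnorm fg.
Qed.

Definition quasi_const : R := 2 `^ p * 2 `^ p.

Lemma quasi_const_gt0 : 0 < quasi_const. Proof. by rewrite mulr_gt0 // powR_gt0. Qed.

Lemma massD D f g : measurable D -> mxmfun f -> mxmfun g ->
  (mass D (fun x => f x + g x)%R <= quasi_const%:E * (mass D f + mass D g))%E.
Proof.
move=> mD mf mg; have m1 := measurable_wnormp mf; have m2 := measurable_wnormp mg.
have f0 f' x : (0 <= (wnorm f' x `^ p)%:E)%E by rewrite lee_fin powR_ge0.
rewrite /mass -(ge0_integralD mu mD (fun x _ => f0 f x) (measurable_funTS m1)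
  (fun x _ => f0 g x) (measurable_funTS m2)).
rewrite (ge0_integralMl mu mD (emeasurable_funD m1 m2) (fun x => adde_ge0 (f0 f x) (f0 g x))
  (ltW quasi_const_gt0)).
apply: ge0_le_integral_any => [x _|x _|//|x _]; first exact: f0.
  by apply: mule_ge0; [rewrite lee_fin ltW // quasi_const_gt0|apply: adde_ge0; exact: f0].
rewrite -EFinD -EFinM lee_fin /quasi_const -mulrA.
apply: (@le_trans _ _ ((2 * (wnorm f x + wnorm g x)) `^ p)).
  apply: ge0_ler_powR; rewrite ?nnegrE ?wnorm_ge0 ?(ltW p0) //.
    by rewrite mulr_ge0 // addr_ge0 // wnorm_ge0.
  by rewrite /wnorm mulmxDr; exact: fnormD.
rewrite powRM ?addr_ge0 ?wnorm_ge0 // ler_wpM2l ?powR_ge0 //.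
by apply: powR_add_le; rewrite ?wnorm_ge0 // ltW.
Qed.

Lemma wnormZ (c : C) f x : wnorm (fun x => c *: f x) x = Num.sqrt (cabs2 c) * wnorm f x.
Proof. by rewrite /wnorm -scalemxAr fnormZ. Qed.

Lemma massZ D (c : C) f : measurable D -> mxmfun f ->
  mass D (fun x => c *: f x) = ((Num.sqrt (cabs2 c) `^ p)%:E * mass D f)%E.
Proof.
move=> mD mf; have m1 := measurable_wnormp mf.
rewrite (ge0_integralMl mu mD m1) ?powR_ge0 //; last by move=> x; rewrite lee_fin powR_ge0.
by apply: eq_integral => x _; rewrite wnormZ powRM ?sqrtr_ge0 ?wnorm_ge0 // EFinM.
Qed.

Lemma wnormN f x : wnorm (fun x => - f x) x = wnorm f x.
Proof.
rewrite /wnorm mulmxN -scaleN1r fnormZ.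
by rewrite (_ : cabs2 (-1) = 1) ?sqrtr1 ?mul1r // /cabs2 /= oppr0 expr0n addr0 sqrrN expr1n.
Qed.

Lemma mxmfunN f : mxmfun f -> mxmfun (fun x => - f x).
Proof.
move=> mf; have -> : (fun x => - f x) = (fun x => (-1) *: f x).
  by apply/funext => x; rewrite scaleN1r.
exact: (mxmfunZ (cmfun_cst _) mf).
Qed.

Lemma mxmfunB f g : mxmfun f -> mxmfun g -> mxmfun (fun x => f x - g x).
Proof.
by move=> mf mg; exact: (mxmfunD mf (mxmfunN mg)).
Qed.

(** Dominated convergence, for approximations that are eventually exact at each
    point. *)
Lemma mass_eventually D (f : nat -> lebRn R n -> 'cV[C]_d) g : measurable D ->
  (forall m, mxmfun (f m)) -> mxmfun g -> (mass D g < +oo)%E ->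
  (forall m x, wnorm (f m) x <= wnorm g x) ->
  (forall x, exists m0, forall m, (m0 <= m)%N -> f m x = 0) ->
  forall e, 0 < e -> exists m, (mass D (f m) <= e%:E)%E.
Proof.
move=> mD mf mg gfin fg ev e e0.
have : (fun m => mass D (f m)) @ \oo --> (\int[mu]_(x in D) (cst 0 x))%E.
  apply: (@dominated_cvg _ _ _ mu D mD (fun m x => (wnorm (f m) x `^ p)%:E) (cst 0%E)
    (fun x => (wnorm g x `^ p)%:E)).
  - by move=> m; apply: measurable_funTS; exact: (measurable_wnormp (mf m)).
  - move=> x _; have [m0 hm] := ev x; apply: cvg_near_cst.
    exists m0 => // m /= m0m; rewrite /wnorm hm // mulmx0 fnorm0 powR0 //.
    by rewrite gt_eqF.
  - by [].
  - apply/integrableP; split; first by apply: measurable_funTS; exact: (measurable_wnormp mg).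
    rewrite (_ : (\int[mu]_(x in D) _)%E = mass D g) //.
    by apply: eq_integral => x _; rewrite gee0_abs // lee_fin powR_ge0.
  - move=> m x _; rewrite gee0_abs ?lee_fin ?powR_ge0 //.
    by apply: ge0_ler_powR; rewrite ?nnegrE ?wnorm_ge0 ?(ltW p0).
rewrite integral0 => /fine_cvgP[[m1 _ h1]] /cvgrPdist_le /(_ e e0) [m2 _ h2].
exists (maxn m1 m2); have := h2 _ (leq_maxr m1 m2) => /=.
rewrite sub0r normrN => h; rewrite -(fineK (h1 _ (leq_maxl m1 m2))) lee_fin.
exact: le_trans (ler_norm _) h.
Qed.

Lemma avg_linear j k (c : C) f g : mxmfun f -> mxmfun g ->
  (mass (dyadic_cube j k) f < +oo)%E -> (mass (dyadic_cube j k) g < +oo)%E ->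
  avgv j k (fun x => c *: f x + g x) = c *: avgv j k f + avgv j k g.
Proof.
move=> mf mg ff fg.
have If := mass_vintegrable mf ff; have Ig := mass_vintegrable mg fg.
have mD : measurable (dyadic_cube j k : set (lebRn R n)) by exact: measurable_dyadic.
have mcf : mxmfun (fun x => c *: f x) by exact: (mxmfunZ (cmfun_cst _) mf).
have Icf : vintegrable (dyadic_cube j k) (fun x => c *: f x).
  apply: (mass_vintegrable mcf); rewrite (massZ c mD mf).
  by apply: lte_mul_pinfty; [rewrite lee_fin powR_ge0|by []|exact: ff].
rewrite (avgvD Icf Ig); congr (_ + _); rewrite /avgv scalerA mulrC -scalerA; congr (_ *: _).
rewrite -mul_scalar_mx (mul_vintegral _ mD If).
by congr vintegral; apply/funext => x; rewrite mul_scalar_mx.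
Qed.

Lemma avg_fun_linear j m k (c : C) f g x : mxmfun f -> mxmfun g ->
  (mass (dyadic_cube j k) f < +oo)%E -> (mass (dyadic_cube j k) g < +oo)%E ->
  dyadic_cube j k x ->
  avg_fun (j + m%:Z) (fun x => c *: f x + g x) x =
  c *: avg_fun (j + m%:Z) f x + avg_fun (j + m%:Z) g x.
Proof.
move=> mf mg ff fg /dyadic_cubeP kx.
have sub : dyadic_cube (j + m%:Z) (cube_index (j + m%:Z) x) `<=` (dyadic_cube j k : set 'rV[R]_n).
  by rewrite kx -(ancestor_index j m x) => y; exact: dyadic_cube_ancestor.
have ff' := le_lt_trans (le_mass sub (fun x _ => lexx (wnorm f x))) ff.
have fg' := le_lt_trans (le_mass sub (fun x _ => lexx (wnorm g x))) fg.
exact: (avg_linear c mf mg ff' fg').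
Qed.

End averages.

(** * Convergence of the averages on a cube *)

Section average_convergence.
Context {R : realType} {n d : nat}.
Local Notation C := R[i].
Local Notation mu := (lebesgueRn R n).
Variables (p dt : R) (W : lebRn R n -> 'M[C]_d).
Hypothesis H : admissible p dt W.
Hypothesis wfin : forall j k,
  (\int[mu]_(x in dyadic_cube j k) (wdens p W x)%:E < +oo)%E.
Variables (j : int) (k : 'rV[int]_n).
Local Open Scope complex_scope.
Implicit Types (f g h : lebRn R n -> 'cV[C]_d) (E : set (lebRn R n)) (v : 'cV[C]_d).
Local Notation Q := (dyadic_cube j k : set (lebRn R n)).
Local Notation mass := (mass p W Q).

Let p0 := adm_p0 H.
Let mQ : measurable Q := measurable_dyadic j k.
Let a : R := quasi_const p.
Let a0 : 0 < a := quasi_const_gt0 p.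

Definition avg_err g (m : nat) : lebRn R n -> 'cV[C]_d :=
  fun x => g x - avg_fun (j + m%:Z) g x.

(** The class that is to contain every function of finite mass: a subspace, closed
    because the averages are uniformly bounded. *)
Definition good g : Prop := [/\ mxmfun g, (mass g < +oo)%E &
  forall e, 0 < e -> exists m0, forall m, (m0 <= m)%N -> (mass (avg_err g m) <= e%:E)%E].

Lemma mxmfun_err g m : mxmfun g -> mxmfun (avg_err g m).
Proof. by move=> mg; exact: (mxmfunB mg (mxmfun_avg _ _)). Qed.

Lemma mass_lin c f g : mxmfun f -> mxmfun g ->
  (mass (fun x => c *: f x + g x)%R <=
    a%:E * ((Num.sqrt (cabs2 c) `^ p)%:E * mass f + mass g))%E.
Proof.
move=> mf mg; have mcf : mxmfun (fun x => c *: f x) by exact: (mxmfunZ (cmfun_cst _) mf).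
apply: (le_trans (massD H mQ mcf mg)); apply: lee_wpmul2l; first by rewrite lee_fin ltW.
by rewrite (massZ H c mQ mf).
Qed.

Lemma massN f : mass (fun x => - f x) = mass f.
Proof. by apply: eq_integral => x _; rewrite wnormN. Qed.

Lemma good_lin c f g : good f -> good g -> good (fun x => c *: f x + g x).
Proof.
move=> [mf ff hf] [mg fg hg].
have mfg : mxmfun (fun x => c *: f x + g x).
  exact: (mxmfunD (mxmfunZ (cmfun_cst _) mf) mg).
pose b := Num.sqrt (cabs2 c) `^ p; have b0 : 0 <= b by exact: powR_ge0.
split; first exact: mfg.
  apply: (le_lt_trans (mass_lin c mf mg)); apply: lte_mul_pinfty => //.
    by rewrite lee_fin ltW.
  apply: lte_add_pinfty; last exact: fg.
  by apply: lte_mul_pinfty; [rewrite lee_fin|by []|exact: ff].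
move=> e e0.
have e1 : 0 < e / (2 * a * (b + 1)) by rewrite divr_gt0 // !mulr_gt0 // ltr_wpDl.
have e2 : 0 < e / (2 * a) by rewrite divr_gt0 // mulr_gt0.
have [m1 h1] := hf _ e1; have [m2 h2] := hg _ e2.
exists (maxn m1 m2) => m; rewrite geq_max => /andP[/h1 {}h1 /h2 {}h2].
have -> : mass (avg_err (fun x => c *: f x + g x) m) =
    mass (fun x => c *: avg_err f m x + avg_err g m x).
  apply: (eq_mass H) => x Qx; rewrite /avg_err (avg_fun_linear H m c mf mg ff fg Qx).
  by rewrite scalerBr opprD addrACA.
apply: (le_trans (mass_lin c (mxmfun_err m mf) (mxmfun_err m mg))).
apply: (@le_trans _ _ (a%:E * (b%:E * (e / (2 * a * (b + 1)))%:E + (e / (2 * a))%:E))%E).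
  apply: lee_wpmul2l; first by rewrite lee_fin ltW.
  by apply: leeD; [apply: lee_wpmul2l; [rewrite lee_fin|exact: h1]|exact: h2].
rewrite -!(EFinM, EFinD) lee_fin.
have -> : a * (b * (e / (2 * a * (b + 1))) + e / (2 * a)) = e * (b / (b + 1) + 1) / 2.
  by field; rewrite !gt_eqF // ltr_wpDl.
have : b / (b + 1) <= 1 by rewrite ler_pdivrMr ?ltr_wpDl // mul1r lerDl.
by move: (b / (b + 1)) => q q1; nra.
Qed.

Lemma good_closed g : mxmfun g -> (mass g < +oo)%E ->
  (forall e, 0 < e -> exists2 h, good h & (mass (fun x => g x - h x)%R <= e%:E)%E) -> good g.
Proof.
move=> mg fg approx; split; [exact: mg|exact: fg|].
move=> e e0; have [K K0 hK] := mass_avg_large H.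
pose c := a * (1 + a * (1 + K)).
have c0 : 0 < c by rewrite mulr_gt0 // ltr_pwDl // mulr_ge0 ?(ltW a0) // addr_ge0 // ltW.
have e1 : 0 < e / c by rewrite divr_gt0.
have [h [mh fh hh] gh] := approx _ e1; have [m0 hm] := hh _ e1.
exists m0 => m /hm {}hm.
pose D := fun x => g x - h x; pose D' := fun x => (-1) *: g x + h x.
have mD : mxmfun D by exact: (mxmfunB mg mh).
have mD' : mxmfun D' by exact: (mxmfunD (mxmfunZ (cmfun_cst _) mg) mh).
have DD' : mass D' = mass D.
  have -> : D' = (fun x => - D x) by apply/funext => y; rewrite /D /D' scaleN1r opprB addrC.
  exact: massN.
have -> : mass (avg_err g m) =
    mass (fun x => D x + (avg_err h m x + avg_fun (j + m%:Z) D' x)).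
  apply: (eq_mass H) => x Qx; rewrite /D' (avg_fun_linear H m (-1) mg mh fg fh Qx).
  rewrite /avg_err /D scaleN1r; move: (avg_fun _ g x) (avg_fun _ h x) => u v.
  by rewrite [- u + v]addrC [h x - v + _]addrA subrK addrA subrK.
have mE : mxmfun (fun x => avg_err h m x + avg_fun (j + m%:Z) D' x).
  exact: (mxmfunD (mxmfun_err m mh) (mxmfun_avg _ _)).
apply: (le_trans (massD H mQ mD mE)).
apply: (@le_trans _ _ (a%:E * ((e / c)%:E + a%:E * ((e / c)%:E + K%:E * (e / c)%:E)))%E).
  apply: lee_wpmul2l; first by rewrite lee_fin ltW.
  apply: leeD; first exact: gh.
  apply: (le_trans (massD H mQ (mxmfun_err m mh) (mxmfun_avg _ _))).
  apply: lee_wpmul2l; first by rewrite lee_fin ltW.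
  apply: leeD; first exact: hm.
  apply: (le_trans (hK j m k D' mD')); apply: lee_wpmul2l; first by rewrite lee_fin ltW.
  by rewrite DD'; exact: gh.
rewrite -!(EFinM, EFinD) lee_fin le_eqVlt; apply/orP; left; apply/eqP.
have -> : a * (e / c + a * (e / c + K * (e / c))) = c * (e / c) by rewrite /c; ring.
by rewrite mulrC (divfK (lt0r_neq0 c0)).
Qed.

Lemma good_eq f g : (forall x, f x = g x) -> good f -> good g.
Proof. by move=> /funext ->. Qed.

Lemma mass_cst_fin v : (mass (fun=> v) < +oo)%E.
Proof.
have mw : measurable_fun setT (fun x => (wdens p W x)%:E).
  by apply/measurable_EFinP; exact: (measurable_wdens (adm_p H) (adm_nonneg H) (adm_meas H)).
apply: (@le_lt_trans _ _ (\int[mu]_(x in Q) ((fnorm v `^ p)%:E * (wdens p W x)%:E))%E).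
  apply: ge0_le_integral_any => [x _|x _|//|x _].
  - by rewrite lee_fin powR_ge0.
  - by apply: mule_ge0; rewrite lee_fin ?powR_ge0 ?wdens_ge0.
  rewrite -EFinM lee_fin /wdens -powRM ?fnorm_ge0 //.
  apply: ge0_ler_powR; rewrite ?nnegrE ?wnorm_ge0 ?(ltW p0) ?mulr_ge0 ?fnorm_ge0 //.
  by rewrite mulrC; exact: fnormM.
rewrite -(ge0_integralMl mu mQ mw); last 2 first.
- by move=> x; rewrite lee_fin wdens_ge0.
- exact: powR_ge0.
by apply: lte_mul_pinfty; [rewrite lee_fin powR_ge0|by []|exact: wfin].
Qed.

(** A function that is constant on the cubes of some level is its own average at all
    finer levels. *)
Lemma good_dyadic_step f (m0 : nat) : mxmfun f -> (mass f < +oo)%E ->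
  (forall m x y, (m0 <= m)%N -> cube_index (j + m%:Z) x = cube_index (j + m%:Z) y ->
    f x = f y) -> good f.
Proof.
move=> mf ff cf; split; [exact: mf|exact: ff|].
move=> e e0; exists m0 => m m0m.
have -> : mass (avg_err f m) = mass (fun=> 0).
  apply: (eq_mass H) => x _; rewrite /avg_err /avg_fun.
  rewrite (@avgv_eq _ _ _ _ _ f (f x)) ?subrr // => y /dyadic_cubeP yx.
  by apply: (cf m) => //; rewrite yx.
rewrite (_ : mass (fun=> 0) = 0%E) ?lee_fin ?ltW //.
rewrite /mass integral0_eq // => x _.
by rewrite /wnorm mulmx0 fnorm0 powR0 // gt_eqF.
Qed.

Definition ind E v : lebRn R n -> 'cV[C]_d := fun x => (\1_E x)%:C *: v.

Lemma mxmfun_ind E v : measurable E -> mxmfun (ind E v).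
Proof.
move=> mE; apply: mxmfunZ; last exact: mxmfun_cst.
by apply: cmfun_real; exact: measurable_indic.
Qed.

Lemma wnorm_ind_le E v x : wnorm p W (ind E v) x <= wnorm p W (fun=> v) x.
Proof.
rewrite /wnorm /ind indicE; case: (x \in E); first by rewrite scale1r.
by rewrite scale0r mulmx0 fnorm0 fnorm_ge0.
Qed.

Lemma mass_ind_fin E v : (mass (ind E v) < +oo)%E.
Proof.
apply: le_lt_trans (mass_cst_fin v).
by apply: (le_mass H) => [x|x _]; [exact|exact: wnorm_ind_le].
Qed.

Definition good_set E := measurable E /\ forall v, good (ind E v).

Lemma good_setT : good_set setT.
Proof.
split; first exact: measurableT.
move=> v; apply: (@good_dyadic_step _ 0%N).
- by apply: mxmfun_ind; exact: measurableT.
- exact: mass_ind_fin.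
- by move=> m x y _ _; rewrite /ind !indicT.
Qed.

Lemma good_set0 : good_set set0.
Proof.
split; first exact: measurable0.
move=> v; apply: (@good_dyadic_step _ 0%N).
- by apply: mxmfun_ind; exact: measurable0.
- exact: mass_ind_fin.
- by move=> m x y _ _; rewrite /ind !indic0.
Qed.

Lemma good_set_dyadic j' k' : good_set (dyadic_cube j' k').
Proof.
split; first exact: measurable_dyadic.
move=> v; apply: (@good_dyadic_step _ (absz (j' - j)%R)).
- by apply: mxmfun_ind; exact: measurable_dyadic.
- exact: mass_ind_fin.
- move=> m x y hm xy; rewrite /ind; congr (_%:C *: _).
  have [l le] : exists l : nat, j + m%:Z = j' + l%:Z.
    by exists (absz (j + m%:Z - j')%R); lia.
  rewrite !indicE; congr ((nat_of_bool _)%:R); apply/idP/idP => /set_mem /dyadic_cubeP h; apply/mem_set;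
  by apply/dyadic_cubeP; rewrite h -!(ancestor_index j' l) -le xy.
Qed.

Lemma good_setD E F : F `<=` E -> good_set E -> good_set F -> good_set (E `\` F).
Proof.
move=> FE [mE gE] [mF gF]; split; first exact: measurableD.
move=> v; apply: good_eq (good_lin (-1) (gF v) (gE v)) => x.
rewrite /ind scaleN1r !indicE in_setD; case: (boolP (x \in F)) => [xF|xF].
  by rewrite (mem_set (FE _ (set_mem xF))) /= !scale1r scale0r addNr.
by rewrite /= andbT scale0r oppr0 add0r.
Qed.

Lemma good_set_bigcup (F : nat -> set (lebRn R n)) : nondecreasing_seq F ->
  (forall i, good_set (F i)) -> good_set (\bigcup_i F i).
Proof.
move=> ndF gF; have mF i : measurable (F i) by have [] := gF i.
have mU : measurable (\bigcup_i F i) by exact: bigcup_measurable.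
split; first exact: mU.
move=> v; apply: good_closed; [exact: (mxmfun_ind v mU)|exact: mass_ind_fin|].
have mcst : mxmfun ((fun=> v) : lebRn R n -> 'cV[C]_d) by exact: mxmfun_cst.
move=> e e0.
pose r (m : nat) x := ind (\bigcup_i F i) v x - ind (F m) v x.
have r_le m x : wnorm p W (r m) x <= wnorm p W (fun=> v) x.
  rewrite /r /wnorm /ind -scalerBl.
  have -> : (\1_(\bigcup_i F i) x)%:C - (\1_(F m) x)%:C = (\1_((\bigcup_i F i) `\` F m) x)%:C :> C.
    rewrite !indicE in_setD; case: (boolP (x \in F m)) => [xF|_]; last by rewrite andbT subr0.
    by rewrite andbF mem_set ?subrr //; exists m => //; exact: set_mem.
  exact: (wnorm_ind_le ((\bigcup_i F i) `\` F m) v x).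
have r_ev x : exists m0, forall m, (m0 <= m)%N -> r m x = 0.
  have [[i _ Fix]|nF] := pselect ((\bigcup_i F i) x).
    exists i => m im; rewrite /r /ind !indicE !mem_set ?subrr //; last by exists i.
    by move: x Fix; apply/subsetPset; exact: ndF.
  exists 0%N => m _; rewrite /r /ind !indicE !memNset ?subrr // => Fx; apply: nF.
  by exists m.
have mr m : mxmfun (r m) by exact: (mxmfunB (mxmfun_ind v mU) (mxmfun_ind v (mF m))).
have [m hm] := mass_eventually H mQ mr mcst (mass_cst_fin v) r_le r_ev e0.
by exists (ind (F m) v); [have [_] := gF m; exact|exact: hm].
Qed.

(** The dyadic cubes form a pi-system generating the Borel sets, and the good sets a
    lambda-system. *)
Lemma good_set_borel (B : set (borelRn R n)) : measurable B -> good_set (B : set (lebRn R n)).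
Proof.
move/borel_dyadic; apply: (@lambda_system_subset _ (@dyadic_sets R n) _ setT good_set).
- move=> A B' [->|[j1 [k1 ->]]]; first by rewrite set0I; left.
  move=> [->|[j2 [k2 ->]]]; first by rewrite setI0; left.
  have main i1 i2 l1 l2 : i1 <= i2 ->
      @dyadic_sets R n (dyadic_cube i1 l1 `&` dyadic_cube i2 l2).
    move=> i12; have [m mE] : exists m : nat, i2 = i1 + m%:Z.
      by exists (absz (i2 - i1)%R); lia.
    have [e|ne] := eqVneq (ancestor m l2) l1.
      right; exists i2, l2; apply/seteqP; split=> [x []//|x x2]; split => //.
      by rewrite -e; apply: dyadic_cube_ancestor; rewrite -mE.
    left; apply/seteqP; split=> // x [x1 x2] /=.
    rewrite mE in x2; move/eqP: ne; apply; exact: dyadic_cube_disj (dyadic_cube_ancestor x2) x1.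
  have [h|h] := leP j1 j2; first exact: main.
  by rewrite setIC; apply: main; exact: ltW.
- split.
  + by [].
  + exact: good_setT.
  + by move=> A B' BA gA gB; exact: good_setD.
  + by move=> F ndF gF; exact: good_set_bigcup.
- move=> A [->|[j1 [k1 ->]]]; [exact: good_set0|exact: good_set_dyadic].
- by [].
Qed.

Lemma good_ae f g : mxmfun f -> mxmfun g -> {ae mu, forall x, Q x -> f x = g x} ->
  good f -> good g.
Proof.
move=> mf mg fg gf; have [_ ff _] := gf.
have d0 : (mass (fun x => g x - f x)%R <= 0%:E)%E.
  have m1 := measurable_wnormp H (mxmfunB mg mf).
  apply: (@le_trans _ _ (\int[mu]_(x in Q) cst 0 x)%E); last by rewrite integral0.
  apply: ae_ge0_le_integral_any; first exact: mQ.
  - exact: measurable_funTS.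
  - exact: measurable_cst.
  - by move=> x; rewrite lee_fin powR_ge0.
  - by move=> x; exact: lexx.
  apply: (ae_imp fg) => x h Qx; rewrite /wnorm (h Qx) subrr mulmx0 fnorm0 powR0 //.
  by rewrite gt_eqF.
apply: good_closed; [exact: mg| |].
  have -> : mass g = mass (fun x => f x + (g x - f x)).
    by apply: (eq_mass H) => x _; rewrite addrC subrK.
  apply: (le_lt_trans (massD H mQ mf (mxmfunB mg mf))); apply: lte_mul_pinfty => //.
    by rewrite lee_fin ltW.
  by apply: lte_add_pinfty; [exact: ff|exact: (le_lt_trans d0 (ltry _))].
move=> e e0; exists f; first exact: gf.
by apply: (le_trans d0); rewrite lee_fin ltW.
Qed.

(** A measurable set of finite measure is a Borel set up to a null set. *)
Lemma good_set_measurable E : measurable E -> good_set E.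
Proof.
move=> mE; split; first exact: mE.
move=> v; have mEQ : measurable (E `&` Q) by exact: measurableI.
have fEQ : (mu (E `&` Q) < +oo)%E.
  apply: (@le_lt_trans _ _ (mu Q)).
    by apply: le_measure; rewrite ?inE //; exact: subIsetr.
  by rewrite (lebesgue_dyadic j k) ltry.
have [B mB [EB B0]] := lebesgue_borel_cover mEQ fEQ.
have [mB' gB] := good_set_borel mB.
apply: (good_ae _ _ _ (gB v)); [exact: mxmfun_ind|exact: mxmfun_ind|].
have : (mu : {measure set (lebRn R n) -> \bar R}).-negligible ((B : set (lebRn R n)) `\` (E `&` Q)).
  by exists ((B : set (lebRn R n)) `\` (E `&` Q)); split; [exact: measurableD|exact: B0|].
apply: negligibleS => x /= /not_implyP[Qx ne]; split.
  apply: contrapT => nB; apply: ne; rewrite /ind !indicE (memNset nB) memNset //.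
  by move=> Ex; apply: nB; apply: EB.
by move=> [Ex _]; apply: ne; rewrite /ind !indicE !mem_set //; apply: EB.
Qed.

Lemma good0 : good (fun=> 0).
Proof.
have [_ h] := good_set0; apply: good_eq (h 0) => x.
by rewrite /ind scaler0.
Qed.

Lemma goodZ c f : good f -> good (fun x => c *: f x).
Proof.
by move=> gf; apply: good_eq (good_lin c gf good0) => x; rewrite addr0.
Qed.

Lemma goodD f g : good f -> good g -> good (fun x => f x + g x).
Proof.
by move=> gf gg; apply: good_eq (good_lin 1 gf gg) => x; rewrite scale1r.
Qed.

Lemma good_sum (I : Type) (s : seq I) (f : I -> lebRn R n -> 'cV[C]_d) :
  (forall i, good (f i)) -> good (fun x => \sum_(i <- s) f i x).
Proof.
move=> gf; elim: s => [|i s IH].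
  by apply: good_eq good0 => x; rewrite big_nil.
by apply: good_eq (goodD (gf i) IH) => x; rewrite big_cons.
Qed.

Lemma good_const v : good (fun=> v).
Proof.
have [_ h] := good_setT; apply: good_eq (h v) => x.
by rewrite /ind indicT scale1r.
Qed.

(** Rounding down to the multiples of [eta] writes the function, up to an error [eta],
    as a finite sum of indicators of its superlevel sets. *)
Lemma good_ge0_bounded (u : lebRn R n -> R) v (M : R) : measurable_fun setT u ->
  (forall x, 0 <= u x <= M) -> good (fun x => (u x)%:C *: v).
Proof.
move=> mu' uM.
have muv : mxmfun (fun x => (u x)%:C *: v).
  exact: (mxmfunZ (cmfun_real mu') (mxmfun_cst v)).
have vfin : (mass (fun=> v) < +oo)%E by exact: (mass_cst_fin v).
have vnum : mass (fun=> v) \is a fin_num.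
  by rewrite ge0_fin_numE //; exact: mass_ge0.
apply: (good_closed); first exact: muv.
  apply: (@le_lt_trans _ _ (mass (fun=> M%:C *: v))); last exact: (mass_cst_fin (M%:C *: v)).
  apply: (le_mass H) => [x|x _]; first exact.
  rewrite /wnorm -!scalemxAr !fnormZ !cabs2_real !sqrtr_sqr ler_wpM2r ?fnorm_ge0 //.
  by have /andP[u0 uM'] := uM x; rewrite !ger0_norm // (le_trans u0).
move=> e e0.
pose c := fine (mass (fun=> v)) + 1.
have c0 : 0 < c by rewrite ltr_wpDl // fine_ge0 // mass_ge0.
pose eta := (e / c) `^ p^-1.
have eta0 : 0 < eta by rewrite powR_gt0 // divr_gt0.
pose N := (Num.trunc (M / eta)).+1.
pose E l : set (lebRn R n) := [set x | l.+1%:R * eta <= u x].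
have mE l : measurable (E l).
  have -> : E l = u @^-1` `[l.+1%:R * eta, +oo[%classic.
    by apply/seteqP; split=> x /=; rewrite in_itv /= andbT.
  by rewrite -[X in measurable X]setTI; exact: mu'.
exists (fun x => \sum_(l < N) eta%:C *: ind (E l) v x).
  apply: good_sum => l; apply: goodZ.
  by have [_ h] := good_set_measurable (mE l); exact: h.
have sumE x : \sum_(l < N) eta%:C *: ind (E l) v x =
    (eta * (Num.trunc (u x / eta))%:R)%:C *: v.
  have cnt (t m : nat) : (\sum_(l < m) (l < t)%N = minn t m)%N.
    elim: m => [|m IH]; first by rewrite big_ord0 minn0.
    by rewrite big_ord_recr /= IH; lia.
  have /andP[u0 uM'] := uM x.
  have tN : (Num.trunc (u x / eta) <= N)%N.
    rewrite /N ltnW // ltnS; apply: le_truncn; rewrite ler_pM2r ?invr_gt0 //.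
  rewrite -(minn_idPl tN) -cnt natr_sum mulr_sumr rmorph_sum scaler_suml.
  apply: eq_bigr => l _; rewrite /ind scalerA rmorphM; congr (_ * _ *: _).
  congr (_%:C); rewrite indicE; congr ((nat_of_bool _)%:R).
  have q0 : 0 <= u x / eta by rewrite divr_ge0 // ltW.
  rewrite ltnNge -(ltnS (Num.trunc _)) truncn_lt_nat // -leNgt ler_pdivlMr //.
  by apply/idP/idP => [/set_mem|h]; [|apply/mem_set].
apply: (@le_trans _ _ (mass (fun=> eta%:C *: v))).
  apply: (le_mass H) => [x|x _]; first exact.
  rewrite /wnorm sumE -scalerBl -!scalemxAr -rmorphB !fnormZ !cabs2_real !sqrtr_sqr.
  rewrite ler_wpM2r ?fnorm_ge0 // (gtr0_norm eta0).
  have /andP[u0 uM'] := uM x.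
  have q0 : 0 <= u x / eta by rewrite divr_ge0 // ltW.
  have /andP[h1 h2] := truncn_itv q0; move: h1 h2; set t := (Num.trunc _).
  rewrite ler_pdivlMr // ltr_pdivrMr // -natr1 mulrDl mul1r [t%:R * eta]mulrC => h1 h2.
  by rewrite ger0_norm ?subr_ge0 //; lra.
have mcst : mxmfun ((fun=> v) : lebRn R n -> 'cV[C]_d) by exact: mxmfun_cst.
rewrite (massZ H _ mQ mcst) cabs2_real sqrtr_sqr (gtr0_norm eta0).
rewrite -(fineK vnum) -EFinM lee_fin /eta -powRrM mulVf ?gt_eqF // powRr1 ?(divr_ge0 (ltW e0) (ltW c0)) //.
rewrite -mulrA -[leRHS]mulr1 ler_pM2l // mulrC ler_pdivrMr // mul1r.
by rewrite /c lerDl.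
Qed.

Lemma good_bounded_scalar (u : lebRn R n -> R) v (M : R) : measurable_fun setT u ->
  (forall x, `|u x| <= M) -> good (fun x => (u x)%:C *: v).
Proof.
move=> mu' uM.
have h : good (fun x => (u x + M)%:C *: v).
  apply: (@good_ge0_bounded _ v (M + M)).
    by apply: measurable_funD => //; exact: measurable_cst.
  by move=> x; have := uM x; rewrite ler_norml => /andP[h1 h2]; apply/andP; split; lra.
apply: good_eq (goodD h (good_const ((- M)%:C *: v))) => x.
by rewrite -scalerDl -rmorphD addrK.
Qed.

Lemma good_bounded g (M : R) : mxmfun g -> (forall x, fnorm (g x) <= M) -> good g.
Proof.
move=> mg gM.
pose e (i : 'I_d) : 'cV[C]_d := delta_mx i ord0.
apply: (@good_eq (fun x => \sum_(i < d)
  ((complex.Re (g x i ord0))%:C *: e i + (complex.Im (g x i ord0))%:C *: ('i *: e i)))).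
  move=> x; apply/colP => l; rewrite summxE (bigD1 l) //= big1 ?addr0.
    rewrite !mxE !eqxx /= !mulr1; case: (g x l ord0) => u w /=.
    by apply/eqP; rewrite eq_complex ReD ImD !ReM !ImM /=; apply/andP; split; apply/eqP; ring.
  by move=> i il; rewrite !mxE eq_sym (negbTE il) /= !mulr0 addr0.
apply: good_sum => i; have [m1 m2] := mg i ord0; apply: goodD.
  by apply: (good_bounded_scalar _ m1) => x; apply: le_trans (gM x); exact: normRe_le_fnorm.
by apply: (good_bounded_scalar _ m2) => x; apply: le_trans (gM x); exact: normIm_le_fnorm.
Qed.

(** Truncation reduces to bounded functions. *)
Lemma good_all g : mxmfun g -> (mass g < +oo)%E -> good g.
Proof.
move=> mg fg; apply: (good_closed); [exact: mg|exact: fg|].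
pose E (m : nat) : set (lebRn R n) := [set x | fnorm (g x) <= m%:R].
have mE m : measurable (E m).
  have -> : E m = (fun x => fnorm (g x)) @^-1` `]-oo, m%:R]%classic.
    by apply/seteqP; split=> x /=; rewrite in_itv.
  by rewrite -[X in measurable X]setTI; exact: (measurable_fnorm mg).
pose t m x := (\1_(E m) x)%:C *: g x.
have mt m : mxmfun (t m).
  by apply: mxmfunZ mg; apply: cmfun_real; exact: measurable_indic.
have gt m : good (t m).
  apply: (@good_bounded _ m%:R (mt m)) => x; rewrite /t indicE.
  case: (boolP (x \in E m)) => [/set_mem xE|_]; first by rewrite scale1r.
  by rewrite scale0r fnorm0.
have r_le m x : wnorm p W (fun x => g x - t m x) x <= wnorm p W g x.
  rewrite /wnorm /t indicE; case: (x \in E m).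
    by rewrite scale1r subrr mulmx0 fnorm0 fnorm_ge0.
  by rewrite scale0r subr0.
have r_ev x : exists m0, forall m, (m0 <= m)%N -> g x - t m x = 0.
  exists (Num.trunc (fnorm (g x))).+1 => m hm; rewrite /t indicE mem_set ?scale1r ?subrr //.
  rewrite /E /=; apply/ltW; rewrite -truncn_lt_nat ?fnorm_ge0 //.
move=> e e0.
have [m hm] := mass_eventually H mQ (fun m => mxmfunB mg (mt m)) mg fg r_le r_ev e0.
by exists (t m); [exact: gt|exact: hm].
Qed.

Lemma mass_avg_cvg g : mxmfun g -> (mass g < +oo)%E -> forall e, 0 < e ->
  exists m0, forall m, (m0 <= m)%N ->
    (mass (fun x => g x - avg_fun (j + m%:Z) g x)%R <= e%:E)%E.
Proof. by move=> mg fg; have [] := good_all mg fg. Qed.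

End average_convergence.

(** * Weights of dyadic cubes *)

(** What the sums over cubes use of the weights. The reverse inequality, that weights
    grow geometrically along ancestors, follows from doubling. *)
Record dyadic_weights {R : realType} {n d : nat} (W : 'rV[R]_n -> 'M[R[i]]_d) (beta : R)
    (wt : int -> 'rV[int]_n -> R) : Prop := {
  wt_gt0 : forall j k, 0 < wt j k;
  wtE : forall j k, weight W (dyadic_cube j k) = (wt j k)%:E;
  wt_doubling : exists2 K : R, 0 < K & forall j m k,
    wt j (ancestor m k) <= K * 2 `^ (m%:R * beta) * wt (j + m%:Z) k;
  wt_reverse : exists c rho : R, [/\ 0 < c, 1 < rho & forall j m k,
    c * rho ^+ m * wt (j + m%:Z) k <= wt j (ancestor m k)] }.

Lemma normcE {R : realType} (z : R[i]) : Normc.normc z = Num.sqrt (cabs2 z).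
Proof. by case: z. Qed.

Section weights.
Context {R : realType} {n d : nat}.
Local Notation C := R[i].
Local Notation mu := (lebesgueRn R n).
Variables (p dt dtt : R) (W : lebRn R n -> 'M[C]_d).
Hypothesis H : admissible p dt W.
Hypothesis Wdual : 1 < p ->
  Ap_dimension (conj_exp p) (fun x => mxpow (W x) (- (p - 1)^-1)) dtt.
Hypothesis Wloc : forall i j, locally_integrable_c (fun x => W x i j).
Hypothesis n0 : (0 < n)%N.

Let beta := doubling_exp (n := n) p dtt.
Let wd := wdens p W.
Let cc : R := @cmp_const R d p.

Let p0 := adm_p0 H.

Lemma ancestorD m m' (k : 'rV[int]_n) : ancestor m (ancestor m' k) = ancestor (m + m') k.
Proof.
pose j : int := (0 + m%:Z) + m'%:Z; pose x : 'rV[R]_n := center j k.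
have xQ : dyadic_cube j k x.
  have s0 := side_gt0 (R := R) j.
  by move=> i; rewrite -/(side j) mxE ler_pM2l // ltr_pM2l //; apply/andP; split; lra.
move/dyadic_cubeP: xQ => ->; transitivity (cube_index 0 x).
  by rewrite /j !ancestor_index.
have -> : j = 0 + (m + m')%N%:Z by rewrite /j -addrA.
by rewrite ancestor_index.
Qed.

Let cc_gt0 : 0 < cc.
Proof.
rewrite /cc /cmp_const ltr_pwDl ?powR_ge0 // !mulr_gt0 ?powR_gt0 ?ltr0n ?(adm_d H) //.
by rewrite sqrtr_gt0 ltr0n (adm_d H).
Qed.

Let mwd : measurable_fun setT (fun x => (wd x)%:E).
Proof.
by apply/measurable_EFinP; exact: (measurable_wdens (adm_p H) (adm_nonneg H) (adm_meas H)).
Qed.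

Let wd0 x : (0 <= (wd x)%:E)%E. Proof. by rewrite lee_fin wdens_ge0. Qed.

Let wd_le x : wd x <= cc * fnorm (W x).
Proof. by rewrite /wd /wdens -mpowE; exact: (mxpow_le_fnorm (adm_nonneg H x) p0). Qed.

Let le_wd x : fnorm (W x) <= cc * wd x.
Proof. by rewrite /wd /wdens -mpowE; exact: (fnorm_le_mxpow (adm_nonneg H x) p0). Qed.

Let iw j k := (\int[mu]_(x in dyadic_cube j k) (wd x)%:E)%E.

Let iw_ge0 j k : (0 <= iw j k)%E.
Proof. by apply: integral_ge0 => x _; exact: wd0. Qed.

Lemma wdens_fin j k : (\int[mu]_(x in dyadic_cube j k) (wdens p W x)%:E < +oo)%E.
Proof.
have mQ : measurable (dyadic_cube j k : set (lebRn R n)) by exact: measurable_dyadic.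
pose h i l x := (Normc.normc (W x i l))%:E.
have mh i l : measurable_fun setT (h i l).
  have [m1 m2] := adm_meas H i l.
  apply/measurable_EFinP; under eq_fun do rewrite normcE.
  apply: (measurableT_comp (continuous_measurable_fun (@sqrt_continuous R))).
  by apply: measurable_funD; exact: measurable_funX.
have h0 i l x : (0 <= h i l x)%E by rewrite lee_fin normcE sqrtr_ge0.
have hfin i l : (\int[mu]_(x in dyadic_cube j k) h i l x < +oo)%E.
  have [_ loc] := Wloc i l; have [K cK QK] := @dyadic_cube_compact R n j k.
  apply: le_lt_trans (loc K cK).
  by apply: ge0_le_integral_any => [x _|x _|//|x _]; [exact: h0|exact: h0|].
have fW x : fnorm (W x) <= \sum_(il : 'I_d * 'I_d) Normc.normc (W x il.1 il.2).
  rewrite -(pair_bigA _ (fun i l => Normc.normc (W x i l))) /=.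
  have s0 : 0 <= \sum_i \sum_l Normc.normc (W x i l).
    by apply: sumr_ge0 => i _; apply: sumr_ge0 => l _; rewrite normcE sqrtr_ge0.
  rewrite fnormP //.
  have nn i l : 0 <= Normc.normc (W x i l) by rewrite normcE sqrtr_ge0.
  apply: (le_trans _ (sum_sqr_le _ (fun i => sumr_ge0 _ (fun l _ => nn i l)))).
  apply: ler_sum => i _; apply: (le_trans _ (sum_sqr_le _ (nn i))).
  by apply: ler_sum => l _; rewrite normc_sqr.
apply: (@le_lt_trans _ _ (\int[mu]_(x in dyadic_cube j k)
    (cc%:E * \sum_(il : 'I_d * 'I_d) h il.1 il.2 x))%E).
  apply: ge0_le_integral_any => [x _|x _|//|x _]; first exact: wd0.
    by apply: mule_ge0; [rewrite lee_fin ltW|apply: sume_ge0 => il _; exact: h0].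
  by rewrite sumEFin -EFinM lee_fin (le_trans (wd_le x)) // ler_wpM2l // ltW.
have msum : measurable_fun setT (fun x => \sum_(il : 'I_d * 'I_d) h il.1 il.2 x)%E.
  by apply: emeasurable_sum => il; exact: mh.
have hs0 x : (0 <= \sum_(il : 'I_d * 'I_d) h il.1 il.2 x)%E.
  by apply: sume_ge0 => il _; exact: h0.
rewrite -(ge0_integralMl mu mQ msum hs0 (ltW cc_gt0)).
apply: lte_mul_pinfty => //; first by rewrite lee_fin ltW.
rewrite (ge0_integral_sum mu mQ (fun il => measurable_funTS (mh il.1 il.2))
  (fun il x _ => h0 il.1 il.2 x)).
by apply: lte_sum_pinfty => il _; exact: hfin.
Qed.

Let iw_gt0 j k : (0 < iw j k)%E.
Proof.
have mQ : measurable (dyadic_cube j k : set (lebRn R n)) by exact: measurable_dyadic.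
rewrite lt0e iw_ge0 andbT; apply/eqP => iw0.
have : (\int[mu]_(x in dyadic_cube j k) `|(wd x)%:E| = 0)%E.
  rewrite -iw0; apply: eq_integral => x _; rewrite gee0_abs //; exact: wd0.
move/(ae_eq_integral_abs mu mQ (measurable_funTS mwd)) => h.
have h' : {ae mu, forall x, (dyadic_cube j k x -> (wd x)%:E = 0%E) /\ W x \in unitmx}.
  by apply: filterS2 h (adm_unit H) => x h1 h2; split => // /h1.
have [x Qx [w0 ux]] := ae_exists j k h'.
have := w0 Qx => -[] /eqP; rewrite powR_eq0 => /andP[/eqP /fnorm_eq0 A0 _].
have := mpow_mulN p^-1 (adm_nonneg H x) ux; rewrite A0 mul0mx.
move/matrixP/(_ (Ordinal (adm_d H)) (Ordinal (adm_d H))); rewrite !mxE eqxx => /eqP.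
by rewrite eq_sym oner_eq0.
Qed.

Let sd : 0 < Num.sqrt d%:R :> R.
Proof. by rewrite sqrtr_gt0 ltr0n (adm_d H). Qed.

Let weight_le j k : (weight W (dyadic_cube j k) <= cc%:E * iw j k)%E.
Proof.
rewrite (ge0_integralMl mu (measurable_dyadic j k) mwd wd0 (ltW cc_gt0)).
apply: ge0_le_integral_any => [x _|x _|//|x _].
- by rewrite lee_fin opnorm_ge0.
- by apply: mule_ge0; [rewrite lee_fin ltW|exact: wd0].
by rewrite -EFinM lee_fin (le_trans (opnorm_le_fnorm _)) // le_wd.
Qed.

Let le_weight j k : (((cc * Num.sqrt d%:R)^-1)%:E * iw j k <= weight W (dyadic_cube j k))%E.
Proof.
have c0 : 0 < cc * Num.sqrt d%:R by rewrite mulr_gt0.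
rewrite (ge0_integralMl mu (measurable_dyadic j k) mwd wd0); last by rewrite invr_ge0 ltW.
apply: ge0_le_integral_any => [x _|x _|//|x _].
- by apply: mule_ge0; [rewrite lee_fin invr_ge0 ltW|exact: wd0].
- by rewrite lee_fin opnorm_ge0.
rewrite -EFinM lee_fin ler_pdivrMl //.
apply: (le_trans (wd_le x)); rewrite -mulrA ler_wpM2l ?(ltW cc_gt0) //.
exact: fnorm_le_opnorm.
Qed.

Let iw_children j k : iw j k = (\sum_(e <- enum 'rV['I_(2 ^ 1)]_n)
  iw (j + 1) (@child n 1 k e))%E.
Proof.
rewrite /iw {1}(dyadic_cube_children j 1 k); apply: ge0_integral_bigsetU.
- by move=> e; exact: measurable_dyadic.
- exact: enum_uniq.
- move=> e e' _ _ [x [Qx Qx']].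
  exact: (@child_inj n 1 k _ _ (dyadic_cube_disj Qx Qx')).
- exact: measurable_funTS.
- by move=> x _; exact: wd0.
Qed.

Let iw_doubling : exists2 K : R, 0 < K & forall j m k,
  (iw j (ancestor m k) <= (K * 2 `^ (m%:R * beta))%:E * iw (j + m%:Z) k)%E.
Proof.
exact: (weight_doubling (adm_d H) (adm_p H) (adm_nonneg H) (adm_unit H) (adm_meas H)
  (adm_dim H) Wdual wdens_fin).
Qed.

Let fiw j k := fine (iw j k).
Let iwE j k : iw j k = (fiw j k)%:E.
Proof. by rewrite fineK // ge0_fin_numE // wdens_fin. Qed.
Let fiw_gt0 j k : 0 < fiw j k.
Proof. by rewrite -lte_fin -iwE; exact: iw_gt0. Qed.

(** A cube and a sibling of it have comparable weights, by doubling, and both lie in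
    their parent. *)
Let fiw_reverse1 : exists2 rho : R, 1 < rho & forall j k,
  rho * fiw (j + 1) k <= fiw j (ancestor 1 k).
Proof.
have [K K0 hK] := iw_doubling.
pose K' := K * 2 `^ (1%:R * beta); have K'0 : 0 < K' by rewrite mulr_gt0 ?powR_gt0.
exists (1 + K'^-1); first by rewrite ltrDl invr_gt0.
move=> j k; have [e ke] := @child_surj n 1 k.
pose e' : 'rV['I_(2 ^ 1)]_n := \row_i rev_ord (e ord0 i).
pose k' := @child n 1 (ancestor 1 k) e'.
have ee' : e != e'.
  apply/eqP => /rowP /(_ (Ordinal n0)); rewrite mxE => /(congr1 val) /=.
  by case: (e ord0 _) => -[|[|]].
have ak : ancestor 1 k' = ancestor 1 k by exact: ancestor_child.
have hsum : fiw (j + 1) k + fiw (j + 1) k' <= fiw j (ancestor 1 k).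
  rewrite -lee_fin EFinD -!iwE [X in (_ <= X)%E]iw_children (bigD1_seq e) ?mem_enum ?enum_uniq //=.
  rewrite -ke; apply: leeD => //.
  have -> : iw (j + 1) k' = (\sum_(i <- enum 'rV['I_(2 ^ 1)]_n | i == e')
      iw (j + 1) (child (ancestor 1 k) i))%E.
    by rewrite big_mkcond /= (bigD1_seq e') ?mem_enum ?enum_uniq //= eqxx big1 ?adde0 // => i /negbTE ->.
  rewrite [leLHS]big_mkcond [leRHS]big_mkcond; apply: lee_sum => i _.
  case: eqP => [->|_]; first by rewrite eq_sym ee'.
  by case: ifP => // _; exact: iw_ge0.
have hK' : fiw (j + 1) k <= K' * fiw (j + 1) k'.
  have h1 : fiw (j + 1) k <= fiw j (ancestor 1 k).
    by apply: le_trans hsum; rewrite lerDl ltW.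
  by apply: (le_trans h1); have := hK j 1%N k'; rewrite ak !iwE -EFinM lee_fin.
have : K'^-1 * fiw (j + 1) k <= fiw (j + 1) k' by rewrite ler_pdivrMl.
by rewrite mulrDl mul1r; lra.
Qed.

Let fiw_reverse : exists2 rho : R, 1 < rho & forall j m k,
  rho ^+ m * fiw (j + m%:Z) k <= fiw j (ancestor m k).
Proof.
have [rho rho1 hr] := fiw_reverse1; exists rho => // j m.
have rho0 : 0 < rho by exact: lt_trans ltr01 rho1.
elim: m => [|m IH] k; first by rewrite expr0 mul1r addr0 ancestor0.
have -> : j + m.+1%:Z = (j + m%:Z) + 1 by rewrite -addrA -PoszD addn1.
rewrite -addn1 -ancestorD exprD expr1 -mulrA.
apply: le_trans (IH _); rewrite ler_wpM2l ?exprn_ge0 ?(ltW rho0) //; exact: hr.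
Qed.

Lemma dyadic_weightsP : exists wt, dyadic_weights W beta wt.
Proof.
have c0 : 0 < cc * Num.sqrt d%:R by rewrite mulr_gt0.
pose wt j k := fine (weight W (dyadic_cube j k)).
have wE j k : weight W (dyadic_cube j k) = (wt j k)%:E.
  rewrite fineK // ge0_fin_numE.
    by apply: le_lt_trans (weight_le j k) _; rewrite iwE -EFinM ltry.
  by apply: integral_ge0 => x _; rewrite lee_fin opnorm_ge0.
have wt_le j k : wt j k <= cc * fiw j k.
  by rewrite -lee_fin EFinM -iwE -wE.
have le_wt j k : fiw j k <= cc * Num.sqrt d%:R * wt j k.
  by rewrite -ler_pdivrMl // -lee_fin EFinM -iwE -wE; exact: le_weight.
have wt0 j k : 0 < wt j k.
  by rewrite -(pmulr_rgt0 _ c0) (lt_le_trans (fiw_gt0 j k)).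
exists wt; split => //.
  have [K K0 hK] := iw_doubling.
  exists (cc * (K * (cc * Num.sqrt d%:R))); first by rewrite !mulr_gt0.
  move=> j m k; apply: (le_trans (wt_le _ _)).
  rewrite -!mulrA ler_wpM2l ?(ltW cc_gt0) //.
  have := hK j m k; rewrite !iwE -EFinM lee_fin => /le_trans; apply.
  apply: (@le_trans _ _ (K * 2 `^ (m%:R * beta) * (cc * Num.sqrt d%:R * wt (j + m%:Z) k))).
    by rewrite ler_wpM2l // mulr_ge0 ?powR_ge0 // ltW.
  by rewrite le_eqVlt; apply/orP; left; apply/eqP; ring.
have [rho rho1 hr] := fiw_reverse.
have rho0 : 0 < rho by exact: lt_trans ltr01 rho1.
exists ((cc * (cc * Num.sqrt d%:R))^-1), rho; split => //.
  by rewrite invr_gt0 mulr_gt0.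
move=> j m k; rewrite -mulrA ler_pdivrMl ?mulr_gt0 //.
apply: (@le_trans _ _ (rho ^+ m * (cc * fiw (j + m%:Z) k))).
  by rewrite ler_wpM2l ?exprn_ge0 ?(ltW rho0).
rewrite mulrCA -mulrA ler_wpM2l ?(ltW cc_gt0) //.
exact: le_trans (hr j m k) (le_wt _ _).
Qed.

End weights.

(** * Auxiliary facts on sums, powers and finite nets *)

Lemma int_leD (j J : int) : j <= J -> J = j + (absz (J - j)%R)%:Z.
Proof. lia. Qed.

Section dominated_sums.
Context {R : realType} {T : choiceType}.
Local Open Scope ereal_scope.

Lemma sum_eventually_le (s : seq T) (a : nat -> T -> \bar R) :
  (forall x (e : R), (0 < e)%R -> exists m0, forall m, (m0 <= m)%N -> a m x <= e%:E) ->
  forall e : R, (0 < e)%R -> exists m0, forall m, (m0 <= m)%N -> \sum_(x <- s) a m x <= e%:E.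
Proof.
move=> ha; elim: s => [|x s IH] e e0.
  by exists 0%N => m _; rewrite big_nil lee_fin ltW.
have e2 : (0 < e / 2)%R by rewrite divr_gt0.
have [m1 h1] := ha x _ e2; have [m2 h2] := IH _ e2.
exists (maxn m1 m2) => m; rewrite geq_max => /andP[/h1 {}h1 /h2 {}h2].
by rewrite big_cons (splitr e) EFinD leeD.
Qed.

(** Dominated convergence for sums: it is enough to control the tails. *)
Lemma esum_dominated (a : nat -> T -> \bar R) (b : T -> \bar R) (C : R) :
  (forall m x, 0 <= a m x) -> (forall x, 0 <= b x) -> \esum_(x in setT) b x < +oo ->
  (0 < C)%R ->
  (forall X, finite_set X -> exists m0, forall m, (m0 <= m)%N ->
    \esum_(x in ~` X) a m x <= C%:E * \esum_(x in ~` X) b x) ->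
  (forall x (e : R), (0 < e)%R -> exists m0, forall m, (m0 <= m)%N -> a m x <= e%:E) ->
  forall e : R, (0 < e)%R -> exists m0, forall m, (m0 <= m)%N ->
    \esum_(x in setT) a m x <= e%:E.
Proof.
move=> a0 b0 bfin C0 tail pw e e0.
have e1 : (0 < e / 2 / C)%R by rewrite !divr_gt0.
have [X finX hX] := esum_tail b0 bfin e1.
have [m1 h1] := tail X finX.
have e2 : (0 < e / 2)%R by rewrite divr_gt0.
have [s XE] := (@finite_seqP _ X).1 finX.
have [m2 h2] := sum_eventually_le (undup s) pw e2.
exists (maxn m1 m2) => m; rewrite geq_max => /andP[/h1 {}h1 /h2 {}h2].
rewrite (esumID X setT) // !setTI (splitr e) EFinD; apply: leeD.
  have -> : X = [set` undup s] by rewrite XE; apply/seteqP; split=> x /=; rewrite mem_undup.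
  have fins : finite_set [set` undup s] by apply/finite_seqP; exists (undup s).
  rewrite (esum_fset fins (fun x _ => a0 m x)).
  by rewrite -fsbig_seq ?undup_uniq.
apply: (le_trans h1).
apply: (@le_trans _ _ (C%:E * (e / 2 / C)%:E)).
  by apply: lee_wpmul2l; [rewrite lee_fin ltW|exact: hX].
by rewrite -EFinM lee_fin mulrC divfK // gt_eqF.
Qed.

End dominated_sums.

Lemma finite_levels (T : choiceType) (X : set (int * T)) : finite_set X ->
  exists m0 : nat, forall (m : nat) j k, (m0 <= m)%N -> X (j, k) -> j < m%:Z.
Proof.
move=> finX; have [s XE] := (@finite_seqP _ X).1 finX.
exists (\sum_(jk <- s) absz jk.1).+1 => m j k hm; rewrite XE /= => js.
have : (absz j <= \sum_(jk <- s) absz jk.1)%N by rewrite (big_rem (j, k)) //= leq_addr.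
by move: (\sum_(_ <- _) _)%N hm => N; lia.
Qed.

Lemma int_le_absz (j : int) (m0 m : nat) : (absz j + m0 <= m)%N ->
  j <= m%:Z /\ (m0 <= absz (m%:Z - j)%R)%N.
Proof. lia. Qed.

Lemma le_powR_neg {R : realType} (e x y : R) : e <= 0 -> 0 < x -> x <= y -> y `^ e <= x `^ e.
Proof.
move=> e0 x0 xy; have y0 := lt_le_trans x0 xy.
rewrite -[e]opprK (powRN y) (powRN x) lef_pV2 ?posrE ?powR_gt0 //.
by apply: ge0_ler_powR; rewrite ?oppr_ge0 ?nnegrE ?(ltW x0) ?(ltW y0).
Qed.

Lemma exprn_powR {R : realType} (x e : R) m : 0 <= x -> (x `^ e) ^+ m = (x ^+ m) `^ e.
Proof. by move=> x0; rewrite -(powR_mulrn m (powR_ge0 x e)) -(powR_mulrn m x0) -!powRrM mulrC. Qed.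

(** Tuples with the same rounded coordinates are close to each other, and there are
    finitely many roundings. *)
Lemma bounded_net {R : realType} (T : finType) (X : Type) (F : set X) (phi : X -> T -> R) (N delta : R) :
  0 < delta -> (forall f, F f -> forall i, `|phi f i| <= N) ->
  exists G : set X, [/\ finite_set G, G `<=` F &
    forall f, F f -> exists2 g, G g & forall i, `|phi f i - phi g i| <= delta].
Proof.
move=> d0 FN; pose M := Num.trunc ((N + N) / delta).
pose code f : {ffun T -> 'I_M.+1} := [ffun i => inord (Num.trunc ((phi f i + N) / delta))].
have codeE f i : F f -> code f i = Num.trunc ((phi f i + N) / delta) :> nat.
  move=> /FN /(_ i); rewrite ler_norml => /andP[h1 h2]; rewrite ffunE inordK // ltnS.
  by apply: le_truncn; rewrite ler_pM2r ?invr_gt0 // lerD2r.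
have close f g i : F f -> F g -> code f = code g -> `|phi f i - phi g i| <= delta.
  move=> Ff Fg fg; have := codeE g i Fg; rewrite -fg (codeE f i Ff) => e.
  have ge0 f' : F f' -> 0 <= (phi f' i + N) / delta.
    move=> /FN /(_ i); rewrite ler_norml => /andP[h1 _].
    by rewrite divr_ge0 ?(ltW d0) // -lerBlDr sub0r.
  have /andP[] := truncn_itv (ge0 f Ff); have /andP[] := truncn_itv (ge0 g Fg).
  rewrite e; move: (Num.trunc _) => k.
  rewrite !ler_pdivlMr // !ltr_pdivrMr // -natr1 mulrDl mul1r => h1 h2 h3 h4.
  by rewrite ler_norml; apply/andP; split; lra.
pose A c := F `&` [set f | code f = c].
have rep (c : {ffun T -> 'I_M.+1}) : exists S : set X, [/\ finite_set S, S `<=` A c & A c !=set0 -> S !=set0].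
  have [[f Acf]|nA] := pselect (A c !=set0); last by exists set0; split.
  by exists [set f]; split => [|_ ->//|_]; [exact: finite_set1|exists f].
have [S hS] := choice rep.
exists (\bigcup_c S c); split.
- by apply: bigcup_finite => [|c _]; [exact: finite_finset|have [] := hS c].
- by move=> f [c _ Scf]; have [_ /(_ _ Scf) []] := hS c.
move=> f Ff; have [_ sub ne] := hS (code f).
have [|g Sg] := ne; first by exists f.
by have [Fg cg] := sub _ Sg; exists g => [|i]; [exists (code f)|exact: close].
Qed.

Lemma finite_eventually (X : Type) (G : set X) (P : X -> nat -> Prop) : finite_set G ->
  (forall g, G g -> exists m0, forall m, (m0 <= m)%N -> P g m) ->
  exists m0, forall m, (m0 <= m)%N -> forall g, G g -> P g m.
Proof.
move=> finG hP.
have ex g : exists m0, G g -> forall m, (m0 <= m)%N -> P g m.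
  by have [/hP[m0 h]|nG] := pselect (G g); [exists m0|exists 0%N].
have [b hb] := choice ex.
have [s sE] := (@finite_seqP _ _).1 (finite_image b finG).
exists (\sum_(i <- s) i)%N => m hm g Gg; apply: hb => //; apply: leq_trans hm.
have bs : b g \in s by have : [set b x | x in G] (b g) by [exists g]; rewrite sE.
by rewrite (big_rem _ bs) /= leq_addr.
Qed.

(** * The power of the Bourgain-Morrey quasi-norm *)

Section total.
Context {R : realType} {n d : nat}.
Local Notation C := R[i].
Local Notation mu := (lebesgueRn R n).
Variables (p dt : R) (W : lebRn R n -> 'M[C]_d).
Hypothesis H : admissible p dt W.
Hypothesis wfin : forall j k,
  (\int[mu]_(x in dyadic_cube j k) (wdens p W x)%:E < +oo)%E.
Variables (beta : R) (wt : int -> 'rV[int]_n -> R).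
Hypothesis Hw : dyadic_weights W beta wt.
Variables (t r : R).
Hypothesis pt : p < t.
Hypothesis tr : t < r.
Local Open Scope complex_scope.
Implicit Types (f g h : lebRn R n -> 'cV[C]_d).
Local Notation cmass j k := (mass p W (dyadic_cube j k)).
Local Notation wn := (wnorm p W).
Local Notation ex := ((t^-1 - p^-1) * r).
Local Notation q := (r / p).

Let p0 := adm_p0 H.
Let t_gt0 : 0 < t := lt_trans p0 pt.
Let r0 : 0 < r := lt_trans t_gt0 tr.

Lemma q_gt0 : 0 < q. Proof. by rewrite divr_gt0. Qed.
Lemma ex_lt0 : ex < 0.
Proof. by rewrite pmulr_llt0 // subr_lt0 ltf_pV2. Qed.

Let q0 := q_gt0.
Let ex0 := ex_lt0.

(** The quasi-norm raised to the power [r] is a sum over the dyadic cubes. All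
    estimates are made on this sum, which needs only a triangle inequality up to a
    constant. *)
Definition term f (jk : int * 'rV[int]_n) : \bar R :=
  ((wt jk.1 jk.2 `^ ex)%:E * poweR (cmass jk.1 jk.2 f) q)%E.

Definition total_on (S : set (int * 'rV[int]_n)) f : \bar R := \esum_(jk in S) term f jk.

Local Notation total := (total_on setT).

Definition level f j : \bar R := \esum_(k in [set: 'rV[int]_n]) term f (j, k).

Lemma wtx_gt0 j k : 0 < wt j k `^ ex.
Proof. by rewrite powR_gt0 // (wt_gt0 Hw). Qed.

Lemma term_ge0 f jk : (0 <= term f jk)%E.
Proof. by apply: mule_ge0; [rewrite lee_fin ltW // wtx_gt0|exact: poweR_ge0]. Qed.

Lemma total_ge0 S f : (0 <= total_on S f)%E.
Proof. by apply: esum_ge0 => jk _; exact: term_ge0. Qed.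

Lemma level_ge0 f j : (0 <= level f j)%E.
Proof. by apply: esum_ge0 => k _; exact: term_ge0. Qed.

Lemma BM_normE f : BM_norm p t r W f = poweR (total f) r^-1.
Proof.
rewrite /BM_norm /total_on; congr poweR; apply: eq_esum => -[j k] _ /=.
have m0 := mass_ge0 p W (dyadic_cube j k) f.
rewrite Lp_massE (wtE Hw) poweR_EFin poweR_EFinM ?powR_ge0 ?poweR_ge0 // -powRrM /term.
by rewrite -poweRrM [p^-1 * r]mulrC.
Qed.

Lemma BM_norm_le f (e : R) : 0 <= e ->
  (BM_norm p t r W f <= e%:E)%E = (total f <= (e `^ r)%:E)%E.
Proof.
move=> e0; rewrite BM_normE; apply/idP/idP => h.
  have := le_poweR (ltW r0) (poweR_ge0 _ _) h.
  by rewrite poweR_EFin -poweRrM mulVf ?gt_eqF // poweRe1 ?total_ge0.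
have ri : 0 <= r^-1 by rewrite invr_ge0 ltW.
have := le_poweR ri (total_ge0 _ _) h.
by rewrite poweR_EFin -powRrM mulfV ?gt_eqF // powRr1.
Qed.

Lemma BM_norm_fin f : (BM_norm p t r W f < +oo)%E = (total f < +oo)%E.
Proof.
rewrite BM_normE; have := total_ge0 setT f; case: (total f) => [x| |] // x0.
  by rewrite poweR_EFin !ltry.
by rewrite poweRyr ?invr_eq0 ?gt_eqF.
Qed.

Lemma term_le f jk : (term f jk <= total f)%E.
Proof.
apply: (@le_trans _ _ (total_on [set jk] f)).
  by rewrite /total_on esum_set1 ?term_ge0.
by apply: esum_subset => // jk'; exact: term_ge0.
Qed.

Lemma mass_fin f j k : (total f < +oo)%E -> (cmass j k f < +oo)%E.
Proof.
move/(le_lt_trans (term_le f (j, k))); rewrite /term /=.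
have := mass_ge0 p W (dyadic_cube j k) f; case: (cmass j k f) => [x _ _||//]; first exact: ltry.
by move=> _; rewrite poweRyr ?gt_eqF // gt0_muley ?lte_fin ?wtx_gt0.
Qed.

Lemma mass_le_term f j k (M : R) : (term f (j, k) <= M%:E)%E ->
  (cmass j k f <= ((wt j k `^ (- ex) * M) `^ q^-1)%:E)%E.
Proof.
rewrite /term /= => h.
have h' : (poweR (cmass j k f) q <= (wt j k `^ (- ex) * M)%:E)%E.
  by rewrite powRN EFinM muleC lee_pdivlMr ?wtx_gt0 // muleC.
have qi : 0 <= q^-1 by rewrite invr_ge0 ltW.
have := le_poweR qi (poweR_ge0 _ _) h'.
by rewrite poweR_EFin -poweRrM mulfV ?gt_eqF // poweRe1 ?mass_ge0.
Qed.

Lemma le_term f g jk : (forall x, dyadic_cube jk.1 jk.2 x -> wn f x <= wn g x) ->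
  (term f jk <= term g jk)%E.
Proof.
move=> fg; apply: lee_wpmul2l; first by rewrite lee_fin ltW // wtx_gt0.
apply: le_poweR; [exact: ltW|exact: mass_ge0|].
by apply: (le_mass H) => [x|]; [exact|exact: fg].
Qed.

Lemma le_total S f g : (forall x, wn f x <= wn g x) -> (total_on S f <= total_on S g)%E.
Proof. by move=> fg; apply: le_esum => jk _; apply: le_term => x _; exact: fg. Qed.

Lemma totalN S f : total_on S (fun x => - f x) = total_on S f.
Proof. by rewrite /total_on; apply: eq_esum => jk _; rewrite /term massN. Qed.

Definition total_const : R := 2 `^ q * quasi_const p `^ q.

Lemma total_const_gt0 : 0 < total_const.
Proof. by rewrite mulr_gt0 ?powR_gt0 ?quasi_const_gt0. Qed.

Let A0 := total_const_gt0.

Lemma totalD S f g : mxmfun f -> mxmfun g ->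
  (total_on S (fun x => f x + g x)%R <= total_const%:E * (total_on S f + total_on S g))%E.
Proof.
move=> mf mg; have a0 := quasi_const_gt0 p.
rewrite /total_on -esumD; [|by move=> *; exact: term_ge0|by move=> *; exact: term_ge0].
apply: le_trans (esumZl_le _ (ltW total_const_gt0) _); last first.
  by move=> jk; apply: adde_ge0; exact: term_ge0.
apply: le_esum => -[j k] _; rewrite /term /=.
rewrite -muleDr; [|by []|by apply: ge0_adde_def; rewrite inE poweR_ge0].
rewrite muleCA; apply: lee_wpmul2l; first by rewrite lee_fin ltW // wtx_gt0.
have mQ : measurable (dyadic_cube j k : set (lebRn R n)) by exact: measurable_dyadic.
have m1 := mass_ge0 p W (dyadic_cube j k) f; have m2 := mass_ge0 p W (dyadic_cube j k) g.
apply: le_trans (le_poweR (ltW q0) (mass_ge0 _ _ _ _) (massD H mQ mf mg)) _.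
rewrite (poweR_EFinM q (ltW a0) (adde_ge0 m1 m2)).
have -> : total_const = quasi_const p `^ q * 2 `^ q by exact: mulrC.
have b0 : (0 <= (quasi_const p `^ q)%:E)%E by rewrite lee_fin; exact: powR_ge0.
apply: le_trans (lee_wpmul2l b0 (poweR_add_le q0 m1 m2)) _.
by rewrite [in X in (_ <= X)%E]EFinM muleA.
Qed.

Lemma totalB S f g : mxmfun f -> mxmfun g ->
  (total_on S (fun x => f x - g x)%R <= total_const%:E * (total_on S f + total_on S g))%E.
Proof. by move=> mf mg; rewrite -(totalN S g); exact: (totalD S mf (mxmfunN mg)). Qed.

Lemma eq_total S f g : (forall x, f x = g x) -> total_on S f = total_on S g.
Proof. by move=> /funext ->. Qed.

Lemma total_levels S f :
  \esum_(jk in [set jk : int * 'rV[int]_n | S jk.1]) term f jk = \esum_(j in S) level f j.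
Proof.
rewrite /level esum_esum; last by move=> *; exact: term_ge0.
rewrite (_ : S `*`` _ = [set jk | S jk.1]).
  by apply: eq_esum => -[].
by apply/seteqP; split=> [[j k] []|[j k] h].
Qed.

Lemma level_le f j S : (forall k, S (j, k)) -> (level f j <= total_on S f)%E.
Proof.
move=> Sj; have -> : level f j = \esum_(i in [set j]) level f i.
  by rewrite esum_set1 //; exact: level_ge0.
by rewrite -total_levels; apply: esum_subset => [jk|[i k] /= ->]; [exact: term_ge0|exact: Sj].
Qed.

(** * Averages act boundedly *)

Hypothesis decay : (dt - n%:R) * q - beta * ex + n%:R < 0.

Lemma term_avg_large : exists2 K : R, 0 < K & forall j m k f, mxmfun f ->
  (term (avg_fun (j + m%:Z)%R f) (j, k) <= K%:E * term f (j, k))%E.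
Proof.
have [K K0 hK] := mass_avg_large H; exists (K `^ q); first by rewrite powR_gt0.
move=> j m k f mf; rewrite /term /= muleCA; apply: lee_wpmul2l.
  by rewrite lee_fin ltW // (wtx_gt0).
apply: le_trans (le_poweR (ltW q0) (mass_ge0 _ _ _ _) (hK j m k f mf)) _.
by rewrite (poweR_EFinM q (ltW K0) (mass_ge0 _ _ _ _)).
Qed.

(** The three contributions to a sum over the [m]-th descendants: the mass, with
    exponent [dt - n] raised to the power [q]; the negative power [ex] of the weights,
    through doubling; and the number of the descendants, [2^(m n)]. *)
Definition decay_rate : R := 2 `^ ((dt - n%:R) * q - beta * ex + n%:R).

Lemma decay_rate_itv : 0 <= decay_rate < 1.
Proof.
rewrite powR_ge0 /= /decay_rate; set e := _ + n%:R.
have e1 : 1 `^ (- e) = 1 :> R by rewrite powR1.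
rewrite -[e]opprK powRN invf_lt1 ?powR_gt0 // -[ltLHS]e1.
by apply: gt0_ltr_powR; rewrite ?oppr_gt0 ?nnegrE ?ltr1n.
Qed.

Lemma wt_powR_doubling : exists2 K : R, 0 < K & forall j m k,
  wt (j + m%:Z) k `^ ex <= K * 2 `^ (m%:R * - (beta * ex)) * wt j (ancestor m k) `^ ex.
Proof.
have [K K0 hK] := wt_doubling Hw; exists (K `^ (- ex)); first by rewrite powR_gt0.
move=> j m k; have w0 := wt_gt0 Hw (j + m%:Z) k; have a0 := wt_gt0 Hw j (ancestor m k).
have e0 : 0 <= - ex by rewrite oppr_ge0 ltW.
have D0 : 0 < K * 2 `^ (m%:R * beta) by rewrite mulr_gt0 ?powR_gt0.
have : wt j (ancestor m k) `^ (- ex) <= ((K * 2 `^ (m%:R * beta)) * wt (j + m%:Z) k) `^ (- ex).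
  apply: ge0_ler_powR; rewrite ?nnegrE; [exact: e0|exact: ltW|exact: ltW (mulr_gt0 D0 w0)|].
  exact: hK.
rewrite powRM ?(ltW D0) ?(ltW w0) // powRM ?(ltW K0) ?powR_ge0 // -powRrM.
rewrite [wt j _ `^ _]powRN [wt (j + _) _ `^ _]powRN.
have -> : m%:R * beta * - ex = m%:R * - (beta * ex) by ring.
rewrite ler_pdivlMr ?powR_gt0 // mulrC ler_pdivrMr ?powR_gt0 //.
Qed.

(** Each cube of level [j + m] is compared with its ancestor of level [j] by
    [mass_avg_small] and [wt_powR_doubling]. *)
Lemma level_avg_small : exists2 K : R, 0 < K & forall j m f, mxmfun f ->
  (level (avg_fun j f) (j + m%:Z)%R <= (K * decay_rate ^+ m)%:E * level f j)%E.
Proof.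
have [K K0 hK] := mass_avg_small H; have [K' K'0 hK'] := wt_powR_doubling.
exists (K' * K `^ q); first by rewrite mulr_gt0 ?powR_gt0.
move=> j m f mf.
pose c := (K' * 2 `^ (m%:R * - (beta * ex))) * (K * 2 `^ (m%:R * (dt - n%:R))) `^ q.
have c0 : 0 <= c by rewrite !mulr_ge0 ?powR_ge0 ?(ltW K'0).
have step k : (term (avg_fun j f) ((j + m%:Z)%R, k) <= c%:E * term f (j, ancestor m k))%E.
  rewrite /term /=.
  have k0 : 0 <= K * 2 `^ (m%:R * (dt - n%:R)) by rewrite mulr_ge0 ?powR_ge0 ?(ltW K0).
  have h1 := le_poweR (ltW q0) (mass_ge0 _ _ _ _) (hK j m k f mf).
  rewrite (poweR_EFinM q k0 (mass_ge0 _ _ _ _)) in h1.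
  have h2 : ((wt (j + m%:Z) k `^ ex)%:E <= (K' * 2 `^ (m%:R * - (beta * ex)) *
    wt j (ancestor m k) `^ ex)%:E)%E by rewrite lee_fin; exact: hK'.
  have w0 : (0 <= (wt (j + m%:Z) k `^ ex)%:E)%E by rewrite lee_fin powR_ge0.
  apply: (le_trans (lee_pmul w0 (poweR_ge0 _ _) h2 h1)).
  by rewrite /c muleA -EFinM muleA -EFinM mulrAC.
rewrite /level; apply: (@le_trans _ _ (\esum_(k in [set: 'rV[int]_n])
    (c%:E * term f (j, ancestor m k)))%E).
  by apply: le_esum => k _; exact: step.
apply: (le_trans (esumZl_le _ c0 (fun k => term_ge0 f (j, ancestor m k)))).
rewrite (esum_ancestor m (fun k => term_ge0 f (j, k))) muleA -EFinM.
apply: lee_wpmul2r; first exact: (level_ge0).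
rewrite lee_fin le_eqVlt; apply/orP; left; apply/eqP.
have -> : ((2 ^ m) ^ n)%N%:R = 2 `^ (m%:R * n%:R) :> R.
  by rewrite powRrM powR_mulrn // powR_mulrn ?exprn_ge0 // !natrX.
have -> : decay_rate ^+ m = 2 `^ (m%:R * ((dt - n%:R) * q - beta * ex + n%:R)).
  by rewrite [m%:R * _]mulrC powRrM powR_mulrn ?powR_ge0.
rewrite /c powRM ?(ltW K0) ?powR_ge0 // -powRrM.
have -> : m%:R * ((dt - n%:R) * q - beta * ex + n%:R) =
  m%:R * - (beta * ex) + m%:R * (dt - n%:R) * q + m%:R * n%:R :> R by ring.
rewrite !powRD; [ring|..]; by rewrite ?implybT // pnatr_eq0 implybT.
Qed.

Lemma total_on_split S S' g :
  total_on S g = (total_on (S `&` S') g + total_on (S `&` ~` S') g)%E.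
Proof. by apply: (esumID S' S) => jk _; exact: (term_ge0). Qed.

(** Above the level [J] the terms of an average decay geometrically and are controlled by
    the level [J] alone. *)
Lemma total_above_avg : exists2 K : R, 0 < K & forall J f, mxmfun f ->
  (total_on [set jk : int * 'rV[int]_n | (J < jk.1)%R] (avg_fun J f) <= K%:E * level f J)%E.
Proof.
have [K K0 hK] := level_avg_small.
have [G G0 hG] := esum_geometric decay_rate_itv.
exists (K * G); first by rewrite mulr_gt0.
move=> J f mf; have th0 := decay_rate_itv; have l0 := level_ge0 f J.
rewrite /total_on (total_levels [set j | (J < j)%R]).
have [fin|->] : level f J \is a fin_num \/ level f J = +oo%E.
- by case: (level f J) l0 => [x _|_|//]; [left|right].
- have lf : 0 <= fine (level f J) by exact: fine_ge0.
  rewrite -(fineK fin) -EFinM.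
  pose a (j : int) : \bar R := ((K * fine (level f J))%:E * (decay_rate ^+ absz (j - J)%R)%:E)%E.
  have a0 j : (0 <= a j)%E.
    rewrite /a -EFinM lee_fin; apply: mulr_ge0; first by rewrite mulr_ge0 // ltW.
    by apply: exprn_ge0; case/andP: th0.
  apply: (@le_trans _ _ (\esum_(j in [set: int]) a j)).
    apply: (@le_trans _ _ (\esum_(j in [set j | (J < j)%R]) a j)%E); last by exact: esum_subset.
    apply: le_esum => j /= Jj.
    have jE := int_leD (ltW Jj); rewrite /a; move: jE; set m := absz _ => ->.
    apply: (le_trans (hK J m f mf)).
    by rewrite -[X in (_ * X <= _)%E](fineK fin) -!EFinM lee_fin mulrAC.
  have c0 : 0 <= K * fine (level f J) by rewrite mulr_ge0 // ltW.
  apply: (le_trans (esumZl_le _ c0 _)).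
    by move=> j; rewrite lee_fin exprn_ge0 //; case/andP: th0.
  apply: (le_trans (lee_wpmul2l _ (hG J))); first by rewrite lee_fin.
  by rewrite -EFinM lee_fin mulrAC.
- by rewrite gt0_muley ?leey // lte_fin mulr_gt0.
Qed.

(** Up to the level [J] the averages are controlled cube by cube. *)
Lemma total_on_avg : exists2 K : R, 0 < K & forall S J f, mxmfun f ->
  (total_on S (avg_fun J f) <= K%:E * (total_on S f + level f J))%E.
Proof.
have [K K0 hK] := term_avg_large; have [K' K'0 hK'] := total_above_avg.
exists (K + K'); first by rewrite addr_gt0.
move=> S J f mf.
have t0 g jk : (0 <= term g jk)%E by exact: (term_ge0).
have l0 : (0 <= level f J)%E by exact: (level_ge0).
have s0 : (0 <= total_on S f)%E by exact: (total_ge0).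
rewrite (total_on_split S [set jk : int * 'rV[int]_n | jk.1 <= J] (avg_fun J f)).
apply: (@le_trans _ _ (K%:E * total_on S f + K'%:E * level f J)%E); last first.
  have K1 : (0 <= K%:E)%E by rewrite lee_fin ltW.
  have K2 : (0 <= K'%:E)%E by rewrite lee_fin ltW.
  rewrite EFinD (ge0_muleDl _ K1 K2).
  by apply: leeD; apply: lee_wpmul2l; rewrite // ?leeDl ?leeDr.
apply: leeD.
  apply: (@le_trans _ _ (\esum_(jk in S `&` [set jk : int * 'rV[int]_n | (jk.1 <= J)%R]) (K%:E * term f jk))%E).
    by apply: le_esum => -[j k] [_ /= jJ]; rewrite (int_leD jJ); exact: hK.
  apply: (le_trans (esumZl_le _ (ltW K0) (t0 f))); apply: lee_wpmul2l; first by rewrite lee_fin ltW.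
  by apply: esum_subset => [jk|jk []//]; exact: t0.
apply: le_trans (hK' J f mf).
by apply: esum_subset => [jk|jk [_ /= /negP]]; [exact: t0|rewrite -ltNge].
Qed.

Lemma total_avg : exists2 K : R, 0 < K & forall J f, mxmfun f ->
  (total (avg_fun J f) <= K%:E * total f)%E.
Proof.
have [K K0 hK] := total_on_avg; exists (K * 2); first by rewrite mulr_gt0.
move=> J f mf; apply: (le_trans (hK setT J f mf)).
rewrite EFinM -muleA; apply: lee_wpmul2l; first by rewrite lee_fin ltW.
rewrite (_ : 2%:E = 1%:E + 1%:E)%E // ge0_muleDl ?lee_fin // mul1e; apply: leeD => //.
exact: (level_le).
Qed.

(** * Convergence in the Bourgain-Morrey space *)

Lemma term_small j k (e : R) : 0 < e -> exists2 e' : R, 0 < e' &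
  forall f, (cmass j k f <= e'%:E)%E -> (term f (j, k) <= e%:E)%E.
Proof.
move=> e0; have c0 := wtx_gt0 j k.
have ec : 0 < e / wt j k `^ ex by rewrite divr_gt0.
exists ((e / wt j k `^ ex) `^ q^-1); first by rewrite powR_gt0.
move=> f hf; rewrite /term /=.
have := le_poweR (ltW q0) (mass_ge0 _ _ _ _) hf.
rewrite poweR_EFin -powRrM mulVf ?gt_eqF // powRr1 ?(ltW ec) // => h.
have c0' : (0 <= (wt j k `^ ex)%:E)%E by rewrite lee_fin ltW.
apply: (le_trans (lee_wpmul2l c0' h)).
by rewrite -EFinM lee_fin mulrC divfK // gt_eqF.
Qed.

(** Finitely many cubes carry all but a small part of the sum, and on these the
    averages converge. On the other cubes [total_on_avg] applies: the levels of the
    finitely many cubes lie below [m], so that the whole level [m] belongs to the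
    tail. *)
Lemma total_avg_cvg f : mxmfun f -> (total f < +oo)%E -> forall e, 0 < e ->
  exists m0 : nat, forall m : nat, (m0 <= m)%N ->
    (total (fun x => f x - avg_fun m%:Z f x)%R <= e%:E)%E.
Proof.
move=> mf ff; have [K K0 hK] := total_on_avg.
have C0 : 0 < total_const * (1 + 2 * K) by rewrite mulr_gt0 // addr_gt0 // mulr_gt0.
apply: (esum_dominated (a := fun m => term (fun x => f x - avg_fun m%:Z f x)) (b := term f) _ _ ff C0).
- by move=> m x; exact: term_ge0.
- by move=> x; exact: term_ge0.
- move=> X finX.
  have [m0 hm0] := finite_levels finX.
  exists m0 => m m0m; set S := ~` X.
  have lT : (level f m%:Z <= total_on S f)%E.
    by apply: (level_le) => k Xk; have := hm0 m _ _ m0m Xk; rewrite ltxx.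
  have s0 : (0 <= total_on S f)%E by exact: (total_ge0).
  suff main : (total_on S (fun x => f x - avg_fun m%:Z f x)%R <=
      (total_const * (1 + 2 * K))%:E * total_on S f)%E by exact: main.
  apply: (le_trans (totalB S mf (mxmfun_avg _ _))).
  have A0' : (0 <= total_const%:E)%E by rewrite lee_fin ltW.
  have K0' : (0 <= K%:E)%E by rewrite lee_fin ltW.
  have -> : ((total_const * (1 + 2 * K))%:E * total_on S f =
     total_const%:E * (total_on S f + K%:E * (total_on S f + total_on S f)))%E.
    case: (total_on S f) s0 => [x x0|_|//]; first by rewrite -!(EFinM, EFinD); congr (_%:E); ring.
    by rewrite !gt0_muley ?lte_fin // ?addr_gt0 ?mulr_gt0 // addye // gt0_muley ?lte_fin.
  apply: (lee_wpmul2l A0'); apply: leeD; first exact: lexx.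
  apply: (le_trans (hK S m%:Z f mf)); apply: (lee_wpmul2l K0').
  by apply: leeD; [exact: lexx|exact: lT].
move=> [j k] e e0; have [e' e'0 he'] := term_small j k e0.
have fjk := mass_fin j k ff.
have [m1 h1] := mass_avg_cvg H wfin mf fjk e'0.
exists (absz j + m1)%N => m hm; apply: he'.
have [jm mj] := int_le_absz hm.
by rewrite (int_leD jm); exact: h1.
Qed.

Lemma wnorm_patch_le E f x : wn (patch (fun=> 0) E f) x <= wn f x.
Proof.
rewrite /wnorm /patch; case: ifP => // _.
by rewrite mulmx0 fnorm0 fnorm_ge0.
Qed.

Definition far (rho : R) f : lebRn R n -> 'cV[C]_d := patch (fun=> 0) (~` eball rho) f.

(** A cube misses the complement of every large enough ball. *)
Lemma total_far f : (total f < +oo)%E -> forall e, 0 < e ->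
  exists m0 : nat, forall m : nat, (m0 <= m)%N ->
    (total (far m%:R f) <= e%:E)%E.
Proof.
move=> ff.
apply: (esum_dominated (a := fun m => term (far m%:R f)) (b := term f) _ _ ff ltr01).
- by move=> m x; exact: term_ge0.
- by move=> x; exact: term_ge0.
- move=> X _; exists 0%N => m _; rewrite mul1e; apply: le_esum => jk _.
  by apply: (le_term) => x _; exact: wnorm_patch_le.
move=> [j k] e e0; have [e' e'0 he'] := term_small j k e0.
have [rho hrho] := @dyadic_cube_eball R n j k.
exists (Num.trunc rho).+1 => m hm; apply: he'.
have -> : cmass j k (far m%:R f) = cmass j k (fun=> 0).
  apply: (eq_mass H) => x Qx; rewrite /far patchN // notin_setE => /= h; apply: h.
  have := hrho x Qx; rewrite /eball /= => h; apply: (lt_le_trans h).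
  by rewrite ltW // (lt_le_trans (truncnS_gt _)) // ler_nat.
rewrite (_ : cmass j k (fun=> 0) = 0%E) ?lee_fin ?ltW //.
rewrite /mass integral0_eq // => x _.
by rewrite /wnorm mulmx0 fnorm0 powR0 // gt_eqF.
Qed.

(** * Dyadic step functions *)

(** A constant vector is controlled by its mass, as [W^(1/p)] is invertible almost
    everywhere. *)
Lemma mass_cst_ge j k : exists2 c : R, 0 < c & forall v,
  ((c * fnorm v `^ p)%:E <= cmass j k (fun=> v))%E.
Proof.
pose b x := fnorm (mpow (W x) (- p^-1)) `^ p.
have mb : measurable_fun setT (fun x => (b x)^-1%:E).
  apply/measurable_EFinP; under eq_fun do rewrite /b -powRN.
  apply: (measurableT_comp (measurable_powR (- p))); apply: measurable_fnorm.
  by apply: (mxmfun_mpow (adm_nonneg H) (adm_meas H)); rewrite oppr_eq0 invr_neq0 // gt_eqF.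
have mQ : measurable (dyadic_cube j k : set (lebRn R n)) by exact: measurable_dyadic.
set I := (\int[mu]_(x in dyadic_cube j k) (b x)^-1%:E)%E.
have b0 x : 0 <= (b x)^-1 by rewrite invr_ge0 powR_ge0.
have bE0 x : (0 <= (b x)^-1%:E)%E by rewrite lee_fin.
have bpos x : W x \in unitmx -> 0 < b x.
  move=> ux; rewrite powR_gt0 // lt_neqAle fnorm_ge0 andbT eq_sym.
  apply/eqP => /fnorm_eq0 z; have := mpow_mulN p^-1 (adm_nonneg H x) ux; rewrite z mulmx0.
  move/matrixP/(_ (Ordinal (adm_d H)) (Ordinal (adm_d H))); rewrite !mxE eqxx => /eqP.
  by rewrite eq_sym oner_eq0.
have I0 : (0 < I)%E.
  rewrite lt0e; apply/andP; split; last by apply: integral_ge0 => x _; exact: bE0.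
  apply/eqP => I0.
  have : (\int[mu]_(x in dyadic_cube j k) `|(b x)^-1%:E| = 0)%E.
    by rewrite -I0; apply: eq_integral => x _; rewrite gee0_abs.
  move/(ae_eq_integral_abs mu mQ (measurable_funTS mb)) => h.
  have h' : {ae mu, forall x, (dyadic_cube j k x -> (b x)^-1%:E = 0%E) /\ W x \in unitmx}.
    by apply: filterS2 h (adm_unit H) => x h1 h2; split => // /h1.
  have [x Qx [w0 ux]] := ae_exists j k h'.
  have := w0 Qx => -[] /eqP; rewrite invr_eq0 => /eqP bx.
  by have := bpos x ux; rewrite bx ltxx.
have main v : ((fnorm v `^ p)%:E * I <= cmass j k (fun=> v))%E.
  rewrite (ge0_integralMl mu mQ mb bE0 (powR_ge0 _ _)).
  apply: ae_ge0_le_integral_any; first exact: mQ.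
  - by apply: measurable_funTS; apply: measurable_funeM.
  - by apply: measurable_funTS; apply: (measurable_wnormp H); exact: mxmfun_cst.
  - by move=> x; rewrite -EFinM lee_fin mulr_ge0 ?powR_ge0.
  - by move=> x; rewrite lee_fin powR_ge0.
  apply: (ae_imp (adm_unit H)) => x ux _; rewrite -EFinM lee_fin.
  rewrite ler_pdivrMr ?bpos // /b -powRM ?fnorm_ge0 ?wnorm_ge0 //.
  apply: ge0_ler_powR; rewrite ?nnegrE ?mulr_ge0 ?fnorm_ge0 ?(ltW p0) //.
  rewrite mulrC; apply: le_trans (fnormM _ _).
  rewrite /wnorm mulmxA.
  have -> : mpow (W x) (- p^-1) *m mpow (W x) p^-1 = 1%:M.
    by have := mpow_mulN (- p^-1) (adm_nonneg H x) ux; rewrite opprK.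
  by rewrite mul1mx.
(* If [I] is infinite, then so is the mass of every nonzero vector. *)
case E : I => [i| |].
- exists i; first by rewrite -lte_fin -E.
  by move=> v; have := main v; rewrite E -EFinM mulrC.
- exists 1 => // v; have [->|v0] := eqVneq v 0.
    by rewrite fnorm0 powR0 ?gt_eqF // mulr0; exact: mass_ge0.
  have fv : 0 < fnorm v `^ p.
    rewrite powR_gt0 // lt_neqAle fnorm_ge0 andbT eq_sym.
    by apply/eqP => /fnorm_eq0 /eqP; rewrite (negbTE v0).
  have := main v; rewrite E gt0_muley ?lte_fin // leye_eq => /eqP ->.
  exact: leey.
- by move: I0; rewrite E.
Qed.

Lemma mass0 j k : cmass j k (fun=> 0) = 0%E.
Proof.
rewrite /mass integral0_eq // => x _.
by rewrite /wnorm mulmx0 fnorm0 powR0 // gt_eqF.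
Qed.

Lemma mass_ind_le J k v j k' : (cmass j k' (ind (dyadic_cube J k) v) <=
  (fnorm v `^ p)%:E * \int[mu]_(x in dyadic_cube J k) (wdens p W x)%:E)%E.
Proof.
have mw : measurable_fun setT (fun x => (wdens p W x)%:E).
  by apply/measurable_EFinP; exact: (measurable_wdens (adm_p H) (adm_nonneg H) (adm_meas H)).
have mQ : measurable (dyadic_cube J k : set (lebRn R n)) by exact: measurable_dyadic.
rewrite (ge0_integralMl mu mQ mw); [|by move=> x; rewrite lee_fin wdens_ge0|exact: powR_ge0].
rewrite [leRHS]integral_mkcond.
have F0 x : (0 <= (fnorm v `^ p)%:E * (wdens p W x)%:E)%E.
  by apply: mule_ge0; rewrite lee_fin ?powR_ge0 ?wdens_ge0.
apply: ge0_le_integral_any => [x _|x _|//|x _].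
- by rewrite lee_fin powR_ge0.
- by apply: erestrict_ge0 => y _; exact: F0.
rewrite patchE.
case: (boolP (x \in dyadic_cube J k)) => [/set_mem Jx|Jx].
  rewrite -EFinM lee_fin /wdens -powRM ?fnorm_ge0 //.
  apply: ge0_ler_powR; rewrite ?nnegrE ?wnorm_ge0 ?(ltW p0) ?mulr_ge0 ?fnorm_ge0 //.
  rewrite mulrC; apply: (@le_trans _ _ (wn (fun=> v) x)); last exact: fnormM.
  exact: wnorm_ind_le.
rewrite /wnorm /ind indicE (negbTE Jx) scale0r mulmx0 fnorm0 powR0 //.
by rewrite gt_eqF.
Qed.

(** Below its level the indicator of a cube meets one cube per level, and the weights of
    these cubes grow geometrically; above its level it is its own average. *)
Lemma total_ind J k : exists2 B : R, 0 < B & forall v,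
  (total (ind (dyadic_cube J k) v) <= (B * fnorm v `^ r)%:E)%E.
Proof.
set w := (\int[mu]_(x in dyadic_cube J k) (wdens p W x)%:E)%E.
have w0 : (0 <= w)%E by apply: integral_ge0 => x _; rewrite lee_fin wdens_ge0.
have wE : w = (fine w)%:E by rewrite fineK // ge0_fin_numE //; exact: wfin.
have fw0 : 0 <= fine w by exact: fine_ge0.
have [K K0 hK] := total_above_avg.
have [c [rho [c0 rho1 hrho]]] := wt_reverse Hw.
have rho0 : 0 < rho by exact: lt_trans ltr01 rho1.
have th : 0 <= rho `^ ex < 1.
  rewrite powR_ge0 /= -[ex]opprK powRN invf_lt1 ?powR_gt0 //.
  have e1 : 1 `^ (- ex) = 1 :> R by rewrite powR1.
  by rewrite -[ltLHS]e1; apply: gt0_ltr_powR; rewrite ?oppr_gt0 ?nnegrE // ltW.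
have [G G0 hG] := esum_geometric th.
pose a := wt J k `^ ex; have a0 : 0 < a by exact: (wtx_gt0).
pose B := (c * wt J k) `^ ex * fine w `^ q.
pose B' := a * fine w `^ q.
have B0 : 0 <= B by rewrite mulr_ge0 // powR_ge0.
have B'0 : 0 <= B' by rewrite mulr_ge0 ?powR_ge0 // ltW.
exists (1 + (B * G + (1 + K) * B')).
  by rewrite ltr_pwDl // addr_ge0 // mulr_ge0 // ?addr_ge0 // ltW.
move=> v; set g := ind _ v; have mg : mxmfun g by apply: mxmfun_ind; exact: measurable_dyadic.
have pq : p * q = r by rewrite mulrC divfK // gt_eqF.
have termg j k' : (term g (j, k') <= (wt j k' `^ ex * (fine w `^ q * fnorm v `^ r))%:E)%E.
  rewrite /term /= EFinM; apply: lee_wpmul2l; first by rewrite lee_fin powR_ge0.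
  have := le_poweR (ltW q0) (mass_ge0 _ _ _ _) (mass_ind_le J k v j k').
  rewrite -/w wE -EFinM poweR_EFin powRM ?powR_ge0 // -powRrM pq [X in (X%:E)%E]mulrC; exact.
have far_anc j m k' : J = j + m%:Z -> k' <> ancestor m k -> term g (j, k') = 0%E.
  move=> JE kk'; rewrite /term /=.
  have -> : cmass j k' g = cmass j k' (fun=> 0).
    apply: (eq_mass H) => x Qx; rewrite /g /ind indicE memNset ?scale0r // => JQ.
    by apply: kk'; apply: (dyadic_cube_disj Qx); apply: dyadic_cube_ancestor; rewrite -JE.
  by rewrite mass0 poweR0r ?mule0 // gt_eqF.
have level_anc j m : J = j + m%:Z -> (level g j <= term g (j, ancestor m k))%E.
  move=> JE; rewrite /level (esumID [set ancestor m k] setT _ (fun k' _ => term_ge0 g (j, k'))).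
  rewrite !setTI esum_set1 ?term_ge0 // esum1 ?adde0 // => k' /= kk'.
  exact: far_anc JE kk'.
have X0 : 0 <= fine w `^ q * fnorm v `^ r by rewrite mulr_ge0 ?powR_ge0.
have up : (total_on [set jk : int * 'rV[int]_n | (J < jk.1)%R] g <=
    (K * (a * (fine w `^ q * fnorm v `^ r)))%:E)%E.
  have gE : avg_fun J g = g.
    apply/funext => x; apply: avgv_eq => y /dyadic_cubeP yx; rewrite /g /ind !indicE.
    congr ((nat_of_bool _)%:R%:C *: v).
    by apply/idP/idP => /set_mem /dyadic_cubeP h; apply/mem_set/dyadic_cubeP; rewrite h yx.
  have := hK J g mg; rewrite gE => /le_trans; apply; rewrite EFinM.
  apply: lee_wpmul2l; first by rewrite lee_fin ltW.
  have J0 : J = J + 0%N%:Z by rewrite addr0.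
  apply: (le_trans (level_anc J 0%N J0)); rewrite ancestor0; exact: termg.
have down : (total_on [set jk : int * 'rV[int]_n | (jk.1 <= J)%R] g <=
    (B * fnorm v `^ r * G)%:E)%E.
  rewrite /total_on (total_levels [set j | (j <= J)%R]).
  pose b (j : int) : \bar R := ((B * fnorm v `^ r)%:E * ((rho `^ ex) ^+ absz (j - J)%R)%:E)%E.
  have Bv : 0 <= B * fnorm v `^ r by rewrite mulr_ge0 ?powR_ge0.
  have pow0 (j : int) : (0 <= ((rho `^ ex) ^+ absz (j - J)%R)%:E)%E.
    by rewrite lee_fin exprn_ge0 ?powR_ge0.
  have b0 j : (0 <= b j)%E by apply: mule_ge0; [rewrite lee_fin|exact: pow0].
  apply: (@le_trans _ _ (\esum_(j in [set: int]) b j)).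
    apply: (@le_trans _ _ (\esum_(j in [set j | (j <= J)%R]) b j)%E); last by exact: esum_subset.
    apply: le_esum => j /= jJ; rewrite /b distnC.
    have jE := int_leD jJ; move: jE; set m := absz _ => jE.
    apply: (le_trans (level_anc j m jE)); apply: (le_trans (termg _ _)).
    rewrite -EFinM lee_fin /B -!mulrA [leRHS]mulrC [X in _ <= X]mulrC.
    have h := hrho j m k; rewrite -jE in h.
    have e0 : 0 < c * rho ^+ m * wt J k.
      by rewrite !mulr_gt0 ?exprn_gt0 // (wt_gt0 Hw).
    have h' := le_powR_neg (ltW ex0) e0 h.
    have -> : (c * wt J k) `^ ex * (fine w `^ q * (fnorm v `^ r * (rho `^ ex) ^+ m)) =
        (c * rho ^+ m * wt J k) `^ ex * (fine w `^ q * fnorm v `^ r).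
      have w0' := ltW (wt_gt0 Hw J k); have r0' := ltW rho0; have c0' := ltW c0.
      have rm0 : 0 <= rho ^+ m by exact: exprn_ge0.
      have cr0 : 0 <= c * rho ^+ m by exact: mulr_ge0.
      rewrite (powRM _ cr0 w0') (powRM _ c0' rm0) (powRM _ c0' w0').
      have -> : (rho `^ ex) ^+ m = (rho ^+ m) `^ ex.
        exact: exprn_powR.
      by ring.
    by apply: ler_wpM2r.
  apply: (le_trans (esumZl_le _ Bv pow0)).
  apply: (le_trans (lee_wpmul2l _ (hG J))); first by rewrite lee_fin.
  by rewrite -EFinM lee_fin.
rewrite (total_on_split setT [set jk : int * 'rV[int]_n | (jk.1 <= J)%R] g) !setTI.
have up' : (total_on (~` [set jk : int * 'rV[int]_n | (jk.1 <= J)%R]) g <=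
    (K * (a * (fine w `^ q * fnorm v `^ r)))%:E)%E.
  apply: le_trans up; apply: esum_subset => [jk|jk /= /negP]; first exact: term_ge0.
  by rewrite -ltNge.
apply: (le_trans (leeD down up')); rewrite -EFinD lee_fin /B'.
have : 0 <= fnorm v `^ r by exact: powR_ge0.
have : 0 <= a * fine w `^ q by exact: B'0.
move=> aQ0 V0; rewrite -subr_ge0.
have -> : forall b V, (1 + (b * G + (1 + K) * (a * fine w `^ q))) * V -
    (b * V * G + K * (a * (fine w `^ q * V))) = (1 + a * fine w `^ q) * V by move=> *; ring.
by rewrite mulr_ge0 // addr_ge0.
Qed.

(** * The sufficiency of the conditions *)

Definition step_fun J (s : seq 'rV[int]_n) (v : 'rV[int]_n -> 'cV[C]_d) :
  lebRn R n -> 'cV[C]_d := fun x => \sum_(k <- s) ind (dyadic_cube J k) (v k) x.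

Lemma mxmfun_step J s v : mxmfun (step_fun J s v).
Proof.
elim: s => [|k s IH].
  rewrite (_ : step_fun J [::] v = fun=> 0); first exact: mxmfun_cst.
  by apply/funext => x; rewrite /step_fun big_nil.
rewrite (_ : step_fun J (k :: s) v = fun x => ind (dyadic_cube J k) (v k) x + step_fun J s v x).
  by apply: mxmfunD IH; apply: mxmfun_ind; exact: measurable_dyadic.
by apply/funext => x; rewrite /step_fun big_cons.
Qed.

(** Induction on [s] with the quasi-triangle inequality; the constant depends on [s]
    only. *)
Lemma total_step J s : exists2 B : R, 0 < B & forall v (delta : R), 0 <= delta ->
  (forall k, k \in s -> fnorm (v k) <= delta) ->
  (total (step_fun J s v) <= (B * delta `^ r)%:E)%E.
Proof.
elim: s => [|k s [B B0 hB]].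
  exists 1 => // v delta d0 _; rewrite mul1r.
  apply: (@le_trans _ _ 0%E); last by rewrite lee_fin powR_ge0.
  rewrite /total_on esum1 // => -[j k] _; rewrite /term /=.
  rewrite (_ : step_fun J [::] v = fun=> 0); last by apply/funext => x; rewrite /step_fun big_nil.
  by rewrite (mass0) poweR0r ?mule0 // gt_eqF.
have [B' B'0 hB'] := total_ind J k.
exists (total_const * (B' + B)); first by rewrite mulr_gt0 // addr_gt0.
move=> v delta d0 vd.
rewrite (_ : step_fun J (k :: s) v = fun x => ind (dyadic_cube J k) (v k) x + step_fun J s v x); last first.
  by apply/funext => x; rewrite /step_fun big_cons.
have mi : mxmfun (ind (dyadic_cube J k) (v k)) by apply: mxmfun_ind; exact: measurable_dyadic.
apply: (le_trans (totalD setT mi (mxmfun_step J s v))).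
rewrite -mulrA (EFinM total_const); apply: lee_wpmul2l; first by rewrite lee_fin ltW.
rewrite mulrDl EFinD; apply: leeD; last first.
  by apply: hB => // k' ks; apply: vd; rewrite inE ks orbT.
apply: (le_trans (hB' (v k))); rewrite lee_fin ler_wpM2l ?(ltW B'0) //.
apply: ge0_ler_powR; rewrite ?nnegrE ?(ltW r0) ?fnorm_ge0 //.
by apply: vd; rewrite inE eqxx.
Qed.

Lemma avgv_congr j k f g : (forall x, dyadic_cube j k x -> f x = g x) ->
  avgv j k f = avgv j k g.
Proof.
move=> fg; rewrite /avgv; congr (_ *: _); apply/colP => i; rewrite !mxE /cintegral.
by congr (_ +i* _); apply: eq_Rintegral => x /set_mem Qx; rewrite fg.
Qed.

(** The mass of the average on the cube is controlled by the mass of [f], and the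
    vector by the mass of the constant function. *)
Lemma avgv_bounded j k (M : R) : 0 <= M -> exists N : R, forall f, mxmfun f ->
  (total f <= M%:E)%E -> fnorm (avgv j k f) <= N.
Proof.
move=> M0; have [c c0 hc] := mass_cst_ge j k; have [K K0 hK] := mass_avg_large H.
pose m := (wt j k `^ (- ex) * M) `^ q^-1.
exists ((K * m / c) `^ p^-1) => f mf fM.
have tf := le_trans (term_le f (j, k)) fM.
have mM := mass_le_term tf.
have h1 : (cmass j k (fun=> avgv j k f) <= K%:E * cmass j k f)%E.
  have <- : cmass j k (avg_fun j f) = cmass j k (fun=> avgv j k f).
    by apply: (eq_mass H) => x Qx; exact: avg_funE.
  by have := hK j 0%N k f mf; rewrite addr0; apply.
have h2 : c * fnorm (avgv j k f) `^ p <= K * m.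
  rewrite -lee_fin; apply: (le_trans (hc _)); apply: (le_trans h1).
  by rewrite EFinM; apply: lee_wpmul2l; [rewrite lee_fin ltW|exact: mM].
have h3 : fnorm (avgv j k f) `^ p <= K * m / c by rewrite ler_pdivlMr // mulrC.
have pi : 0 <= p^-1 by rewrite invr_ge0 ltW.
have := ge0_ler_powR pi _ _ h3; rewrite -powRrM mulfV ?gt_eqF // powRr1 ?fnorm_ge0 //.
by apply; rewrite nnegrE ?powR_ge0 // (le_trans (powR_ge0 _ _) h3).
Qed.

Lemma step_funB J s v w x : step_fun J s v x - step_fun J s w x =
  step_fun J s (fun k => v k - w k) x.
Proof. by rewrite /step_fun -sumrB; apply: eq_bigr => k _; rewrite /ind scalerBr. Qed.

Lemma step_fun_index J s v x : uniq s ->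
  step_fun J s v x = if cube_index J x \in s then v (cube_index J x) else 0.
Proof.
move=> us; have ind0 k : k != cube_index J x -> ind (dyadic_cube J k) (v k) x = 0.
  move=> /eqP kx; rewrite /ind indicE memNset ?scale0r //.
  by move/dyadic_cubeP.
case: ifPn => xs; last first.
  rewrite /step_fun big_seq big1 // => k ks; apply: ind0.
  by apply: contraNneq xs => <-.
rewrite /step_fun (bigD1_seq _ xs us) /= big1 ?addr0 => [|k /ind0 //].
by rewrite /ind indicE mem_set ?scale1r //; exact: cube_indexP.
Qed.

(** Outside the cubes of [s] the function is far from the origin; on these cubes the step
    function is its average. *)
Lemma total_sub_step : exists2 K : R, 0 < K & forall J s (rho : R) f, uniq s -> mxmfun f ->
  (forall x : 'rV[R]_n, eball rho x -> cube_index J x \in s) ->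
  (total (fun x => f x - step_fun J s (fun k => avgv J k f) x)%R <=
   K%:E * (total (fun x => f x - avg_fun J f x)%R + total (far rho f)))%E.
Proof.
have [K K0 hK] := total_avg.
exists (total_const * (1 + K)); first by rewrite mulr_gt0 // addr_gt0.
move=> J s rho f us mf xs.
pose U : set (lebRn R n) := [set x | cube_index J (x : 'rV[R]_n) \in s].
have mU : measurable U.
  have -> : U = \big[setU/set0]_(k <- s) (dyadic_cube J k : set (lebRn R n)).
    rewrite -bigcup_seq; apply/seteqP; split=> x /=.
      by move=> xU; exists (cube_index J x) => //; exact: cube_indexP.
    by move=> [k ks /dyadic_cubeP kx]; rewrite /U /= -kx.
  by apply: bigsetU_measurable => k _; exact: measurable_dyadic.
pose g : lebRn R n -> 'cV[C]_d := fun x => (\1_(~` U) x)%:C *: f x.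
have mg : mxmfun g.
  by apply: mxmfunZ mf; apply: cmfun_real; apply: measurable_indic; exact: measurableC.
have gU x : U x -> g x = 0 by move=> Ux; rewrite /g indicE memNset ?scale0r // => /(_ Ux).
have gN x : ~ U x -> g x = f x by move=> Ux; rewrite /g indicE mem_set ?scale1r.
have sameU x y : dyadic_cube J (cube_index J x) y -> U y <-> U x.
  by move=> /dyadic_cubeP yx; rewrite /U /= yx.
have -> : total (fun x => f x - step_fun J s (fun k => avgv J k f) x) =
    total (fun x => (f x - avg_fun J f x) + avg_fun J g x).
  apply: eq_total => x; rewrite -addrA; congr (_ + _); rewrite (step_fun_index _ _ _ us).
  rewrite /avg_fun; have [Ux|Ux] := pselect (U x).
    rewrite ifT //; rewrite (@avgv_eq _ _ _ _ _ g 0) ?addr0 // => y /sameU yx.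
    by apply: gU; apply/yx.
  rewrite ifN; last by apply/negP.
  rewrite oppr0 (@avgv_congr J (cube_index J x) g f) ?addNr // => y /sameU yx.
  by apply: gN => /yx.
apply: (le_trans (totalD setT (mxmfunB mf (mxmfun_avg _ _)) (mxmfun_avg J g))).
rewrite (EFinM total_const) -muleA; apply: lee_wpmul2l; first by rewrite lee_fin ltW.
set a := total _; set b := total (far rho f).
have a0 : (0 <= a)%E by exact: (total_ge0).
have b0 : (0 <= b)%E by exact: (total_ge0).
have gb : (total g <= b)%E.
  apply: (le_total) => x; rewrite /wnorm.
  have [Ux|Ux] := pselect (U x); first by rewrite gU // mulmx0 fnorm0 fnorm_ge0.
  by rewrite gN // /far patchT // inE => /xs.
move: a b a0 b0 gb => a b a0 b0 gb.
have K0' : (0 <= K%:E)%E by rewrite lee_fin ltW.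
have ab0 : (0 <= a + b)%E by exact: (adde_ge0 a0 b0).
rewrite EFinD (ge0_muleDl _ lee01 K0') mul1e; apply: leeD; first by rewrite leeDl.
have gab : (total g <= a + b)%E by apply: (le_trans gb); rewrite leeDr.
exact: (le_trans (hK J g mg) (lee_wpmul2l K0' gab)).
Qed.

(** Every member of the family is close to a step function on finitely many fixed
    cubes. The values of these step functions are bounded vectors, and two members
    whose values are close on each cube are close in the quasi-norm: a net for the
    values gives a net for the family. *)
Lemma totally_bounded_criterion (F : set (lebRn R n -> 'cV[C]_d)) (M : R) :
  (forall f, F f -> mxmfun f) -> 0 <= M -> (forall f, F f -> (total f <= M%:E)%E) ->
  (forall e : R, 0 < e -> exists rho : R, forall f, F f -> (total (far rho f) <= e%:E)%E) ->
  (forall e : R, 0 < e -> exists J, forall f, F f ->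
    (total (fun x => f x - avg_fun J f x)%R <= e%:E)%E) ->
  forall e : R, 0 < e -> exists G, [/\ finite_set G, G `<=` F &
    forall f, F f -> exists2 g, G g & (total (fun x => f x - g x)%R <= e%:E)%E].
Proof.
move=> mF M0 FM far0 avg0 e e0; have [K K0 hK] := total_sub_step.
set A := total_const in hK *.
(* [f - g] is split into three parts of size [tau], at the cost of two quasi-triangle
   inequalities. *)
pose tau := e / (A * (1 + 2 * A)).
have A1 : 0 < A * (1 + 2 * A) by rewrite mulr_gt0 // addr_gt0 // mulr_gt0.
have tau0 : 0 < tau by rewrite divr_gt0.
have eta0 : 0 < tau / (2 * K) by rewrite divr_gt0 // mulr_gt0.
have [J hJ] := avg0 _ eta0; have [rho hrho] := far0 _ eta0.
have [s [us hs]] := finite_box_cover (R := R) J rho (n := n).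
have xs (x : 'rV[R]_n) : eball rho x -> cube_index J x \in s.
  by move=> xr; have [|k ks /dyadic_cubeP <-//] := hs x => i; exact: eball_box.
have hstep f : F f ->
    (total (fun x => f x - step_fun J s (fun k => avgv J k f) x)%R <= tau%:E)%E.
  move=> Ff; apply: (le_trans (hK J s rho f us (mF f Ff) xs)).
  have K0' : (0 <= K%:E)%E by rewrite lee_fin ltW.
  apply: (le_trans (lee_wpmul2l K0' (leeD (hJ f Ff) (hrho f Ff)))).
  rewrite -EFinD -EFinM lee_fin.
  have -> : forall u, K * (u + u) = u * (2 * K) by move=> u; ring.
  by rewrite divfK // gt_eqF // mulr_gt0.
have [B B0 hB] := total_step J s.
pose delta' := (tau / B) `^ r^-1; have delta'0 : 0 < delta' by rewrite powR_gt0 // divr_gt0.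
have dd0 : 0 < d%:R :> R by rewrite ltr0n (adm_d H).
pose delta := delta' / (2 * d%:R).
have delta0 : 0 < delta by rewrite divr_gt0 // mulr_gt0.
have [N hN] : exists N : R, forall f k, F f -> k \in s -> fnorm (avgv J k f) <= N.
  elim: (s) => [|k s' [N hN]]; first by exists 0.
  have [N' hN'] := avgv_bounded J k M0.
  exists (Num.max N N') => f k' Ff; rewrite inE => /orP[/eqP ->|ks].
    by rewrite le_max (hN' f (mF f Ff) (FM f Ff)) orbT.
  by rewrite le_max hN.
pose phi f (i : 'I_(size s) * 'I_d * bool) : R :=
  let z := avgv J (tnth (in_tuple s) i.1.1) f i.1.2 ord0 in
  if i.2 then complex.Re z else complex.Im z.
have phiN f : F f -> forall i, `|phi f i| <= N.
  move=> Ff [[l i] b]; have h := hN f _ Ff (mem_tnth l (in_tuple s)).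
  rewrite /phi /=; case: b; apply: le_trans h; [exact: normRe_le_fnorm|exact: normIm_le_fnorm].
have [G [finG GF hG]] := bounded_net delta0 phiN.
exists G; split=> // f Ff; have [g Gg fg] := hG f Ff; exists g => //.
have Fg := GF g Gg.
have subE (u v : 'cV[C]_d) i : (u - v) i ord0 = u i ord0 - v i ord0 by rewrite !mxE.
have ReB (z w : C) : complex.Re (z - w) = complex.Re z - complex.Re w by case: z; case: w.
have ImB (z w : C) : complex.Im (z - w) = complex.Im z - complex.Im w by case: z; case: w.
have close k : k \in s -> fnorm (avgv J k f - avgv J k g) <= delta'.
  move=> ks; have /tnthP[l ->] : k \in in_tuple s by exact: ks.
  apply: (le_trans (fnorm_le_sum _)).
  apply: (@le_trans _ _ (\sum_(i < d) (delta + delta))).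
    apply: ler_sum => i _; rewrite big_ord1 subE ReB ImB.
    have := fg (l, i, true); have := fg (l, i, false); rewrite /phi /= => h1 h2.
    by apply: lerD.
  rewrite sumr_const card_ord -mulr2n -mulrnA -mulr_natr natrM /delta.
  by rewrite divfK // gt_eqF // mulr_gt0.
pose hf := step_fun J s (fun k => avgv J k f).
pose hg := step_fun J s (fun k => avgv J k g).
have mf := mF f Ff; have mg := mF g Fg.
have mhf : mxmfun hf by exact: mxmfun_step.
have mhg : mxmfun hg by exact: mxmfun_step.
have hh : (total (fun x => hf x - hg x)%R <= tau%:E)%E.
  have -> : total (fun x => hf x - hg x) = total (step_fun J s (fun k => avgv J k f - avgv J k g)).
    by apply: eq_total => x; rewrite /hf /hg step_funB.
  apply: (le_trans (hB _ delta' (ltW delta'0) close)).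
  rewrite lee_fin /delta' -powRrM mulVf ?gt_eqF // powRr1 ?(ltW (divr_gt0 tau0 B0)) //.
  by rewrite mulrC divfK // gt_eqF.
have -> : total (fun x => f x - g x) =
    total (fun x => (f x - hf x) + ((hf x - hg x) - (g x - hg x))).
  apply: eq_total => x; move: (f x) (g x) (hf x) (hg x) => a b a' b'.
  by rewrite opprB [a' - b' + _]addrA subrK addrA subrK.
have m1 := mxmfunB mf mhf; have m2 := mxmfunB mg mhg; have m3 := mxmfunB mhf mhg.
apply: (le_trans (totalD setT m1 (mxmfunB m3 m2))).
have A0' : (0 <= A%:E)%E by rewrite lee_fin ltW.
apply: (@le_trans _ _ (A%:E * (tau%:E + A%:E * (tau%:E + tau%:E)))%E).
  apply: (lee_wpmul2l A0'); apply: leeD; first exact: hstep.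
  apply: (le_trans (totalB setT m3 m2)); apply: (lee_wpmul2l A0').
  by apply: leeD; [exact: hh|exact: hstep].
rewrite -!(EFinM, EFinD) lee_fin /tau le_eqVlt; apply/orP; left; apply/eqP.
have -> : forall u, A * (u + A * (u + u)) = (A * (1 + 2 * A)) * u by move=> u; ring.
by rewrite mulrC divfK // gt_eqF.
Qed.

(** * The necessity of the conditions *)

Let A0' : (0 <= total_const%:E)%E.
Proof. by rewrite lee_fin ltW. Qed.

Variable F : set (lebRn R n -> 'cV[C]_d).
Hypothesis mF : forall f, F f -> mxmfun f.
Hypothesis nets : forall e : R, 0 < e -> exists G : set (lebRn R n -> 'cV[C]_d),
  [/\ finite_set G, forall g, G g -> mxmfun g /\ (total g < +oo)%E &
    forall f, F f -> exists2 g, G g & (total (fun x => f x - g x)%R <= e%:E)%E].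

(** The truncations [far rho] and the averages are bounded uniformly in their
    parameters. Each of the three conditions therefore passes from the finitely many
    members of a net to the family. *)
Lemma nets_bounded : exists2 M : R, 0 <= M & forall f, F f -> (total f <= M%:E)%E.
Proof.
have [G [finG mG hG]] := nets ltr01.
have [m0 hm0] : exists m0, forall m, (m0 <= m)%N -> forall g, G g -> (total g <= m%:R%:E)%E.
  apply: finite_eventually finG _ => g /mG[_ fg].
  have g0 := total_ge0 setT g; have gE : total g = (fine (total g))%:E.
    by rewrite fineK // ge0_fin_numE.
  exists (Num.trunc (fine (total g))).+1 => m hm; rewrite gE lee_fin ltW //.
  by apply: (lt_le_trans (truncnS_gt _)); rewrite ler_nat.
exists (total_const * (1 + m0%:R)); first by rewrite mulr_ge0 ?(ltW A0) ?addr_ge0.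
move=> f Ff; have [g Gg fg] := hG f Ff; have [mg _] := mG g Gg.
have -> : total f = total (fun x => (f x - g x) + g x) by apply: eq_total => x; rewrite subrK.
apply: (le_trans (totalD setT (mxmfunB (mF Ff) mg) mg)).
rewrite (EFinM total_const); apply: (lee_wpmul2l A0'); rewrite EFinD.
by apply: leeD; [exact: fg|exact: (hm0 m0 (leqnn _) g Gg)].
Qed.

Lemma mxmfun_far (rho : R) f : mxmfun f -> mxmfun (far rho f).
Proof.
move=> mf.
have -> : far rho f = fun x => (\1_(~` (eball rho : set (lebRn R n))) x)%:C *: f x.
  apply/funext => x; rewrite /far /patch indicE.
  by case: ifP => _; rewrite ?scale1r ?scale0r.
by apply: mxmfunZ mf; apply: cmfun_real; apply: measurable_indic; apply: measurableC; exact: measurable_eball.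
Qed.

Lemma nets_far (e : R) : 0 < e -> exists rho0 : R, forall rho, rho0 <= rho ->
  forall f, F f -> (total (far rho f) <= e%:E)%E.
Proof.
move=> e0; pose e1 := e / (total_const * 2).
have e10 : 0 < e1 by rewrite divr_gt0 // mulr_gt0.
have [G [finG mG hG]] := nets e10.
have [m0 hm0] : exists m0, forall m, (m0 <= m)%N -> forall g, G g ->
    (total (far m%:R g) <= e1%:E)%E.
  apply: finite_eventually finG _ => g /mG[_ fg].
  exact: (total_far fg e10).
exists m0%:R => rho hrho f Ff; have [g Gg fg] := hG f Ff; have [mg _] := mG g Gg.
have mfg := mxmfunB (mF Ff) mg.
have -> : total (far rho f) = total (fun x => far rho (fun x => f x - g x) x + far rho g x).
  by apply: eq_total => x; rewrite /far /patch; case: ifP; rewrite ?addr0 ?subrK.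
apply: (le_trans (totalD setT (mxmfun_far rho mfg) (mxmfun_far rho mg))).
apply: (@le_trans _ _ (total_const%:E * (e1%:E + e1%:E))%E).
  apply: (lee_wpmul2l A0'); apply: leeD.
    by apply: le_trans fg; apply: (le_total) => x; exact: wnorm_patch_le.
  apply: le_trans (hm0 m0 (leqnn _) g Gg); apply: (le_total) => x.
  have [xr|xr] := pselect ((~` eball rho : set 'rV[R]_n) x).
    have xm : (~` eball m0%:R : set 'rV[R]_n) x.
      by move=> xm; apply: xr; apply: lt_le_trans hrho.
    by rewrite /wnorm /far !patchT // inE.
  by rewrite {1}/wnorm /far patchN ?mulmx0 ?fnorm0 ?wnorm_ge0 // notin_setE.
rewrite -EFinD -EFinM lee_fin /e1 le_eqVlt; apply/orP; left; apply/eqP.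
have -> : forall u, total_const * (u + u) = u * (total_const * 2) by move=> u; ring.
by rewrite divfK // gt_eqF // mulr_gt0.
Qed.

Lemma avg_funB J f g x : mxmfun f -> mxmfun g -> (total f < +oo)%E -> (total g < +oo)%E ->
  avg_fun J (fun x => f x - g x) x = avg_fun J f x - avg_fun J g x.
Proof.
move=> mf mg ff fg; pose k := cube_index J x.
have f1 := mass_fin J k ff; have g1 := mass_fin J k fg.
have h := avg_linear H (-1) mg mf g1 f1.
rewrite /avg_fun -/k addrC -scaleN1r -h; apply: avgv_congr => y _.
by rewrite scaleN1r addrC.
Qed.

Lemma nets_avg (e : R) : (forall f, F f -> (total f < +oo)%E) -> 0 < e ->
  exists J0 : nat, forall J : int, J0%:Z <= J ->
  forall f, F f -> (total (fun x => f x - avg_fun J f x)%R <= e%:E)%E.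
Proof.
move=> fF e0; have [K K0 hK] := total_avg.
set A := total_const.
(* [D] collects two quasi-triangle inequalities and the bound [K] of the averages. *)
pose D := A * (1 + A * (K + 1)).
have D0 : 0 < D by rewrite mulr_gt0 // addr_gt0 // mulr_gt0 // addr_gt0.
have e10 : 0 < e / D by rewrite divr_gt0.
have [G [finG mG hG]] := nets e10.
have [m0 hm0] : exists m0, forall m, (m0 <= m)%N -> forall g, G g ->
    (total (fun x => g x - avg_fun m%:Z g x)%R <= (e / D)%:E)%E.
  apply: finite_eventually finG _ => g /mG[mg fg].
  exact: (total_avg_cvg mg fg e10).
exists m0 => -[m|//]; rewrite lez_nat => m0m f Ff.
have [g Gg fg] := hG f Ff; have [mg fg'] := mG g Gg.
have mf := mF Ff; have mfg := mxmfunB mf mg.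
have -> : total (fun x => f x - avg_fun m%:Z f x) = total (fun x => (f x - g x) -
    (avg_fun m%:Z (fun x => f x - g x) x - (g x - avg_fun m%:Z g x))).
  apply: eq_total => x; rewrite (avg_funB m%:Z x mf mg (fF f Ff) fg').
  move: (f x) (g x) (avg_fun _ f x) (avg_fun _ g x) => a b a' b'.
  by rewrite !opprB [b - b' + _]addrA subrK addrA subrK.
have m1 : mxmfun (avg_fun m%:Z (fun x => f x - g x)) by exact: mxmfun_avg.
have m2 := mxmfunB mg (mxmfun_avg m%:Z g).
apply: (le_trans (totalB setT mfg (mxmfunB m1 m2))).
apply: (@le_trans _ _ (A%:E * ((e / D)%:E + A%:E * (K%:E * (e / D)%:E + (e / D)%:E)))%E).
  apply: (lee_wpmul2l A0'); apply: leeD; first exact: fg.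
  apply: (le_trans (totalB setT m1 m2)); apply: (lee_wpmul2l A0').
  apply: leeD; last exact: (hm0 m m0m g Gg).
  apply: (le_trans (hK m%:Z _ mfg)); apply: lee_wpmul2l; [by rewrite lee_fin ltW|exact: fg].
rewrite -!(EFinM, EFinD) lee_fin le_eqVlt; apply/orP; left; apply/eqP.
have -> : forall u, A * (u + A * (K * u + u)) = u * D by move=> u; rewrite /D; ring.
by rewrite divfK // gt_eqF.
Qed.

End total.

(** * The Kolmogorov-Riesz theorem *)

Section suprema.
Context {R : realType} {n d : nat}.
Local Notation C := R[i].
Variable F : set ('rV[R]_n -> 'cV[C]_d).
Implicit Types (N : ('rV[R]_n -> 'cV[C]_d) -> \bar R).

Lemma family_sup_ge0 N : (0 <= family_sup F N)%E.
Proof. by rewrite /family_sup le_max lexx. Qed.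

Lemma family_sup_le N (e : R) : 0 <= e ->
  (family_sup F N <= e%:E)%E <-> forall f, F f -> (N f <= e%:E)%E.
Proof.
move=> e0; rewrite /family_sup ge_max lee_fin e0 /=; split=> [h f Ff|h].
  by apply: le_trans h; apply: ereal_sup_ubound; exists f.
by apply: ge_ereal_sup => _ [f Ff <-]; exact: h.
Qed.

Lemma cvg0_le (T : Type) (Fl : set_system T) (FF : Filter Fl) (g : T -> \bar R) :
  (forall x, (0 <= g x)%E) ->
  (g x @[x --> Fl] --> 0%E) <-> forall e : R, 0 < e -> \forall x \near Fl, (g x <= e%:E)%E.
Proof.
move=> g0; split.
  move=> /fine_cvgP[fin /cvgrPdist_le h] e e0; have := h e e0.
  move=> he; near=> x.
  have xf : g x \is a fin_num by near: x.
  have : `|0 - fine (g x)| <= e by near: x.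
  rewrite sub0r normrN => /(le_trans (ler_norm _)).
  by rewrite -lee_fin fineK.
move=> h; apply/fine_cvgP; split.
  near=> x; rewrite ge0_fin_numE //; apply: (@le_lt_trans _ _ 1%:E); last exact: ltry.
  by near: x; exact: h.
apply/cvgrPdist_le => e e0; near=> x.
have xe : (g x <= e%:E)%E by near: x; exact: h.
rewrite /= sub0r normrN ger0_norm ?fine_ge0 //.
rewrite -lee_fin fineK // ge0_fin_numE //.
exact: le_lt_trans xe (ltry _).
Unshelve. all: end_near. Qed.

End suprema.

Lemma int_ninfty_filter : Filter int_ninfty_nbhs.
Proof.
apply: filter_from_filter; first by exists 0.
move=> i j _ _; exists (Num.min i j) => // a /=.
by rewrite le_min => /andP[].
Qed.

Theorem theorem4p7 (R : realType) (n d : nat) (p t r : R)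
    (W : 'rV[R]_n -> 'M[R[i]]_d) (dt dtt : R)
    (F : set ('rV[R]_n -> 'cV[R[i]]_d)) :
  (0 < n)%N -> (0 < d)%N ->
  1 <= p -> p < t -> t < r ->
  matrix_weight W -> Ap_class p W ->
  0 <= dt -> dt < n%:R -> Ap_dimension p W dt ->
  (1 < p ->
     Ap_dimension (conj_exp p) (fun x => mxpow (W x) (- (p - 1)^-1)) dtt) ->
  let beta := if p == 1 then n%:R else n%:R + dtt * p / conj_exp p in
  - n%:R * r / p + dt * r / p + n%:R - beta * r * (t^-1 - p^-1) < 0 ->
  F `<=` BM_space p t r W ->
  BM_totally_bounded p t r W F <->
  [/\ (family_sup F (BM_norm p t r W) < +oo)%E,
      family_sup F (fun f => BM_norm p t r W (patch (fun=> 0) (~` eball rho) f))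
        @[rho --> +oo] --> 0%E &
      family_sup F (fun f => BM_norm p t r W (f \- dyadic_average a f))
        @[a --> int_ninfty_nbhs] --> 0%E].
Proof.
move=> n0 d0 p1 pt tr [Wnn Wunit Wloc] _ _ _ Wdim Wdual beta hdecay FBM.
have H : admissible p dt W.
  by split; [exact: d0|exact: p1|exact: Wnn|exact: Wunit|by move=> i j; have [] := Wloc i j|exact: Wdim].
have wfin := wdens_fin H Wloc.
have [wt Hw] := dyadic_weightsP H Wdual Wloc n0.
have p0 := adm_p0 H.
have r0 : 0 < r := lt_trans (lt_trans p0 pt) tr.
have decay : (dt - n%:R) * (r / p) - beta * ((t^-1 - p^-1) * r) + n%:R < 0.
  move: hdecay; congr (_ < 0); ring.
clear hdecay.
have leE f e := @BM_norm_le R n d p dt W H beta wt Hw t r pt tr f e.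
have finE f := @BM_norm_fin R n d p dt W H beta wt Hw t r pt tr f.
have mF f : F f -> mxmfun (f : lebRn R n -> 'cV[R[i]]_d).
  by move=> /FBM[[mf _] _] i j; rewrite (ord1 j); exact: mf.
have fF f : F f -> (total_on p W wt t r setT f < +oo)%E.
  by move=> /FBM[_]; rewrite finE.
have root e : 0 < e -> exists2 e' : R, 0 < e' & e' `^ r = e.
  move=> e0; exists (e `^ r^-1); first by rewrite powR_gt0.
  by rewrite -powRrM mulVf ?gt_eqF // powRr1 // ltW.
have avgE a f : (f \- dyadic_average a f) = (fun x => f x - avg_fun (- a) f x).
  by rewrite dyadic_averageE.
split.
  move=> tb.
  have nets (e : R) : 0 < e -> exists G : set (lebRn R n -> 'cV[R[i]]_d), [/\ finite_set G,
      forall g, G g -> mxmfun g /\ (total_on p W wt t r setT g < +oo)%E &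
      forall f, F f -> exists2 g, G g & (total_on p W wt t r setT (fun x => f x - g x)%R <= e%:E)%E].
    move=> e0; have [e' e'0 e'E] := root e e0; have [G [finG GBM hG]] := tb _ e'0.
    exists G; split; first exact: finG.
      move=> g /GBM[[mg _] fg]; split; last by rewrite -finE.
      by move=> i j; rewrite (ord1 j); exact: mg.
    move=> f Ff; have [g Gg fg] := hG f Ff; exists g; first exact: Gg.
    by rewrite -e'E -leE ?(ltW e'0) //; exact: ltW fg.
  split.
  - have [M M0 hM] := nets_bounded H Hw pt tr mF nets.
    have M1 : 0 < M + 1 by rewrite ltr_wpDl.
    have [N N0 NE] := root _ M1.
    apply: (@le_lt_trans _ _ N%:E); last exact: ltry.
    apply/family_sup_le; first exact: ltW.
    move=> f Ff; rewrite leE ?(ltW N0) // NE; apply: (le_trans (hM f Ff)).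
    by rewrite lee_fin lerDl.
  - apply/cvg0_le => [rho|e e0]; first exact: family_sup_ge0.
    have er : 0 < e `^ r by rewrite powR_gt0.
    have [rho0 h] := nets_far H Hw pt tr mF nets er.
    exists rho0; split; first exact: num_real.
    move=> rho /ltW hrho; apply/family_sup_le; first exact: ltW.
    by move=> f Ff; rewrite leE ?(ltW e0) //; exact: h.
  apply/(cvg0_le int_ninfty_filter) => [a|e e0]; first exact: family_sup_ge0.
  have er : 0 < e `^ r by rewrite powR_gt0.
  have [J0 h] := nets_avg H wfin Hw pt tr decay mF nets fF er.
  exists (- J0%:Z) => // a /= aJ; apply/family_sup_le; first exact: ltW.
  move=> f Ff; rewrite avgE leE ?(ltW e0) //; apply: h => //.
  by rewrite lerNr.
move=> [bd far0 avg0] e e0.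
have [M M0 hM] : exists2 M : R, 0 <= M & forall f, F f -> (total_on p W wt t r setT f <= M%:E)%E.
  have s0 := family_sup_ge0 F (BM_norm p t r W).
  have sfin : family_sup F (BM_norm p t r W) \is a fin_num by rewrite ge0_fin_numE.
  have N0 : 0 <= fine (family_sup F (BM_norm p t r W)) by exact: fine_ge0.
  exists (fine (family_sup F (BM_norm p t r W)) `^ r); first exact: powR_ge0.
  move=> f Ff; rewrite -leE //; move: f Ff; apply/family_sup_le => //.
  by rewrite fineK.
have far1 (u : R) : 0 < u -> exists rho : R, forall f, F f ->
    (total_on p W wt t r setT (far rho f) <= u%:E)%E.
  move=> u0; have [u' u'0 uE] := root u u0.
  have fs0 rho : (0 <= family_sup F (fun f => BM_norm p t r W (patch (fun=> 0)%R (~` eball rho) f)))%E.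
    exact: family_sup_ge0.
  have /(cvg0_le _ fs0) /(_ u' u'0) [rho [_ h]] := far0.
  exists (rho + 1) => f Ff; rewrite -uE -leE ?(ltW u'0) //; move: f Ff.
  apply/family_sup_le; first exact: ltW.
  by apply: h; rewrite ltrDl.
have avg1 (u : R) : 0 < u -> exists J, forall f, F f ->
    (total_on p W wt t r setT (fun x => f x - avg_fun J f x)%R <= u%:E)%E.
  move=> u0; have [u' u'0 uE] := root u u0.
  have fs0 a : (0 <= family_sup F (fun f => BM_norm p t r W (f \- dyadic_average a f)%R))%E.
    exact: family_sup_ge0.
  have /(cvg0_le int_ninfty_filter fs0) /(_ u' u'0) [a _ h] := avg0.
  exists (- a) => f Ff; rewrite -uE -leE ?(ltW u'0) // -avgE; move: f Ff.
  by apply/family_sup_le; [exact: ltW|apply: h => /=].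
have e2 : 0 < e / 2 by rewrite divr_gt0.
have er : 0 < (e / 2) `^ r by rewrite powR_gt0.
have [G [finG GF hG]] :=
  totally_bounded_criterion H wfin Hw pt tr decay mF M0 hM far1 avg1 er.
exists G; split; [exact: finG|by move=> g /GF /FBM|].
move=> f Ff; have [g Gg fg] := hG f Ff; exists g; first exact: Gg.
apply: (@le_lt_trans _ _ (e / 2)%:E); last by rewrite lte_fin ltr_pdivrMr // ltr_pMr // ltr1n.
by rewrite leE ?(ltW e2).
Qed.
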